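(* Consider the system of five equations for $(\zeta,\delta,\gamma,\beta,\alpha)$ $$m\int_\beta^\alpha s^{-m-1}h(s)\,ds+rK_0\beta^{-m}+rK_1\alpha^{-m}=0,\qquad n\int_\beta^\alpha s^{-n-1}h(s)\,ds+rK_0\beta^{-n}+rK_1\alpha^{-n}=0,$$ $$n\int_\delta^\infty s^{-n-1}[h(s)+rK]\,ds-n\int_\gamma^\beta s^{-n-1}[h(s)+rK_0]\,ds=0,$$ $$n\int_\beta^\infty s^{-n-1}[h(s)+rK_0]\,ds+rK\zeta^{-n}=0,$$ $$m\int_0^\gamma s^{-m-1}[h(s)+rK_0]\,ds-m\int_0^\delta s^{-m-1}[h(s)+rK]\,ds-rK\zeta^{-m}=0,\qquad(\ast)$$ and, given a solution, let $$\Gamma_1=-\tfrac1{\sigma^2(n-m)}\int_0^\delta s^{-m-1}[h(s)+rK]\,ds,\qquad\Gamma_2=-\tfrac1{\sigma^2(n-m)}\int_\delta^\infty s^{-n-1}[h(s)+rK]\,ds,$$ $$\Delta_1=\tfrac{rK\zeta^{-m}}{\sigma^2m(n-m)},\qquad\Delta_2=-\tfrac{rK\zeta^{-n}}{\sigma^2n(n-m)},\qquad A=\Delta_1-\tfrac1{\sigma^2(n-m)}\int_0^\alpha s^{-m-1}[h(s)-rK_1]\,ds,$$ $$w_1(x)=\begin{cases}-K,&x\le\delta,\\ \Gamma_1x^m+\Gamma_2x^n+R_h(x),&\delta<x<\gamma,\\ \Delta_1x^m+\Delta_2x^n-K_0,&\gamma\le x\le\beta,\\ Ax^m+R_h(x),&x>\beta,\end{cases}\qquad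 w_0(x)=\begin{cases}-K,&x\le\zeta,\\ \Delta_1x^m+\Delta_2x^n,&\zeta<x<\alpha,\\ Ax^m+R_h(x)-K_1,&x\ge\alpha.\end{cases}$$ Then the following are equivalent: (i) the system $(\ast)$ has a unique solution $(\zeta,\delta,\gamma,\beta,\alpha)$ such that $0<\zeta<\alpha$ and $0<\delta<\gamma<\beta<\alpha$, the constants $\Gamma_1,\Gamma_2,A,\Delta_1,\Delta_2$ are strictly positive, and the functions $w_1,w_0$ are increasing and satisfy the HJB equation (stated in the context); (ii) $K<0$, $h(0)<-rK_0$, $h(\delta_\dagger)<0$, $K_1<K_1^\dagger$ and $K_0<K_0^\dagger$, where $\delta_\dagger>0$, $K_1^\dagger>0$ (which depends on all problem data except $K_1,K_0$) and $K_0^\dagger>0$ (which depends on all problem data except $K_0$) are the points defined in the context.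
   Context: Let $b\in\mathbb R$, $\sigma\ne0$, $r>0$ be constants, $W$ a standard one-dimensional Brownian motion and, for $x>0$, let $X$ solve $dX_t=bX_t\,dt+\sqrt2\,\sigma X_t\,dW_t$, $X_0=x$. Standing assumption: $h:(0,\infty)\to\mathbb R$ is right-continuous and increasing (i.e. nondecreasing; ''increasing'' always means nondecreasing), $\lim_{x\to\infty}h(x)=\infty$, $\mathbb E[\int_0^\infty e^{-rt}|h(X_t)|\,dt]<\infty$ for every $x>0$; $K_1,K_0>0$, $K\in\mathbb R$. Put $h(0):=\lim_{x\downarrow0}h(x)\in[-\infty,\infty)$. The constants $m<0<n$ are $m,n=\frac1{2\sigma^2}\big[\sigma^2-b\mp\sqrt{(b-\sigma^2)^2+4\sigma^2r}\big]$, and $$R_h(x)=\frac1{\sigma^2(n-m)}\Big[x^m\int_0^xs^{-m-1}h(s)\,ds+x^n\int_x^\infty s^{-n-1}h(s)\,ds\Big]=\mathbb E\Big[\int_0^\infty e^{-rs}h(X_s)\,ds\Big].$$ HJB equation: $w_1,w_0:(0,\infty)\to\mathbb R$ satisfy the HJB equation if they are $C^1$ with locally absolutely continuous first derivatives and, for Lebesgue-a.e. $x>0$, $$\max\{\sigma^2x^2w_1''(x)+bxw_1'(x)-rw_1(x)+h(x),\ w_0(x)-w_1(x)-K_0,\ -w_1(x)-K\}=0,$$ $$\max\{\sigma^2x^2w_0''(x)+bxw_0'(x)-rw_0(x),\ w_1(x)-w_0(x)-K_1,\ -w_0(x)-K\}=0.$$ Definition of $\delta_\dagger,K_1^\dagger,K_0^\dagger$.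 Suppose $K<0$ and $h(0)<-rK$ (which holds if $K<0$ and $h(0)<-rK_0$). Then $\delta_\dagger>0$ is the unique solution of $\int_{\delta_\dagger}^\infty s^{-n-1}[h(s)+rK]\,ds=0$. Let $$G_1(\delta_\dagger,\zeta,\alpha)=m\int_{\delta_\dagger}^\alpha s^{-m-1}[h(s)-rK_1]\,ds+r(K_1+K)\delta_\dagger^{-m}-rK\zeta^{-m},$$ $$G_2(\delta_\dagger,\zeta,\alpha)=-n\int_{\delta_\dagger}^\alpha s^{-n-1}[h(s)-rK_1]\,ds-r(K_1+K)\delta_\dagger^{-n}+rK\zeta^{-n},$$ and let $(\zeta_\dagger,\alpha_\dagger)=(\zeta_\dagger(K_1),\alpha_\dagger(K_1))$ be the unique pair with $\zeta_\dagger>0$, $\delta_\dagger\vee\zeta_\dagger<\alpha_\dagger$ and $G_1(\delta_\dagger,\zeta_\dagger,\alpha_\dagger)=G_2(\delta_\dagger,\zeta_\dagger,\alpha_\dagger)=0$. If $h(\delta_\dagger)<0$, then $K_1^\dagger>0$ is the unique value of $K_1>0$ (all other data fixed) such that $G_2(\delta_\dagger,\delta_\dagger,\alpha_\dagger(K_1);K_1)=0$, the dependence of $\alpha_\dagger$ and $G_2$ on $K_1$ being made explicit. If $h(\delta_\dagger)<0$ and $K_1<K_1^\dagger$, let $\hat x\in(\delta_\dagger,\alpha_\dagger)$ be the unique solution of $m\hat x^m\int_{\hat x}^{\alpha_\dagger}s^{-m-1}[h(s)-rK_1]\,ds-n\hat x^n\int_{\hat x}^{\alpha_\dagger}s^{-n-1}[h(s)-rK_1]\,ds=0$;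 then $K_0^\dagger=-K_1-\frac{n\hat x^n}{r}\int_{\hat x}^{\alpha_\dagger}s^{-n-1}[h(s)-rK_1]\,ds$. (The point $\alpha_\dagger$ is in general different from $\alpha$ in the claim.) *)

(* Defs.v *)
From HB Require Import structures.
From mathcomp Require Import all_boot all_order all_algebra.
From mathcomp Require Import all_classical all_reals all_analysis.
Set Implicit Arguments.
Unset Strict Implicit.
Unset Printing Implicit Defensive.
Import Order.TTheory GRing.Theory Num.Theory.
Import numFieldNormedType.Exports.
Local Open Scope classical_set_scope.
Local Open Scope ring_scope.

(* MathComp-Analysis development over an arbitrary [R : realType].            *)
(* Functions on (0, +oo) are total functions [R -> R] about which nothing is  *)
(* assumed, and of which nothing is used, on ]-oo, 0].                        *)

(* Processes are indexed by R, and only times t >= 0 are constrained.         *)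
(* [normal_prob] takes the standard deviation, so W_t - W_s ~ N(0, t - s).    *)
(* As any of the events may be setT, the product rule over all finite         *)
(* nondecreasing sequences of times is mutual independence of the increments. *)
Definition brownian_motion (R : realType) (d : measure_display)
    (T : measurableType d) (P : probability T R) (W : R -> {RV P >-> R}) :=
  [/\ {ae P, forall w, W 0 w = 0},
      forall w, {within [set t : R | 0 <= t], continuous (fun t => W t w)},
      forall (s t : R) (B : set R), 0 <= s -> s < t -> measurable B ->
        P [set w | B (W t w - W s w)] = normal_prob 0 (Num.sqrt (t - s)) B
    & forall (k : nat) (t : nat -> R) (B : nat -> set R),
        0 <= t 0%N -> (forall i, (i < k)%N -> t i <= t i.+1) ->
        (forall i, (i < k)%N -> measurable (B i)) ->
        P [set w | forall i, (i < k)%N -> B i (W (t i.+1) w - W (t i) w)]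
        = (\prod_(i < k) P [set w | B i (W (t i.+1) w - W (t i) w)%R])%E].

(* The unique strong solution of                                              *)
(*   dX_t = b X_t dt + sqrt 2 sigma X_t dW_t, X_0 = x,                        *)
(* the drift of log X being b - (sqrt 2 sigma)^2 / 2.                         *)
Definition geometric_bm (R : realType) (T : Type) (b sigma : R)
    (W : R -> T -> R) (x t : R) (w : T) : R :=
  x * expR ((b - sigma ^+ 2) * t + Num.sqrt 2 * sigma * W t w).

Definition increasing_pos (R : realType) (f : R -> R) :=
  forall x y : R, 0 < x -> x <= y -> f x <= f y.

(* h(0), an extended real. *)
Definition right_lim0 (R : realType) (h : R -> R) : \bar R :=
  lim ((h x)%:E @[x --> (0 : R)^'+]).

Definition payoff_assumption (R : realType) (d : measure_display)
    (T : measurableType d) (P : probability T R) (W : R -> {RV P >-> R})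
    (b sigma r : R) (h : R -> R) :=
  [/\ forall x : R, 0 < x -> h y @[y --> x^'+] --> h x,
      increasing_pos h,
      h x @[x --> +oo] --> +oo
    & forall x : R, 0 < x ->
        (\int[P]_w \int[lebesgue_measure]_(t in `[0%R, +oo[)
           (expR (- r * t) * `|h (geometric_bm b sigma W x t w)|)%:E < +oo)%E].

Definition abs_continuous (R : realType) (f : R -> R) (a b : R) :=
  forall e : R, 0 < e -> exists2 d : R, 0 < d &
    forall (k : nat) (u v : nat -> R),
      (forall i, (i < k)%N -> [/\ a <= u i, u i <= v i & v i <= b]) ->
      trivIset `I_k (fun i => `]u i, v i[%classic) ->
      \sum_(i < k) (v i - u i) < d ->
      \sum_(i < k) `|f (v i) - f (u i)| < e.

(* C^1 on (0, +oo) with locally absolutely continuous derivative.  Such an f  *)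
(* is twice differentiable almost everywhere.                                 *)
Definition C1_AC (R : realType) (f : R -> R) :=
  [/\ forall x : R, 0 < x -> derivable f x 1,
      forall x : R, 0 < x -> {for x, continuous (derive1 f)}
    & forall a b : R, 0 < a -> a <= b -> abs_continuous (derive1 f) a b].

Definition HJB (R : realType) (b sigma r : R) (h : R -> R) (K1 K0 K : R)
    (w1 w0 : R -> R) :=
  [/\ C1_AC w1, C1_AC w0,
      {ae lebesgue_measure, forall x : R, 0 < x ->
        Num.max
          (sigma ^+ 2 * x ^+ 2 * derive1n 2 w1 x + b * x * derive1 w1 x
             - r * w1 x + h x)
          (Num.max (w0 x - w1 x - K0) (- w1 x - K)) = 0}
    & {ae lebesgue_measure, forall x : R, 0 < x ->
        Num.max
          (sigma ^+ 2 * x ^+ 2 * derive1n 2 w0 x + b * x * derive1 w0 x - r * w0 x)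
          (Num.max (w1 x - w0 x - K1) (- w0 x - K)) = 0}].

(* The exponents m < 0 < n. *)
Definition exp_m (R : realType) (b sigma r : R) : R :=
  (2 * sigma ^+ 2)^-1 * (sigma ^+ 2 - b
    - Num.sqrt ((b - sigma ^+ 2) ^+ 2 + 4 * sigma ^+ 2 * r)).
Definition exp_n (R : realType) (b sigma r : R) : R :=
  (2 * sigma ^+ 2)^-1 * (sigma ^+ 2 - b
    + Num.sqrt ((b - sigma ^+ 2) ^+ 2 + 4 * sigma ^+ 2 * r)).

(* The integral of s^(-k-1) (h(s) + c) over the interval i. *)
Definition pint (R : realType) (h : R -> R) (k c : R) (i : interval R) : R :=
  \int[lebesgue_measure]_(s in [set` i]) (s `^ (- k - 1) * (h s + c)).

Definition R_h (R : realType) (b sigma r : R) (h : R -> R) (x : R) : R :=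
  let m := exp_m b sigma r in let n := exp_n b sigma r in
  (sigma ^+ 2 * (n - m))^-1 *
    (x `^ m * pint h m 0 `]0, x[ + x `^ n * pint h n 0 `]x, +oo[).

(* In [delta_dag], [za_dag], [K1_dag] and [x_hat], "the" solution of a        *)
(* problem is rendered by [get], which picks a member of the set of           *)
(* solutions, or a default value when that set is empty.  With K < 0 and      *)
(* h(0) < - r K (and h(delta_dag) < 0 for K1_dag, in addition K1 < K1_dag for *)
(* x_hat) the solution exists and is unique.                                  *)

Definition delta_dag (R : realType) (b sigma r : R) (h : R -> R) (K : R) : R :=
  let n := exp_n b sigma r in
  get [set delta : R | 0 < delta /\ pint h n (r * K) `]delta, +oo[ = 0].

Definition G1 (R : realType) (b sigma r : R) (h : R -> R) (K K1 : R)
    (delta zeta alpha : R) : R :=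
  let m := exp_m b sigma r in
  m * pint h m (- (r * K1)) `]delta, alpha[
  + r * (K1 + K) * delta `^ (- m) - r * K * zeta `^ (- m).

Definition G2 (R : realType) (b sigma r : R) (h : R -> R) (K K1 : R)
    (delta zeta alpha : R) : R :=
  let n := exp_n b sigma r in
  - n * pint h n (- (r * K1)) `]delta, alpha[
  - r * (K1 + K) * delta `^ (- n) + r * K * zeta `^ (- n).

(* The pair (zeta_dag, alpha_dag). *)
Definition za_dag (R : realType) (b sigma r : R) (h : R -> R) (K K1 : R)
    : R * R :=
  let delta := delta_dag b sigma r h K in
  get [set za : R * R | [/\ 0 < za.1, Num.max delta za.1 < za.2,
         G1 b sigma r h K K1 delta za.1 za.2 = 0
       & G2 b sigma r h K K1 delta za.1 za.2 = 0]].

Definition alpha_dag (R : realType) (b sigma r : R) (h : R -> R) (K K1 : R)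
    : R := (za_dag b sigma r h K K1).2.

Definition K1_dag (R : realType) (b sigma r : R) (h : R -> R) (K : R) : R :=
  let delta := delta_dag b sigma r h K in
  get [set K1 : R | 0 < K1 /\
         G2 b sigma r h K K1 delta delta (alpha_dag b sigma r h K K1) = 0].

Definition x_hat (R : realType) (b sigma r : R) (h : R -> R) (K K1 : R) : R :=
  let m := exp_m b sigma r in let n := exp_n b sigma r in
  let alpha := alpha_dag b sigma r h K K1 in
  get [set x : R | [/\ delta_dag b sigma r h K < x, x < alpha
     & m * x `^ m * pint h m (- (r * K1)) `]x, alpha[
       - n * x `^ n * pint h n (- (r * K1)) `]x, alpha[ = 0]].

Definition K0_dag (R : realType) (b sigma r : R) (h : R -> R) (K K1 : R) : R :=
  let n := exp_n b sigma r in
  let x := x_hat b sigma r h K K1 in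
  - K1 - n * x `^ n / r
         * pint h n (- (r * K1)) `]x, alpha_dag b sigma r h K K1[.

Definition free_boundary_system (R : realType) (b sigma r : R) (h : R -> R)
    (K1 K0 K : R) (zeta delta gamma beta alpha : R) :=
  let m := exp_m b sigma r in let n := exp_n b sigma r in
  [/\ m * pint h m 0 `]beta, alpha[ + r * K0 * beta `^ (- m)
        + r * K1 * alpha `^ (- m) = 0,
      n * pint h n 0 `]beta, alpha[ + r * K0 * beta `^ (- n)
        + r * K1 * alpha `^ (- n) = 0,
      n * pint h n (r * K) `]delta, +oo[
        - n * pint h n (r * K0) `]gamma, beta[ = 0,
      n * pint h n (r * K0) `]beta, +oo[ + r * K * zeta `^ (- n) = 0
    & m * pint h m (r * K0) `]0, gamma[ - m * pint h m (r * K) `]0, delta[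
        - r * K * zeta `^ (- m) = 0].

Definition ordered_points (R : realType) (zeta delta gamma beta alpha : R) :=
  [/\ 0 < zeta, zeta < alpha & [/\ 0 < delta, delta < gamma, gamma < beta
    & beta < alpha]].

Definition Gamma1 (R : realType) (b sigma r : R) (h : R -> R) (K delta : R)
    : R :=
  let m := exp_m b sigma r in let n := exp_n b sigma r in
  - (sigma ^+ 2 * (n - m))^-1 * pint h m (r * K) `]0, delta[.

Definition Gamma2 (R : realType) (b sigma r : R) (h : R -> R) (K delta : R)
    : R :=
  let m := exp_m b sigma r in let n := exp_n b sigma r in
  - (sigma ^+ 2 * (n - m))^-1 * pint h n (r * K) `]delta, +oo[.

Definition Delta1 (R : realType) (b sigma r K zeta : R) : R :=
  let m := exp_m b sigma r in let n := exp_n b sigma r in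
  r * K * zeta `^ (- m) / (sigma ^+ 2 * m * (n - m)).

Definition Delta2 (R : realType) (b sigma r K zeta : R) : R :=
  let m := exp_m b sigma r in let n := exp_n b sigma r in
  - (r * K * zeta `^ (- n) / (sigma ^+ 2 * n * (n - m))).

Definition coef_A (R : realType) (b sigma r : R) (h : R -> R)
    (K1 K zeta alpha : R) : R :=
  let m := exp_m b sigma r in let n := exp_n b sigma r in
  Delta1 b sigma r K zeta
  - (sigma ^+ 2 * (n - m))^-1 * pint h m (- (r * K1)) `]0, alpha[.

Definition fun_w1 (R : realType) (b sigma r : R) (h : R -> R) (K1 K0 K : R)
    (zeta delta gamma beta alpha : R) (x : R) : R :=
  let m := exp_m b sigma r in let n := exp_n b sigma r in
  if x <= delta then - K
  else if x < gamma then
    Gamma1 b sigma r h K delta * x `^ m + Gamma2 b sigma r h K delta * x `^ n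
      + R_h b sigma r h x
  else if x <= beta then
    Delta1 b sigma r K zeta * x `^ m + Delta2 b sigma r K zeta * x `^ n - K0
  else coef_A b sigma r h K1 K zeta alpha * x `^ m + R_h b sigma r h x.

Definition fun_w0 (R : realType) (b sigma r : R) (h : R -> R) (K1 K : R)
    (zeta alpha : R) (x : R) : R :=
  let m := exp_m b sigma r in let n := exp_n b sigma r in
  if x <= zeta then - K
  else if x < alpha then
    Delta1 b sigma r K zeta * x `^ m + Delta2 b sigma r K zeta * x `^ n
  else coef_A b sigma r h K1 K zeta alpha * x `^ m + R_h b sigma r h x - K1.

(* Main.v *)
Require Import Defs.
From HB Require Import structures.
From mathcomp Require Import all_boot all_order all_algebra.
From mathcomp Require Import all_classical all_reals all_analysis.
From mathcomp Require Import measurable_realfun.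
From mathcomp Require Import ring lra.
Set Implicit Arguments.
Unset Strict Implicit.
Unset Printing Implicit Defensive.
Import Order.TTheory GRing.Theory Num.Theory.
Import numFieldNormedType.Exports.
Local Open Scope classical_set_scope.
Local Open Scope ring_scope.

(* Put p = -m, M(x) = p int_0^x s^(p-1) h(s) ds, N(x) = n int_x^oo s^(-n-1) h(s) ds, k = -rK,
   k0 = rK0 and k1 = rK1.  Every solution of the inhomogeneous equation is, up to the factor r(n+p),
   n (M - mu) x^(-p) + p (N - nu) x^n for constants mu and nu, and it has value C/r and slope 0
   at t iff (mu, nu) = (M - C t^p, N - C t^(-n)) at t.  So each equation of the system says that
   two curves leave prescribed levels smoothly at two free boundaries.  As h increases, the slope,
   suitably scaled, is concave in x^(n+p), and C - h changes sign at most once; this orders the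
   possible free boundaries and gives uniqueness and all comparisons with the dagger points.

   For existence, alpha is the smallest t for which the difference w1 - w0 leaving K1 smoothly at t
   comes down to -K0 at some point beta of [delta_dag, t]; being an interior minimum, this touching
   is smooth, which is the equation for beta.  K0 < K0_dag says that at alpha_dag the difference
   goes below -K0.  Likewise gamma is the largest t <= beta for which the curve leaving
   w0 - K0 smoothly at t comes down to -K, at delta.

   The integrability of s^(-m-1) h and s^(-n-1) h follows from that of the discounted payoff and a
   lower bound of order exp(-n j) for the discounted occupation time of [j, j+1] by log X. *)

(** * Discounted occupation of Brownian motion *)

(** The integrals [pint] take a default value when they are infinite, and the only integrability
    given is that of the discounted payoff along the paths; so a probabilistic estimate has to
    precede all analysis. Afterwards h enters only through the record [moments]: its monotonicity,
    and the fact that an integral of a signed weight against h - H has the sign of its integrand.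
    This matters because h may jump, so that M and N need not be differentiable. The solutions are
    C^1 all the same, since the terms in h cancel in their first derivative; the second derivative
    is needed only almost everywhere. Nothing is differentiated with respect to a free boundary
    either. The extremal parameters come from the compactness of a triangle of pairs (boundary,
    touching point), and most of the work is to exclude its sides, where a touching would not be
    smooth. For the converse implication, the coefficient of x^m along the entry equation is
    strictly monotone in alpha, which turns an inequality between integrals into an order between
    alpha and alpha_dag. *)

Lemma brownian_joint_measurable (R : realType) (d : measure_display)
    (T : measurableType d) (P : probability T R) (W : R -> {RV P >-> R}) :
  brownian_motion W ->
  measurable_fun [set: T * R] (fun z => W (Num.max 0 z.2) z.1).
Proof.
case=> _ Wcont _ _.
(* The grid point of mesh 1/(k+1) at or below [Num.max 0 t]: sampling there is measurable on
   countably many slabs, and path continuity gives the limit. The maximum keeps the time in [0, oo),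
   where the paths are continuous. *)
pose tk (k : nat) (t : R) : R := (Num.truncn (k.+1%:R * Num.max 0 t))%:R / k.+1%:R.
have m0 (t : R) : 0 <= Num.max 0 t by rewrite le_max lexx.
apply: (@measurable_fun_cvg _ _ _ setT (fun k z => W (tk k z.2) z.1)).
- move=> k.
  pose E i := [set z : T * R | Num.truncn (k.+1%:R * Num.max 0 z.2) = i].
  have -> : setT = \bigcup_i E i.
    by apply/seteqP; split => // z _; exists (Num.truncn (k.+1%:R * Num.max 0 z.2)).
  have mE i : measurable (E i).
    rewrite (_ : E i = setT `&` snd @^-1` ((fun t : R => k.+1%:R * Num.max 0 t) @^-1` `[i%:R, i.+1%:R[)).
      apply: (measurable_snd measurableT).
      rewrite -[X in measurable X]setTI.
      have mf : measurable_fun [set: R] (fun t : R => k.+1%:R * Num.max 0 t).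
        apply: measurable_funM; first exact: measurable_cst.
        apply: measurable_maxr; [exact: measurable_cst|exact: measurable_id].
      by apply: (mf measurableT); exact: measurable_itv.
    apply/seteqP; split => [z|z [_]] /=; rewrite in_itv/=.
      by move=> <-; split => //; apply: truncn_itv; rewrite mulr_ge0.
    by move=> /truncn_def.
  apply/measurable_fun_bigcup => // i.
  apply: (@eq_measurable_fun _ _ _ _ _ (fun z => W (i%:R / k.+1%:R) z.1)).
    by move=> z; rewrite inE /E /tk/= => ->.
  apply: (@measurable_funS _ _ _ _ setT) => //.
  by apply: measurableT_comp => //; exact: measurable_fst.
- move=> [w t] _ /=.
  have : W s w @[s --> within [set s : R | 0 <= s] (nbhs (Num.max 0 t))] --> W (Num.max 0 t) w.
    by have /subspace_continuousP := Wcont w; apply; exact: m0.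
  move=> Wc; refine (@cvg_comp _ _ _ (fun k => tk k t) (fun s => W s w) _ _ _ _ Wc).
  suff cv : tk k t @[k --> \oo] --> Num.max 0 t.
    move=> B /cv cvB; rewrite nbhs_filterE /= in cvB *.
    apply: (filterS _ cvB) => k /=; apply; rewrite /tk; exact: divr_ge0.
  apply/cvgrPdist_lt => e e0.
  near=> k.
  have k0 : 0 < k.+1%:R :> R by [].
  have := truncn_itv (mulr_ge0 (ltW k0) (m0 t)) => /andP[h1 h2].
  have ke : k.+1%:R^-1 < e by near: k; exact: (near_infty_natSinv_lt (PosNum e0)).
  move: h1 h2; rewrite /tk; set u := Num.max 0 t; set v := Num.truncn _ => h1 h2.
  rewrite ger0_norm; last by rewrite subr_ge0 ler_pdivrMr// mulrC.
  apply: le_lt_trans ke.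
  rewrite lerBlDr -[X in X + _]mul1r -mulrDl ler_pdivlMr// mulrC.
  by rewrite nat1r ltW.
Unshelve. all: end_near. Qed.

(* Weighted by exp(- r t), the process mu t + c B_t moves at speed [s]: the window of width sqrt
   after the time (k + 1) / s carries a fixed share of the occupation of [k, k + 1]. *)
Lemma gaussian_window (R : realType) (mu c r : R) : c != 0 -> 0 < r ->
  let s := Num.sqrt (mu ^+ 2 + 2 * c ^+ 2 * r) in
  let nu := (s - mu) / c ^+ 2 in
  exists2 C : R, 0 < C & forall k t y : R, 0 <= k ->
    (k + 1) / s <= t <= (k + 1) / s + Num.sqrt ((k + 1) / s) ->
    k <= mu * t + c * y <= k + 1 ->
    C * expR (- nu * k) / Num.sqrt ((k + 1) / s)
      <= expR (- r * t) * normal_pdf 0 (Num.sqrt t) y.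
Proof.
move=> c0 r0 s nu.
have c2 : 0 < c ^+ 2 by rewrite exprn_even_gt0.
have D0 : mu ^+ 2 < mu ^+ 2 + 2 * c ^+ 2 * r.
  by rewrite ltrDl mulr_gt0// mulr_gt0.
have Dpos : 0 < mu ^+ 2 + 2 * c ^+ 2 * r by apply: le_lt_trans D0; exact: sqr_ge0.
have s0 : 0 < s by rewrite sqrtr_gt0.
have s2 : s ^+ 2 = mu ^+ 2 + 2 * c ^+ 2 * r by rewrite sqr_sqrtr// ltW.
have smu : mu < s.
  rewrite ltNge; apply/negP => smu.
  have : s ^+ 2 <= mu ^+ 2 by rewrite !expr2 ler_pM// ltW.
  by rewrite s2 leNgt D0.
have nu0 : 0 < nu by rewrite divr_gt0// subr_gt0.
have hq : 0 < 1 + Num.sqrt s by have := sqrtr_ge0 s; lra.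
have hpi : 0 < pi *+ 2 :> R by rewrite pmulrn_lgt0// pi_gt0.
(* On the window t <= tau + sqrt tau <= tau (1 + sqrt s), because s tau = k + 1 >= 1; so q sqrt tau
   bounds the normalisation of the density. *)
pose q := Num.sqrt (pi *+ 2 * (1 + Num.sqrt s)) : R.
have q0 : 0 < q by rewrite sqrtr_gt0 mulr_gt0.
exists (expR (- (nu + (s + s ^+ 2) / c ^+ 2)) / q); first by rewrite divr_gt0// expR_gt0.
move=> k t y k0; set tau := (k + 1) / s => /andP[t1 t2] /andP[y1 y2].
have tau0 : 0 < tau by rewrite divr_gt0// ltr_wpDl.
have t0 : 0 < t by exact: lt_le_trans t1.
have stau : s * tau = k + 1 by rewrite /tau mulrC divfK// gt_eqF.
have tau1 : 1 <= s * tau by rewrite stau lerDr.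
have rs : Num.sqrt tau <= tau * Num.sqrt s.
  have h : 1 <= Num.sqrt (s * tau) by rewrite -[leLHS]sqrtr1 ler_sqrt//; apply: ltW; exact: mulr_gt0.
  rewrite sqrtrM in h; last exact: ltW.
  rewrite -[in X in _ <= X * _](sqr_sqrtr (ltW tau0)) expr2.
  have := sqrtr_ge0 tau; have := sqrtr_ge0 s; nra.
have st0 : Num.sqrt t != 0 by rewrite gt_eqF// sqrtr_gt0.
rewrite normal_pdfE// /normal_peak /normal_fun subr0 (sqr_sqrtr (ltW t0)).
have E1 : Num.sqrt (t * pi *+ 2) <= q * Num.sqrt tau.
  rewrite /q -sqrtrM; last by apply: ltW; exact: mulr_gt0.
  rewrite ler_sqrt; last exact: (ltW (mulr_gt0 (mulr_gt0 hpi hq) tau0)).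
  rewrite -mulrnAr [leLHS]mulrC -mulrA ler_pM2l//.
  by rewrite mulrDl mul1r (le_trans t2)// lerD2l mulrC.
have E2 : expR (- (nu + (s + s ^+ 2) / c ^+ 2)) * expR (- nu * k)
    <= expR (- r * t) * expR (- y ^+ 2 / (t *+ 2)).
  rewrite -!expRD ler_expR.
  set z := mu * t + c * y in y1 y2.
  have yE : y = (z - mu * t) / c by rewrite /z; field.
  (* Completing the square: s^2 = mu^2 + 2 c^2 r trades the discount for the drift s and the factor
     exp(- nu z). *)
  have -> : - r * t + - y ^+ 2 / (t *+ 2) = - ((z - s * t) ^+ 2 / (2 * c ^+ 2 * t)) - nu * z.
    have rE : r = (s ^+ 2 - mu ^+ 2) / (2 * c ^+ 2).
      by rewrite s2; field; rewrite c0.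
    by rewrite rE yE /nu; field; rewrite c0 gt_eqF.
  have nuz : nu * z <= nu * k + nu by rewrite -[X in _ + X]mulr1 -mulrDr ler_pM2l.
  (* In the window s t - z lies between 0 and 1 + s sqrt tau, so its square is of order tau and the
     Gaussian factor is bounded below. *)
  have : (z - s * t) ^+ 2 / (2 * c ^+ 2 * t) <= (s + s ^+ 2) / c ^+ 2.
    rewrite ler_pdivrMr; last by apply: mulr_gt0 => //; exact: mulr_gt0.
    rewrite [leRHS](_ : _ = (s + s ^+ 2) * 2 * t); last by field; rewrite c0.
    have h1 : 0 <= s * t - z by rewrite subr_ge0 (le_trans y2)// -stau ler_pM2l.
    have h2 : s * t - z <= 1 + s * Num.sqrt tau.
      rewrite lerBlDr; apply: (@le_trans _ _ (s * (tau + Num.sqrt tau))).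
        by rewrite ler_pM2l.
      by rewrite mulrDr stau; lra.
    have h3 : (z - s * t) ^+ 2 <= (1 + s * Num.sqrt tau) ^+ 2.
      by rewrite -sqrrN opprB !expr2 ler_pM.
    apply: (le_trans h3).
    have h4 : (1 + s * Num.sqrt tau) ^+ 2 <= 2 * (1 + s ^+ 2 * tau).
      rewrite -{2}(sqr_sqrtr (ltW tau0)).
      have := sqr_ge0 (1 - s * Num.sqrt tau); lra.
    apply: (le_trans h4).
    have : s * tau <= s * t by rewrite ler_pM2l.
    have : s ^+ 2 * tau <= s ^+ 2 * t by rewrite ler_pM2l// exprn_gt0.
    lra.
  lra.
rewrite [leLHS](_ : _ = expR (- (nu + (s + s ^+ 2) / c ^+ 2)) * expR (- nu * k)
   * (q * Num.sqrt tau)^-1); last by field; rewrite !gt_eqF// sqrtr_gt0.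
rewrite [leRHS](_ : _ = expR (- r * t) * expR (- y ^+ 2 / (t *+ 2))
   * (Num.sqrt (t * pi *+ 2))^-1); last by ring.
apply: ler_pM => //.
- by rewrite invr_ge0; apply: mulr_ge0; [exact: ltW|exact: sqrtr_ge0].
- have h1 : 0 < q * Num.sqrt tau by rewrite mulr_gt0// sqrtr_gt0.
  have h2 : 0 < Num.sqrt (t * pi *+ 2).
    by rewrite sqrtr_gt0 pmulrn_lgt0// mulr_gt0// pi_gt0.
  by rewrite lef_pV2.
Qed.

(** The bound of [gaussian_window] integrated over an interval of length 1/|c|. Either sign of c
    occurs, as log X and - log X are both used. *)
Lemma normal_window (R : realType) (mu c r : R) : c != 0 -> 0 < r ->
  let s := Num.sqrt (mu ^+ 2 + 2 * c ^+ 2 * r) in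
  let nu := (s - mu) / c ^+ 2 in
  exists2 C : R, 0 < C & forall k t : R, 0 <= k ->
    (k + 1) / s <= t <= (k + 1) / s + Num.sqrt ((k + 1) / s) ->
    ((C * expR (- nu * k) / Num.sqrt ((k + 1) / s))%:E
      <= (expR (- r * t))%:E *
         normal_prob 0 (Num.sqrt t) [set y | (k <= mu * t + c * y < k + 1)%R])%E.
Proof.
move=> c0 r0 s nu.
have [C C0 H] := gaussian_window mu c0 r0.
exists (C / `|c|); first by rewrite divr_gt0// normr_gt0.
move=> k t k0 ht.
set B := [set y | _].
have mB : measurable B.
  rewrite (_ : B = (fun y => mu * t + c * y) @^-1` `[k, k + 1[); last first.
    by apply/seteqP; split => y; rewrite /B/= in_itv.
  rewrite -[X in measurable X]setTI.
  have mf : measurable_fun [set: R] (fun y : R => mu * t + c * y).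
    apply: measurable_funD; first exact: measurable_cst.
    by apply: measurable_funM; [exact: measurable_cst|exact: measurable_id].
  by apply: (mf measurableT); exact: measurable_itv.
have lB : lebesgue_measure B = (`|c|^-1)%:E.
  have [cp|cn] := ltP 0 c.
    rewrite (_ : B = `[(k - mu * t) / c, (k + 1 - mu * t) / c[%classic); last first.
      apply/seteqP; split => y; rewrite /B/= in_itv/= => /andP[h1 h2].
        by rewrite ler_pdivrMr// ltr_pdivlMr//; apply/andP; split; lra.
      by move: h1 h2; rewrite ler_pdivrMr// ltr_pdivlMr// => h1 h2; apply/andP; split; lra.
    rewrite lebesgue_measure_itv/= lte_fin ltr_pM2r ?invr_gt0// ifT; last by lra.
    by rewrite -EFinB gtr0_norm//; congr EFin; field; rewrite gt_eqF.
  have {}cn : c < 0 by rewrite lt_neqAle c0.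
  rewrite (_ : B = `](k + 1 - mu * t) / c, (k - mu * t) / c]%classic); last first.
    apply/seteqP; split => y; rewrite /B/= in_itv/= => /andP[h1 h2].
      by rewrite ltr_ndivrMr// ler_ndivlMr//; apply/andP; split; lra.
    by move: h1 h2; rewrite ltr_ndivrMr// ler_ndivlMr// => h1 h2; apply/andP; split; lra.
  rewrite lebesgue_measure_itv/= lte_fin ltr_nM2r ?invr_lt0// ifT; last by lra.
  by rewrite -EFinB ltr0_norm//; congr EFin; field; rewrite lt_eqF.
rewrite /normal_prob -ge0_integralZl//; last first.
- by move=> y _; rewrite lee_fin normal_pdf_ge0.
- by apply: measurable_funTS; apply/measurable_EFinP; exact: measurable_normal_pdf.
rewrite (_ : C / `|c| * expR (- nu * k) / Num.sqrt ((k + 1) / s)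
   = C * expR (- nu * k) / Num.sqrt ((k + 1) / s) * `|c|^-1); last by ring.
rewrite EFinM -lB -integral_cst//.
apply: ge0_le_integral => //=.
- move=> y _; rewrite lee_fin divr_ge0 ?sqrtr_ge0// mulr_ge0 ?expR_ge0//; exact: ltW.
- apply: measurable_funTS; apply/measurable_EFinP; apply: measurable_funM => //.
  exact: measurable_normal_pdf.
- move=> y; rewrite /B/= => /andP[h1 h2]; rewrite -EFinM lee_fin.
  by apply: H => //; rewrite h1 ltW.
Qed.

Lemma brownian_law (R : realType) (d : measure_display)
    (T : measurableType d) (P : probability T R) (W : R -> {RV P >-> R})
    (t : R) (B : set R) :
  brownian_motion W -> 0 < t -> measurable B ->
  P [set w | B (W t w)] = normal_prob 0 (Num.sqrt t) B.
Proof.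
move=> [W0 _ Wlaw _] t0 mB; rewrite -{2}[t]subr0 -(Wlaw 0 t B)//.
have mA1 : measurable [set w | B (W t w)].
  by rewrite -[X in measurable X]setTI; exact: measurable_funPT.
have mA2 : measurable [set w | B (W t w - W 0 w)].
  rewrite -[X in measurable X]setTI.
  have mf : measurable_fun setT (fun w => W t w - W 0 w) by exact: measurable_funB.
  exact: mf.
have PE A : measurable A -> P A = (\int[P]_w (\1_A w)%:E)%E.
  by move=> mA; rewrite integral_indic// setIT.
rewrite !PE//.
apply: ge0_ae_eq_integral => //.
- by apply/measurable_EFinP; exact: measurable_indic.
- by apply/measurable_EFinP; exact: measurable_indic.
- move: W0; apply: filterS => w W0 _; rewrite !indicE; congr ((_%:R)%:E).
  by congr nat_of_bool; apply/idP/idP; rewrite !inE /= W0 subr0.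
Qed.

(** In the k-th time window the process is in [z0 + k, z0 + k + 1[ with a discounted probability of
    order at least exp(- nu (z0 + k)) / sqrt tau_k, and there f is at least f(z0 + k); integrating
    over a window of length sqrt tau_k removes the root. The windows may overlap in time, but the
    cells are disjoint in space, so the contributions add up to at most the given integral. *)
Lemma brownian_occupation (R : realType) (d : measure_display)
    (T : measurableType d) (P : probability T R) (W : R -> {RV P >-> R})
    (mu c r z0 : R) (f : R -> R) :
  brownian_motion W -> c != 0 -> 0 < r -> 0 <= z0 ->
  measurable_fun setT f -> (forall x, 0 <= f x) ->
  (forall x y, z0 <= x -> x <= y -> f x <= f y) ->
  (\int[P]_w \int[lebesgue_measure]_(t in `[0%R, +oo[)
     (expR (- r * t) * f (mu * t + c * W t w))%:E < +oo)%E ->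
  let nu := (Num.sqrt (mu ^+ 2 + 2 * c ^+ 2 * r) - mu) / c ^+ 2 in
  exists C : R, forall K : nat,
    \sum_(k < K) f (z0 + k%:R) * expR (- nu * (z0 + k%:R)) <= C.
Proof.
move=> HW c0 r0 z00 mf f0 fmono Hfin nu.
set s := Num.sqrt (mu ^+ 2 + 2 * c ^+ 2 * r) in nu *.
have s0 : 0 < s.
  have c2 : 0 < c ^+ 2 by rewrite exprn_even_gt0.
  rewrite sqrtr_gt0; apply: ltr_wpDl; first exact: sqr_ge0.
  by apply: mulr_gt0 => //; exact: mulr_gt0.
have [C C0 HC] := normal_window mu c0 r0.
pose L (w : T) (t : R) := mu * Num.max 0 t + c * W (Num.max 0 t) w.
have mL : measurable_fun [set: T * R] (fun z => L z.1 z.2).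
  apply: measurable_funD.
    apply: measurable_funM; first exact: measurable_cst.
    apply: measurable_maxr; [exact: measurable_cst|exact: measurable_snd].
  apply: measurable_funM; first exact: measurable_cst.
  exact: brownian_joint_measurable.
pose G (z : T * R) : \bar R :=
  ((expR (- r * z.2) * f (L z.1 z.2)) * \1_(`[0%R, +oo[%classic : set R) z.2)%:E.
have G0 z : (0 <= G z)%E by rewrite lee_fin !mulr_ge0 ?expR_ge0.
have mG : measurable_fun setT G.
  apply/measurable_EFinP; apply: measurable_funM.
    apply: measurable_funM.
      apply: measurableT_comp; first exact: measurable_expR.
      by apply: measurable_funM; [exact: measurable_cst|exact: measurable_snd].
    exact: measurableT_comp.
  have m1 : measurable_fun [set: R] (\1_(`[0%R, +oo[%classic : set R) : R -> R).
    by apply: measurable_indic; exact: measurable_itv.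
  exact: (measurableT_comp m1 (@measurable_snd _ _ T R)).
have GE : (\int[lebesgue_measure]_t \int[P]_w G (w, t) < +oo)%E.
  rewrite -(fubini_tonelli (m1 := P) (m2 := lebesgue_measure) G mG G0).
  apply: le_lt_trans Hfin; rewrite le_eqVlt; apply/orP; left; apply/eqP; apply: esym; apply: eq_integral => w _.
  rewrite integral_mkcond; apply: eq_integral => t _.
  rewrite /G /= patchE indicE; case: ifPn => [ht|_]; last by rewrite mulr0.
  rewrite mulr1 /L; move: ht; rewrite inE /= in_itv/= andbT => ht.
  by rewrite (max_idPr ht).
(* The time at which a motion of speed s from 0 reaches the upper end of the k-th cell. *)
pose tau k := (z0 + k%:R + 1) / s.
pose J k := (`[tau k, tau k + Num.sqrt (tau k)]%classic : set R).
have tau0 k : 0 < tau k by rewrite divr_gt0// ltr_wpDl// addr_ge0.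
pose gk k (t : R) := f (z0 + k%:R) * (C * expR (- nu * (z0 + k%:R)) / Num.sqrt (tau k)) * \1_(J k) t.
have gk0 k t : 0 <= gk k t.
  rewrite /gk; apply: mulr_ge0 => //; apply: mulr_ge0 => //.
  by apply: divr_ge0; [rewrite mulr_ge0 ?expR_ge0// ltW|exact: sqrtr_ge0].
have mgk k : measurable_fun setT (gk k).
  apply: measurable_funM; first exact: measurable_cst.
  by apply: measurable_indic; exact: measurable_itv.
have low K t : (\sum_(k < K) (gk k t)%:E <= \int[P]_w G (w, t))%E.
  have [t0|t0] := leP t 0.
    rewrite big1 ?integral_ge0// => k _; rewrite /gk indicE memNset ?mulr0//.
    by rewrite /J/= in_itv/= => /andP[h _]; have := tau0 k; rewrite ltNge (le_trans h).
  pose A k := [set w : T | (z0 + k%:R <= mu * t + c * W t w < z0 + k%:R + 1)%R].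
  have mA k : measurable (A k).
    rewrite -[X in measurable X]setTI.
    have mg : measurable_fun setT (fun w => mu * t + c * W t w).
      apply: measurable_funD; first exact: measurable_cst.
      by apply: measurable_funM; first exact: measurable_cst.
    rewrite (_ : A k = (fun w => mu * t + c * W t w) @^-1` `[z0 + k%:R, z0 + k%:R + 1[).
      by apply: mg => //; exact: measurable_itv.
    by apply/seteqP; split => w; rewrite /A/= in_itv.
  apply: (@le_trans _ _ (\int[P]_w \sum_(k < K) (expR (- r * t) * f (z0 + k%:R) * \1_(A k) w)%:E)%E).
    rewrite ge0_integral_sum//; first last.
    - by move=> k w _; rewrite lee_fin !mulr_ge0 ?expR_ge0.
    - move=> k; apply/measurable_EFinP; apply: measurable_funM; first exact: measurable_cst.
      exact: measurable_indic.
    apply: lee_sum => k _.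
    under eq_integral do rewrite EFinM.
    rewrite ge0_integralZl//; first last.
    - by rewrite lee_fin mulr_ge0 ?expR_ge0.
    - by apply/measurable_EFinP; exact: measurable_indic.
    rewrite integral_indic// setIT.
    have PA : P (A k) = normal_prob 0 (Num.sqrt t)
        [set y | (z0 + k%:R <= mu * t + c * y < z0 + k%:R + 1)%R].
      rewrite -(brownian_law HW t0)//.
      rewrite (_ : [set y | _] = (fun y => mu * t + c * y) @^-1` `[z0 + k%:R, z0 + k%:R + 1[).
        rewrite -[X in measurable X]setTI.
        have mg : measurable_fun [set: R] (fun y : R => mu * t + c * y).
          apply: measurable_funD; first exact: measurable_cst.
          by apply: measurable_funM; [exact: measurable_cst|exact: measurable_id].
        by apply: (mg measurableT); exact: measurable_itv.
      by apply/seteqP; split => y; rewrite /= in_itv.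
    rewrite [X in (_ <= _ * X)%E]PA /gk indicE.
    have [|_] := boolP (t \in J k); last first.
      rewrite mulr0; apply: mule_ge0; last by apply: integral_ge0 => y _; rewrite lee_fin normal_pdf_ge0.
      by rewrite lee_fin mulr_ge0 ?expR_ge0.
    rewrite inE /J/= in_itv/= mulr1 => tJ.
    rewrite [X in (_ <= X%:E * _)%E]mulrC [in leRHS]EFinM -[leRHS]muleA EFinM.
    apply: lee_wpmul2l; first by rewrite lee_fin.
    by apply: HC => //; rewrite addr_ge0.
  apply: ge0_le_integral => //.
  - by move=> w _; apply: sume_ge0 => k _; rewrite lee_fin !mulr_ge0 ?expR_ge0.
  - apply: emeasurable_sum => k; apply/measurable_EFinP; apply: measurable_funM; first exact: measurable_cst.
    exact: measurable_indic.
  - by apply: (measurableT_comp mG); exact: measurable_pair2.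
  move=> w _; rewrite /G /= indicE mem_set/=; last by rewrite in_itv/= andbT ltW.
  rewrite mulr1.
  rewrite sumEFin lee_fin; under eq_bigr do rewrite -mulrA.
  rewrite -mulr_sumr; apply: ler_wpM2l; first exact: expR_ge0.
  rewrite /L (max_idPr (ltW t0)); set l := mu * t + _.
  (* At most one cell contains l, and its index can only be [Num.truncn (l - z0)]. *)
  apply: (@le_trans _ _ (\sum_(k < K) (if k == Num.truncn (l - z0) :> nat then f l else 0))).
    apply: ler_sum => k _; rewrite indicE.
    have [|_] := boolP (w \in A k); last by rewrite mulr0; case: ifP.
    rewrite inE /A/= -/l mulr1 => /andP[l1 l2].
    rewrite (@truncn_def _ (l - z0) k) ?eqxx; last by rewrite -natr1; apply/andP; split; lra.
    by apply: fmono => //; rewrite lerDl.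
  rewrite -big_mkcond/=.
  have [jK|jK] := ltnP (Num.truncn (l - z0)) K.
    by rewrite (big_pred1 (Ordinal jK)).
  rewrite big_pred0 // => k; apply/negbTE; rewrite neq_ltn; apply/orP; left.
  exact: leq_trans (ltn_ord k) jK.
exists (fine (\int[lebesgue_measure]_t \int[P]_w G (w, t)) / C) => K.
rewrite ler_pdivlMr// -lee_fin fineK; last first.
  by rewrite ge0_fin_numE//; apply: integral_ge0 => t _; exact: integral_ge0.
apply: (@le_trans _ _ (\int[lebesgue_measure]_t \sum_(k < K) (gk k t)%:E)%E); last first.
  apply: ge0_le_integral => //.
  - by move=> t _; apply: sume_ge0 => k _; rewrite lee_fin; exact: gk0.
  - by apply: emeasurable_sum => k; apply/measurable_EFinP; exact: mgk.
  - exact: (measurable_fun_fubini_tonelli_G (m1 := P) G).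
rewrite ge0_integral_sum//; first last.
- by move=> k t _; rewrite lee_fin; exact: gk0.
- by move=> k; apply/measurable_EFinP; exact: mgk.
rewrite mulr_suml -sumEFin; apply: lee_sum => k _.
rewrite /gk; under eq_integral do rewrite EFinM.
rewrite ge0_integralZl//; first last.
- rewrite lee_fin; apply: mulr_ge0 => //.
  by apply: divr_ge0; [rewrite mulr_ge0 ?expR_ge0// ltW|exact: sqrtr_ge0].
- by apply/measurable_EFinP; apply: measurable_indic; exact: measurable_itv.
rewrite integral_indic// ?setIT; last exact: measurable_itv.
have lJ : lebesgue_measure (J k) = (Num.sqrt (tau k))%:E.
  rewrite /J lebesgue_measure_itv/= lte_fin ltrDl sqrtr_gt0 tau0 -EFinB.
  by congr EFin; ring.
rewrite [X in (_ <= _ * X)%E]lJ -EFinM lee_fin.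
rewrite le_eqVlt; apply/orP; left; apply/eqP; field.
by rewrite gt_eqF// sqrtr_gt0.
Qed.

(** * Integrability of the payoff *)

(** h is monotone on (0, oo) only, but its composition with exp is monotone on the whole line. *)
Lemma increasing_pos_measurable (R : realType) (h : R -> R) (D : set R) :
  increasing_pos h -> measurable D -> D `<=` [set x | 0 < x] ->
  measurable_fun D h.
Proof.
move=> hi mD D0.
apply: (@eq_measurable_fun _ _ _ _ D ((fun z : R => h (expR z)) \o @ln R)).
  by move=> x; rewrite inE => /D0/= x0; rewrite lnK.
apply: measurable_funTS; apply: measurableT_comp; last exact: measurable_ln.
apply: nondecreasing_measurable => // x y xy.
by apply: hi; rewrite ?expR_gt0// ler_expR.
Qed.

Lemma power_mul_measurable (R : realType) (h : R -> R) (k : R) (D : set R) :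
  increasing_pos h -> measurable D -> D `<=` [set x | 0 < x] ->
  measurable_fun D (fun s => s `^ k * h s).
Proof.
move=> hi mD D0; apply: measurable_funM; last exact: increasing_pos_measurable.
by apply: measurable_funTS; exact: measurable_powR.
Qed.

Lemma integrable_cover d (T : measurableType d) (R : realType)
    (mu : {measure set T -> \bar R}) (A B D : set T) (f : T -> \bar R) :
  measurable A -> measurable B -> measurable D -> D `<=` A `|` B ->
  mu.-integrable A f -> mu.-integrable B f -> mu.-integrable D f.
Proof.
move=> mA mB mD DAB iA iB; apply: (@integrableS _ _ _ _ (A `|` (B `\` A))) => //.
- by apply: measurableU => //; exact: measurableD.
- by rewrite setUDr setDv setD0.
have mBA : measurable (B `\` A) by exact: measurableD.
have iBA : mu.-integrable (B `\` A) f by exact: (@integrableS _ _ _ _ B).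
have mf : measurable_fun (A `|` (B `\` A)) f.
  by apply/measurable_funU => //; split; [case/integrableP: iA|case/integrableP: iBA].
apply/integrableP; split => //.
rewrite ge0_integral_setU//; last 2 first.
- exact: measurableT_comp.
- by apply/disj_setPS => x [Ax [_ /(_ Ax)]].
by apply: lte_add_pinfty; [case/integrableP: iA|case/integrableP: iBA].
Qed.

Lemma power_mul_integrable_cc (R : realType) (h : R -> R) (k a b : R) :
  increasing_pos h -> 0 < a ->
  lebesgue_measure.-integrable `[a, b] (EFin \o (fun s => s `^ k * h s)).
Proof.
move=> hi a0; apply: measurable_bounded_integrable => //.
- by rewrite /= lebesgue_measure_itv/=; case: ifPn => _; rewrite -?EFinB ltry.
- apply: power_mul_measurable => // x; rewrite /= in_itv/= => /andP[ax _].
  exact: lt_le_trans ax.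
exists ((a `^ k + b `^ k) * (`|h a| + `|h b|)); split; first exact: num_real.
move=> M HM x; rewrite /= in_itv/= => /andP[ax xb]; apply: le_trans (ltW HM).
have x0 := lt_le_trans a0 ax; have b0 := lt_le_trans x0 xb.
rewrite normrM; apply: ler_pM => //.
  rewrite ger0_norm ?powR_ge0//; have [k0|k0] := leP 0 k.
    apply: (@le_trans _ _ (b `^ k)); last by rewrite lerDr powR_ge0.
    by apply: ge0_ler_powR => //; rewrite nnegrE ltW.
  apply: (@le_trans _ _ (a `^ k)); last by rewrite lerDl powR_ge0.
  rewrite -[k]opprK !(powRN _ (- k)) lef_pV2 ?posrE ?powR_gt0//.
  by apply: ge0_ler_powR => //; rewrite ?nnegrE ?oppr_ge0 ltW.
have := hi _ _ a0 ax; have := hi _ _ x0 xb.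
have := ler_norm (h a); have := ler_norm (h b).
have := ler_norm (- h a); have := ler_norm (- h b); rewrite !normrN => *.
by rewrite ler_norml; apply/andP; split; have := normr_ge0 (h a); have := normr_ge0 (h b); lra.
Qed.

(** Cells of unit length in the scale eps ln s, with eps = 1 for the tail at infinity and eps = -1
    for the one at 0. By monotonicity |h| on a cell is at most the sum of its values at the two
    ends; the value at the far end belongs to the term of index k + 1, which costs the factor exp
    nu. *)
Lemma exponential_partition_integrable (R : realType) (h : R -> R) (eps nu z0 C : R) :
  increasing_pos h -> eps = 1 \/ eps = - 1 -> 0 < nu ->
  (forall K : nat, \sum_(k < K) `|h (expR (eps * (z0 + k%:R)))| * expR (- nu * (z0 + k%:R)) <= C) ->
  lebesgue_measure.-integrable [set s : R | 0 < s /\ z0 <= eps * ln s]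
    (EFin \o (fun s => s `^ (- (eps * nu) - 1) * h s)).
Proof.
move=> hi epsE nu0 HC.
pose I (k : nat) := [set s : R | 0 < s /\ (z0 + k%:R <= eps * ln s < z0 + k.+1%:R)%R].
pose D := [set s : R | 0 < s /\ z0 <= eps * ln s].
have mln : measurable_fun [set: R] (fun s : R => eps * ln s).
  by apply: measurable_funM => //; exact: measurable_ln.
have mI k : measurable (I k).
  rewrite (_ : I k = `]0, +oo[%classic `&` (setT `&` (fun s : R => eps * ln s) @^-1` `[z0 + k%:R, z0 + k.+1%:R[)).
    by apply: measurableI => //; apply: mln => //; exact: measurable_itv.
  by apply/seteqP; split => s; rewrite /I/= !in_itv/= ?andbT; [case=> ? ?|case=> ? [_ ?]].
have DE : D = \bigcup_k I k.
  apply/seteqP; split => s.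
    move=> [s0 sz]; exists (Num.truncn (eps * ln s - z0)) => //; split => //.
    have /truncn_itv/andP[h1 h2] : 0 <= eps * ln s - z0 by rewrite subr_ge0.
    by apply/andP; split; lra.
  move=> [k _ [s0 /andP[h1 _]]]; split => //; apply: le_trans h1.
  by rewrite lerDl.
have tI : trivIset setT I.
  apply/trivIsetP => i j _ _ ij; apply/seteqP; split => // s [[s0 /andP[i1 i2]] [_ /andP[j1 j2]]].
  have Ei : Num.truncn (eps * ln s - z0) = i by apply: truncn_def; apply/andP; split; lra.
  have Ej : Num.truncn (eps * ln s - z0) = j by apply: truncn_def; apply/andP; split; lra.
  by move: ij; rewrite -Ei -Ej eqxx.
have mD : measurable D by rewrite DE; exact: bigcup_measurable.
have mf : measurable_fun D (fun s => s `^ (- (eps * nu) - 1) * h s).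
  by apply: power_mul_measurable => // s [].
pose F := fun s : R => s `^ (- (eps * nu) - 1) * h s.
have mDf : measurable_fun D (EFin \o F).
  exact/measurable_EFinP.
apply/integrableP; split => //.
have mabs : measurable_fun (\bigcup_k I k) (fun s => `|(EFin \o F) s|%E).
  by rewrite -DE; exact: measurableT_comp.
rewrite -/D DE ge0_integral_bigcup//.
pose f k := `|h (expR (eps * (z0 + k%:R)))|.
pose u k := f k * expR (- nu * (z0 + k%:R)).
(* With e = eps (z0 + k), 1/s <= exp(1 - e) and the cell has length at most exp(e + 1): this is the
   factor exp 2. *)
have bound k : (\int[lebesgue_measure]_(s in I k) `|(EFin \o F) s|
    <= (expR 2 * (u k + expR nu * u k.+1))%:E)%E.
  pose e := eps * (z0 + k%:R).
  have sub : I k `<=` `[expR (e - 1), expR (e + 1)]%classic.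
    move=> s [s0 /andP[h1 h2]]; rewrite /= in_itv/=.
    rewrite -{1 2}(lnK s0) !ler_expR /e; rewrite -natr1 in h2.
    by case: epsE h1 h2 => ->; rewrite ?mul1r ?mulN1r => h1 h2; apply/andP; split; lra.
  apply: (@le_trans _ _ (\int[lebesgue_measure]_(s in I k)
     (expR (- nu * (z0 + k%:R)) * expR (1 - e) * (f k + f k.+1))%:E)%E).
    apply: ge0_le_integral => //.
    - exact: mI.
    - apply: (@measurable_funS _ _ _ _ (\bigcup_k I k) (I k)) => //.
        exact: bigcup_measurable.
      exact: bigcup_sup.
    - move=> s Is; rewrite lee_fin normrM ger0_norm ?powR_ge0//.
      case: (Is) => s0 /andP[h1 h2].
      have := sub _ Is; rewrite /= in_itv/= => /andP[b1 b2].
      apply: ler_pM => //; first exact: powR_ge0.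
        rewrite /powR gt_eqF// -expRD ler_expR.
        have -> : (- (eps * nu) - 1) * ln s = - nu * (eps * ln s) - ln s by ring.
        have : e - 1 <= ln s by rewrite -ler_expR lnK.
        have : nu * (z0 + k%:R) <= nu * (eps * ln s) by rewrite ler_pM2l.
        lra.
      rewrite /f.
      have := ler_norm (h (expR (eps * (z0 + k%:R)))); have := ler_norm (h (expR (eps * (z0 + k.+1%:R)))).
      have := ler_norm (- h (expR (eps * (z0 + k%:R)))); have := ler_norm (- h (expR (eps * (z0 + k.+1%:R)))).
      have := normr_ge0 (h (expR (eps * (z0 + k%:R)))); have := normr_ge0 (h (expR (eps * (z0 + k.+1%:R)))).
      rewrite !normrN ler_norml => *.
      have [H1 H2] : Num.min (h (expR (eps * (z0 + k%:R)))) (h (expR (eps * (z0 + k.+1%:R)))) <= h s /\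
        h s <= Num.max (h (expR (eps * (z0 + k%:R)))) (h (expR (eps * (z0 + k.+1%:R)))).
        rewrite ge_min le_max; rewrite -(lnK s0).
        case: epsE h1 h2 => -> h1 h2; split; apply/orP.
        - by left; apply: hi; rewrite ?expR_gt0// ler_expR; lra.
        - by right; apply: hi; rewrite ?expR_gt0// ler_expR; lra.
        - by right; apply: hi; rewrite ?expR_gt0// ler_expR; lra.
        - by left; apply: hi; rewrite ?expR_gt0// ler_expR; lra.
      move: H1 H2; rewrite ge_min le_max => /orP[] H1 /orP[] H2; apply/andP; split; lra.
  rewrite integral_cst//; last exact: mI.
  have lI : (lebesgue_measure (I k) <= (expR (e + 1))%:E)%E.
    apply: (@le_trans _ _ (lebesgue_measure `[expR (e - 1), expR (e + 1)]%classic)).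
      by apply: le_measure => //; rewrite inE; [exact: mI|exact: measurable_itv].
    rewrite lebesgue_measure_itv/= lte_fin ltr_expR; case: ifPn => _; last by rewrite lee_fin expR_ge0.
    by rewrite -EFinB lee_fin gerBl expR_ge0.
  apply: (@le_trans _ _ ((expR (- nu * (z0 + k%:R)) * expR (1 - e) * (f k + f k.+1))%:E * (expR (e + 1))%:E)%E).
    by apply: lee_wpmul2l => //; rewrite lee_fin !mulr_ge0 ?expR_ge0// addr_ge0 ?normr_ge0.
  rewrite -EFinM lee_fin /u.
  have -> : - nu * (z0 + k.+1%:R) = - nu * (z0 + k%:R) - nu by rewrite -natr1; ring.
  rewrite le_eqVlt; apply/orP; left; apply/eqP.
  rewrite (expRB _ nu) (_ : expR 2 = expR (1 - e) * expR (e + 1)); last first.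
    by rewrite -expRD; congr expR; ring.
  by field; rewrite expR_eq0.
apply: (@le_lt_trans _ _ (expR 2 * (C + expR nu * C))%:E); last exact: ltry.
have u0 k : 0 <= u k by rewrite mulr_ge0 ?expR_ge0 ?normr_ge0.
apply: lime_le; first by apply: is_cvg_nneseries => k _ _; exact: integral_ge0.
apply: nearW => K; rewrite big_mkord.
apply: (@le_trans _ _ (\sum_(k < K) (expR 2 * (u k + expR nu * u k.+1))%:E)%E).
  by apply: lee_sum => k _; exact: bound.
rewrite sumEFin lee_fin -mulr_sumr ler_pM2l ?expR_gt0// big_split/= lerD//.
  exact: HC.
rewrite -mulr_sumr ler_pM2l ?expR_gt0//.
apply: le_trans (HC K.+1); rewrite big_ord_recl/=.
by rewrite lerDr; exact: (u0 0%N).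
Qed.

(** Replaces the occupation estimate for bounded payoffs: the constant 1, and h near 0 when h is
    nonnegative. *)
Lemma geometric_sum_bounded (R : realType) (nu z0 B : R) : 0 < nu -> 0 <= B ->
  exists C, forall (K : nat) (f : nat -> R), (forall k, f k <= B) ->
    \sum_(k < K) f k * expR (- nu * (z0 + k%:R)) <= C.
Proof.
move=> nu0 B0; pose q := expR (- nu).
have q1 : q < 1 by rewrite expR_lt1 oppr_lt0.
have q0 : 0 < q by exact: expR_gt0.
exists (B * (expR (- nu * z0) / (1 - q))) => K f fB.
have geo : \sum_(k < K) q ^+ k <= (1 - q)^-1.
  have h : (1 - q) * \sum_(k < K) q ^+ k = 1 - q ^+ K.
    by rewrite -[LHS]opprK -mulNr opprB -subrX1 opprB.
  rewrite -div1r ler_pdivlMr ?subr_gt0// mulrC h gerBl.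
  by apply: ltW; rewrite exprn_gt0.
apply: (@le_trans _ _ (\sum_(k < K) B * expR (- nu * z0) * q ^+ k)).
  apply: ler_sum => k _; rewrite -mulrA mulrDr expRD (mulrC (- nu) k%:R) expRM_natl.
  by apply: ler_wpM2r => //; rewrite mulr_ge0 ?expR_ge0// exprn_ge0// ltW.
rewrite -mulr_sumr -mulrA; apply: ler_wpM2l => //.
by apply: ler_wpM2l => //; exact: expR_ge0.
Qed.

Lemma integrable_right_tail (R : realType) (h : R -> R) (nu z0 C x : R) :
  increasing_pos h -> 0 < nu ->
  (forall K : nat, \sum_(k < K) `|h (expR (1 * (z0 + k%:R)))| * expR (- nu * (z0 + k%:R)) <= C) ->
  0 < x ->
  lebesgue_measure.-integrable `]x, +oo[ (EFin \o (fun s => s `^ (- nu - 1) * h s)).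
Proof.
move=> hi nu0 HC x0.
have H := exponential_partition_integrable hi (or_introl erefl) nu0 HC.
rewrite mul1r in H.
have iH := power_mul_integrable_cc (- nu - 1) (expR z0) hi x0.
apply: (integrable_cover _ _ _ _ iH H) => //.
- rewrite (_ : [set s | _] = `[expR z0, +oo[%classic)//.
  apply/seteqP; split => s /=; rewrite in_itv/= andbT mul1r.
    by move=> [s0]; rewrite -ler_expR lnK.
  move=> zs; have s0 : 0 < s by apply: lt_le_trans zs; exact: expR_gt0.
  by split => //; rewrite -ler_expR lnK.
- move=> s; rewrite /= !in_itv/= andbT mul1r => xs.
  have s0 := lt_trans x0 xs.
  have [?|?] := leP s (expR z0); [left|right]; first by rewrite (ltW xs).
  by split => //; rewrite -ler_expR lnK// ltW.
Qed.

Lemma integrable_left_tail (R : realType) (h : R -> R) (nu z0 C x : R) :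
  increasing_pos h -> 0 < nu ->
  (forall K : nat, \sum_(k < K) `|h (expR (- 1 * (z0 + k%:R)))| * expR (- nu * (z0 + k%:R)) <= C) ->
  0 < x ->
  lebesgue_measure.-integrable `]0, x[ (EFin \o (fun s => s `^ (nu - 1) * h s)).
Proof.
move=> hi nu0 HC x0.
have H := exponential_partition_integrable hi (or_intror erefl) nu0 HC.
rewrite mulN1r opprK in H.
have iH := power_mul_integrable_cc (nu - 1) x hi (expR_gt0 (- z0)).
apply: (integrable_cover _ _ _ _ iH H) => //.
- rewrite (_ : [set s | _] = `]0, expR (- z0)]%classic)//.
  apply/seteqP; split => s /=; rewrite in_itv/= mulN1r lerNr.
    by move=> [s0]; rewrite -ler_expR lnK// s0.
  by move=> /andP[s0 sz]; split => //; rewrite -ler_expR lnK.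
- move=> s; rewrite /= !in_itv/= mulN1r => /andP[s0 sx].
  have [?|?] := leP (expR (- z0)) s; [left|right]; first by rewrite (ltW sx).
  by split => //; rewrite lerNr -ler_expR lnK// ltW.
Qed.

(* log X has drift b - sigma^2 and volatility sqrt 2 sigma. *)
Lemma exp_nE (R : realType) (b sigma r : R) : sigma != 0 ->
  (Num.sqrt ((b - sigma ^+ 2) ^+ 2 + 2 * (Num.sqrt 2 * sigma) ^+ 2 * r) - (b - sigma ^+ 2)) / (Num.sqrt 2 * sigma) ^+ 2
  = exp_n b sigma r.
Proof.
move=> s0; rewrite /exp_n exprMn sqr_sqrtr//.
rewrite (_ : 2 * (2 * sigma ^+ 2) * r = 4 * sigma ^+ 2 * r); last by ring.
by field; rewrite s0.
Qed.

(** Applies to - log X, with drift - (b - sigma^2) and volatility - sqrt 2 sigma. *)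
Lemma exp_mE (R : realType) (b sigma r : R) : sigma != 0 ->
  (Num.sqrt ((- (b - sigma ^+ 2)) ^+ 2 + 2 * (- (Num.sqrt 2 * sigma)) ^+ 2 * r) - - (b - sigma ^+ 2)) / (- (Num.sqrt 2 * sigma)) ^+ 2
  = - exp_m b sigma r.
Proof.
move=> s0; rewrite /exp_m !sqrrN exprMn sqr_sqrtr//.
rewrite (_ : 2 * (2 * sigma ^+ 2) * r = 4 * sigma ^+ 2 * r); last by ring.
by field; rewrite s0.
Qed.

(** The two equations are Vieta's relations for sigma^2 q (q - 1) + b q - r = 0, whose roots are m
    and n; through them r and b are expressed by p = - m, n and sigma^2. *)
Lemma exp_bounds (R : realType) (b sigma r : R) : sigma != 0 -> 0 < r ->
  [/\ exp_m b sigma r < 0, 0 < exp_n b sigma r,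
      r = - sigma ^+ 2 * exp_m b sigma r * exp_n b sigma r
    & b = sigma ^+ 2 * (1 - exp_m b sigma r - exp_n b sigma r)].
Proof.
move=> s0 r0; have s2 : 0 < sigma ^+ 2 by rewrite exprn_even_gt0.
set S := Num.sqrt ((b - sigma ^+ 2) ^+ 2 + 4 * sigma ^+ 2 * r).
have D0 : (b - sigma ^+ 2) ^+ 2 < (b - sigma ^+ 2) ^+ 2 + 4 * sigma ^+ 2 * r.
  by rewrite ltrDl mulr_gt0// mulr_gt0.
have S2 : S ^+ 2 = (b - sigma ^+ 2) ^+ 2 + 4 * sigma ^+ 2 * r.
  by rewrite sqr_sqrtr// (le_trans (sqr_ge0 _) (ltW D0)).
have S0 : 0 <= S by exact: sqrtr_ge0.
have SN : `|b - sigma ^+ 2| < S.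
  by rewrite -(@ltr_pXn2r _ 2)// ?nnegrE// real_normK ?num_real// S2.
move: SN; rewrite ltr_norml => /andP[h1 h2].
have i0 : 0 < (2 * sigma ^+ 2)^-1 by rewrite invr_gt0 mulr_gt0.
rewrite /exp_m /exp_n -/S; split.
- by rewrite pmulr_rlt0//; lra.
- by rewrite pmulr_rgt0//; lra.
- have -> : r = (S ^+ 2 - (b - sigma ^+ 2) ^+ 2) / (4 * sigma ^+ 2).
    by rewrite S2; field; rewrite s0.
  by field; rewrite s0.
- by field; rewrite s0.
Qed.

(** The occupation estimate needs |h| to be monotone far out in the logarithmic scale. At infinity
    this holds once h >= 0. At 0 it holds once h <= 0, if h takes a negative value; otherwise h is
    bounded on (0, 1] and a geometric sum suffices. *)
Lemma payoff_integrable (R : realType) (d : measure_display)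
    (T : measurableType d) (P : probability T R) (W : R -> {RV P >-> R})
    (b sigma r : R) (h : R -> R) :
  brownian_motion W -> sigma != 0 -> 0 < r -> payoff_assumption W b sigma r h ->
  forall x, 0 < x ->
  lebesgue_measure.-integrable `]x, +oo[
    (EFin \o (fun s => s `^ (- exp_n b sigma r - 1) * h s)) /\
  lebesgue_measure.-integrable `]0, x[
    (EFin \o (fun s => s `^ (- exp_m b sigma r - 1) * h s)).
Proof.
move=> HW s0 r0 [_ hi hoo Hfin] x x0.
have [m0 n0 _ _] := exp_bounds b s0 r0.
have c0 : Num.sqrt 2 * sigma != 0 by rewrite mulf_neq0// sqrtr_eq0 -ltNge.
have {}Hfin := Hfin 1 ltr01.
have hexp z y : z <= y -> h (expR z) <= h (expR y).
  by move=> zy; apply: hi; rewrite ?expR_gt0// ler_expR.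
split.
- have [z0 [z00 hz0]] : exists z0 : R, 0 <= z0 /\ 0 <= h (expR z0).
    have /cvgryPgt/(_ 0)[A [_ HA]] := hoo.
    exists `|A|; split => //; apply: ltW; apply: HA.
    have := expR_ge1Dx `|A|; have := ler_norm A; lra.
  have [||||C HC] := @brownian_occupation _ _ _ _ W (b - sigma ^+ 2) (Num.sqrt 2 * sigma)
     r z0 (fun z => `|h (expR z)|) HW c0 r0 z00.
  + have mh : measurable_fun [set: R] (fun z => h (expR z)).
      by apply: nondecreasing_measurable => // u v uv; exact: hexp.
    exact: (measurableT_comp (@normr_measurable R setT) mh).
  + by [].
  + move=> u v zu uv; rewrite !ger0_norm; first exact: hexp.
      by apply: (le_trans hz0); apply: hexp; exact: le_trans uv.
    by apply: (le_trans hz0); exact: hexp.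
  + apply: le_lt_trans Hfin; rewrite le_eqVlt; apply/orP; left; apply/eqP; apply: esym; apply: eq_integral => w _; apply: eq_integral => t _.
    by rewrite /geometric_bm mul1r.
  rewrite exp_nE// in HC.
  apply: (@integrable_right_tail _ _ _ z0 C) => // K.
  by under eq_bigr do rewrite mul1r.
- have np : 0 < - exp_m b sigma r by rewrite oppr_gt0.
  have [[s [sp hs]]|hpos] := pselect (exists s, 0 < s /\ h s < 0); last first.
    have B0 : 0 <= h 1.
      by rewrite leNgt; apply/negP => h1; apply: hpos; exists 1.
    have [C HC] := geometric_sum_bounded 0 np B0.
    apply: (@integrable_left_tail _ _ _ 0 C) => // K.
    apply: (HC K (fun k => `|h (expR (- 1 * (0 + k%:R)))|)) => k.
    rewrite ger0_norm; last first.
      by rewrite leNgt; apply/negP => h1; apply: hpos; eexists; split; last exact: h1; exact: expR_gt0.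
    by apply: hi; rewrite ?expR_gt0// add0r mulN1r -[leRHS]expR0 ler_expR oppr_le0.
  have [z0 [z00 hz0]] : exists z0 : R, 0 <= z0 /\ h (expR (- z0)) <= 0.
    exists (Num.max 0 (- ln s)); split; first by rewrite le_max lexx.
    apply: le_trans (ltW hs); rewrite -{2}(lnK sp); apply: hexp.
    by rewrite lerNl le_max lexx orbT.
  have c0' : - (Num.sqrt 2 * sigma) != 0 by rewrite oppr_eq0.
  have [||||C HC] := @brownian_occupation _ _ _ _ W (- (b - sigma ^+ 2)) (- (Num.sqrt 2 * sigma))
     r z0 (fun z => `|h (expR (- z))|) HW c0' r0 z00.
  + have mh : measurable_fun [set: R] (fun z => h (expR (- z))).
      by apply: nonincreasing_measurable => // u v uv; apply: hexp; rewrite lerN2.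
    exact: (measurableT_comp (@normr_measurable R setT) mh).
  + by [].
  + move=> u v zu uv.
    have neg y : z0 <= y -> h (expR (- y)) <= 0.
      by move=> zy; apply: le_trans hz0; apply: hexp; rewrite lerN2.
    rewrite (ler0_norm (neg _ zu)) (ler0_norm (neg _ (le_trans zu uv))) lerN2.
    by apply: hexp; rewrite lerN2.
  + apply: le_lt_trans Hfin; rewrite le_eqVlt; apply/orP; left; apply/eqP; apply: esym; apply: eq_integral => w _; apply: eq_integral => t _.
    by rewrite /geometric_bm mul1r; congr ((_ * `|h (expR _)|)%:E); ring.
  rewrite exp_mE// in HC.
  apply: (@integrable_left_tail _ _ _ z0 C) => // K.
  by under eq_bigr do rewrite mulN1r.
Qed.

(** * Derivative rules and monotone powers *)

Lemma is_derive_cmul (R : realType) (f : R -> R) (c x d : R) :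
  is_derive x 1 f d -> is_derive x 1 (fun y => c * f y) (c * d).
Proof. exact: (@is_deriveZ R R^o R^o f c x 1 d). Qed.
Lemma is_derive_mul (R : realType) (f g : R -> R) (x d e : R) :
  is_derive x 1 f d -> is_derive x 1 g e -> is_derive x 1 (fun y => f y * g y) (f x * e + g x * d).
Proof. exact: (@is_deriveM R R^o f g x 1 d e). Qed.
Lemma is_derive_add (R : realType) (f g : R -> R) (x d e : R) :
  is_derive x 1 f d -> is_derive x 1 g e -> is_derive x 1 (fun y => f y + g y) (d + e).
Proof. exact: (@is_deriveD R R^o R^o f g x 1 d e). Qed.
Lemma is_derive_sub (R : realType) (f g : R -> R) (x d e : R) :
  is_derive x 1 f d -> is_derive x 1 g e -> is_derive x 1 (fun y => f y - g y) (d - e).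
Proof. exact: (@is_deriveB R R^o R^o f g x 1 d e). Qed.

Lemma powR_le_pos (R : realType) (q x y : R) : 0 < q -> 0 < x -> x <= y -> x `^ q <= y `^ q.
Proof.
move=> q0 x0 xy; apply: ge0_ler_powR => //; rewrite ?nnegrE; apply: ltW => //.
exact: lt_le_trans xy.
Qed.

Lemma powR_le_neg (R : realType) (q x y : R) : 0 < q -> 0 < x -> x <= y -> y `^ (- q) <= x `^ (- q).
Proof.
move=> q0 x0 xy; rewrite !powRN lef_pV2 ?posrE ?powR_gt0//; last exact: lt_le_trans xy.
exact: powR_le_pos.
Qed.

(* [M x] stands for the integral of p s^(p-1) h(s) over ]0, x[, and [N x] for that of
   n s^(-n-1) h(s) over ]x, +oo[; here p = -m.  [mom_weight] is the positivity of an integral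
   over ]x, y[. *)
Record moments (R : realType) (p n : R) (h M N : R -> R) : Prop := Moments {
  mom_p : 0 < p;
  mom_n : 0 < n;
  mom_incr : increasing_pos h;
  mom_infty : forall C, exists x, 0 < x /\ C < h x;
  mom_rcont : forall x C, 0 < x -> h x < C -> exists y, x < y /\ h y < C;
  mom_weight : forall A B H x y, 0 < x -> x <= y ->
    (forall s, x < s -> s < y -> 0 <= (A * s `^ (p - 1) + B * s `^ (- n - 1)) * (h s - H)) ->
    0 <= A * ((M y - M x) - H * (y `^ p - x `^ p)) / p
       + B * ((N x - N y) - H * (x `^ (- n) - y `^ (- n))) / n;
  mom_tail0 : forall x, 0 < x -> M x <= h x * x `^ p;
  mom_tail : forall x, 0 < x -> h x * x `^ (- n) <= N x;
  mom_lim : forall e t, 0 < e -> exists x, t < x /\ N x < e }.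

(** * Power moments as Lebesgue integrals *)

Lemma Rintegral_exhaust d (T : measurableType d) (R : realType)
    (mu : {measure set T -> \bar R}) (D : set T) (F : (set T)^nat) (f : T -> R) (e : R) :
  measurable D -> nondecreasing_seq F -> (forall i, measurable (F i)) ->
  \bigcup_i F i = D -> mu.-integrable D (EFin \o f) -> (forall x, D x -> 0 <= f x) ->
  0 < e -> exists k, \int[mu]_(s in D) f s - \int[mu]_(s in F k) f s < e.
Proof.
move=> mD ndF mF FD iD f0 e0.
have FkD k : F k `<=` D by rewrite -FD; exact: bigcup_sup.
have iF k : mu.-integrable (F k) (EFin \o f) by exact: (integrableS mD (mF k) (FkD k) iD).
have := @ge0_nondecreasing_set_cvg_integral _ _ _ F (EFin \o f) mu ndF mF
  (fun i => measurable_int mu (iF i)) _.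
have f0' i (x : T) : F i x -> (0 <= (EFin \o f) x)%E by move=> /FkD /f0; rewrite lee_fin.
move=> /(_ f0'); rewrite FD.
rewrite -(fineK (integrable_fin_num mD iD)).
move=> /fine_cvgP[_] /cvgrPdist_lt /(_ _ e0)[k _ Hk].
exists k; have := Hk k (leqnn k); rewrite /Rintegral /=.
by apply: le_lt_trans; exact: ler_norm.
Qed.

Section power_integrals.
Context {R : realType}.
Notation mu := (@lebesgue_measure R).
Implicit Types (h : R -> R) (q x y : R).

Lemma integral_power_oo q x y : q != 0 -> 0 < x -> x <= y ->
  \int[mu]_(s in `]x, y[) (s `^ (q - 1)) = (y `^ q - x `^ q) / q.
Proof.
move=> q0 x0; rewrite le_eqVlt => /predU1P[->|xy].
  by rewrite set_itvoo0// Rintegral_set0 subrr mul0r.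
have pos s : s \in `[x, y] -> 0 < s by rewrite in_itv/= => /andP[xs _]; exact: lt_le_trans xs.
pose F (s : R) : R := q^-1 * s `^ q.
have dF (s : R) : 0 < s -> is_derive s 1 F (s `^ (q - 1)).
  move=> s0; rewrite (_ : s `^ (q - 1) = q^-1 * (q * s `^ (q - 1))); last by rewrite mulKf.
  exact/is_derive_cmul/is_derive1_powR.
have cp q' (s : R) : 0 < s -> {for s, continuous (fun s : R => s `^ q')}.
  by move=> s0; apply/differentiable_continuous/derivable1_diffP/ex_derive; exact: is_derive1_powR.
have H := @continuous_FTC2 R (fun s => s `^ (q - 1)) F x y xy.
have I : mu.-integrable `[x, y] (EFin \o (fun s : R => s `^ (q - 1))).
  have := @power_mul_integrable_cc R (cst 1) (q - 1) x y (fun _ _ _ _ => lexx _) x0.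
  by apply: eq_integrable => // s _; rewrite /= mulr1.
rewrite Rintegral_itv_bndo_bndc; last first.
  by apply: integrableS I => //; exact: subset_itv_oo_cc.
rewrite Rintegral_itv_obnd_cbnd; last first.
  by apply: integrableS I => //; exact: subset_itv_oc_cc.
rewrite /Rintegral H.
- by rewrite -EFinB /= /F; field; rewrite q0.
- apply: continuous_in_subspaceT => s; rewrite inE /= => /pos s0; exact: cp.
- split.
  + by move=> s sxy; apply: ex_derive; apply: dF; apply: pos; exact: subset_itv_oo_cc.
  + apply: cvg_at_right_filter; apply/differentiable_continuous/derivable1_diffP.
    by apply: ex_derive; exact: dF.
  + apply: cvg_at_left_filter; apply/differentiable_continuous/derivable1_diffP.
    by apply: ex_derive; apply: dF; exact: lt_trans xy.
- move=> s sxy; rewrite derive1E.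
  by have /dF[_ ->] : 0 < s by apply: pos; exact: subset_itv_oo_cc.
Qed.

Definition lower_moment p h x := p * \int[mu]_(s in `]0, x[) (s `^ (p - 1) * h s).
Definition upper_moment n h x := n * \int[mu]_(s in `]x, +oo[) (s `^ (- n - 1) * h s).

Lemma power_mul_integrable_oo h q x y : increasing_pos h -> 0 < x ->
  mu.-integrable `]x, y[ (EFin \o (fun s => s `^ q * h s)).
Proof.
move=> hi x0; apply: (integrableS _ _ _ (power_mul_integrable_cc q y hi x0)) => //.
exact: subset_itv_oo_cc.
Qed.

Lemma lower_momentB p h x y : p != 0 ->
  mu.-integrable `]0, y[ (EFin \o (fun s => s `^ (p - 1) * h s)) ->
  0 < x -> x <= y ->
  lower_moment p h y - lower_moment p h x
  = p * \int[mu]_(s in `]x, y[) (s `^ (p - 1) * h s).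
Proof.
move=> p0 iy x0; rewrite le_eqVlt => /predU1P[->|xy].
  by rewrite set_itvoo0// Rintegral_set0 subrr mulr0.
rewrite /lower_moment -mulrBr; congr (_ * _).
rewrite [X in _ - X]Rintegral_itv_bndo_bndc; last first.
  by apply: integrableS iy => //; apply: subset_itvl; rewrite bnd_simp ltW.
by rewrite Rintegral_itvB// bnd_simp// ltW.
Qed.

Lemma upper_momentB n h x y : n != 0 ->
  mu.-integrable `]x, +oo[ (EFin \o (fun s => s `^ (- n - 1) * h s)) ->
  0 < x -> x <= y ->
  upper_moment n h x - upper_moment n h y
  = n * \int[mu]_(s in `]x, y[) (s `^ (- n - 1) * h s).
Proof.
move=> n0 ix x0; rewrite le_eqVlt => /predU1P[->|xy].
  by rewrite set_itvoo0// Rintegral_set0 subrr mulr0.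
rewrite /upper_moment -mulrBr; congr (_ * _).
rewrite -(@Rintegral_itvB _ _ (BRight x) _ y)// ?bnd_simp//; last exact: ltW.
rewrite opprB addrC subrK Rintegral_itv_bndo_bndc//.
by apply: integrableS ix => //; exact: subset_itvl.
Qed.

Lemma lower_tail0 h q x e : 0 < x -> 0 < e ->
  (forall s, 0 < s -> s < x -> 0 <= h s) ->
  mu.-integrable `]0, x[ (EFin \o (fun s => s `^ q * h s)) ->
  exists y, [/\ 0 < y, y < x &
    \int[mu]_(s in `]0, x[) (s `^ q * h s) - \int[mu]_(s in `]y, x[) (s `^ q * h s) < e].
Proof.
move=> x0 e0 h0 ix.
pose F (k : nat) := `]x / k.+2%:R, x[%classic : set R.
have ndF : nondecreasing_seq F.
  move=> i j ij; apply/subsetPset; apply: subset_itvr; rewrite bnd_simp.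
  by rewrite ler_pM2l// lef_pV2 ?posrE// ler_nat !ltnS.
have FD : \bigcup_i F i = `]0, x[%classic.
  apply/seteqP; split => s.
    move=> [k _]; rewrite /F/= !in_itv/= => /andP[ks ->]; rewrite andbT.
    by apply: lt_trans ks; rewrite divr_gt0.
  rewrite /= in_itv/= => /andP[s0 sx]; exists (Num.truncn (x / s)) => //.
  rewrite /F/= in_itv/= sx andbT ltr_pdivrMr// mulrC -ltr_pdivrMr//.
  by apply: lt_trans (truncnS_gt _) _; rewrite ltr_nat.
have f0 s : `]0, x[%classic s -> 0 <= s `^ q * h s.
  by rewrite /= in_itv/= => /andP[s0 sx]; rewrite mulr_ge0 ?powR_ge0 ?h0.
have [k Hk] := @Rintegral_exhaust _ _ R mu _ F _ e (measurable_itv _) ndF (fun k => measurable_itv _) FD ix f0 e0.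
exists (x / k.+2%:R); split => //; first by rewrite divr_gt0.
by rewrite ltr_pdivrMr// ltr_pMr// ltr1n.
Qed.

Lemma upper_tail0 h q x e : 0 < x -> 0 < e ->
  (forall s, x < s -> 0 <= h s) ->
  mu.-integrable `]x, +oo[ (EFin \o (fun s => s `^ q * h s)) ->
  exists y, x < y /\
    \int[mu]_(s in `]x, +oo[) (s `^ q * h s) - \int[mu]_(s in `]x, y[) (s `^ q * h s) < e.
Proof.
move=> x0 e0 h0 ix.
pose F (k : nat) := `]x, x + k.+1%:R[%classic : set R.
have ndF : nondecreasing_seq F.
  move=> i j ij; apply/subsetPset; apply: subset_itvl; rewrite bnd_simp.
  by rewrite lerD2l ler_nat ltnS.
have FD : \bigcup_i F i = `]x, +oo[%classic.
  apply/seteqP; split => s.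
    by move=> [k _]; rewrite /F/= !in_itv/= => /andP[->].
  rewrite /= in_itv/= andbT => xs; exists (Num.truncn (s - x)) => //.
  rewrite /F/= in_itv/= xs/= -ltrBlDl.
  exact: truncnS_gt.
have f0 s : `]x, +oo[%classic s -> 0 <= s `^ q * h s.
  by rewrite /= in_itv/= andbT => xs; rewrite mulr_ge0 ?powR_ge0 ?h0.
have [k Hk] := @Rintegral_exhaust _ _ R mu _ F _ e (measurable_itv _) ndF (fun k => measurable_itv _) FD ix f0 e0.
by exists (x + k.+1%:R); split => //; rewrite ltrDl.
Qed.

End power_integrals.

Lemma integrable_cmul d (T : measurableType d) (R : realType)
    (mu : {measure set T -> \bar R}) (D : set T) (f : T -> R) (c : R) :
  measurable D -> mu.-integrable D (EFin \o f) ->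
  mu.-integrable D (EFin \o (fun s => c * f s)).
Proof.
by move=> mD i; apply: (eq_integrable mD _ _ _ (integrableZl mD c i)).
Qed.

Lemma integrable_add d (T : measurableType d) (R : realType)
    (mu : {measure set T -> \bar R}) (D : set T) (f g : T -> R) :
  measurable D -> mu.-integrable D (EFin \o f) -> mu.-integrable D (EFin \o g) ->
  mu.-integrable D (EFin \o (fun s => f s + g s)).
Proof.
by move=> mD i j; apply: (eq_integrable mD _ _ _ (integrableD mD i j)).
Qed.

Section moments_of_integrals.
Context {R : realType}.
Notation mu := (@lebesgue_measure R).

(** The constant payoff 1 passes the tail criteria, its weighted sums being geometric. *)
Lemma power_integrable_tails (k x : R) : 0 < k -> 0 < x ->
  mu.-integrable `]x, +oo[ (EFin \o (fun s => s `^ (- k - 1) * cst 1 s)) /\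
  mu.-integrable `]0, x[ (EFin \o (fun s => s `^ (k - 1) * cst 1 s)).
Proof.
move=> k0 x0; have c1 : increasing_pos (cst 1 : R -> R) by move=> *; exact: lexx.
have [C HC] := geometric_sum_bounded 0 k0 (@ler01 R).
have HC' K : \sum_(i < K) `|1 : R| * expR (- k * (0 + i%:R)) <= C.
  by apply: (HC K (fun=> `|1|)) => _; rewrite normr1.
split; [exact: (@integrable_right_tail R (cst 1) k 0 C x)|].
exact: (@integrable_left_tail R (cst 1) k 0 C x).
Qed.

(** The fundamental theorem of calculus reaches only ]y, x[ with y > 0. The defect
    [lower_moment p (cst 1) z] - z^p is the same for all z, and at a small z it lies between - e and
    p e, against its assumed size (p + 1) e. *)
Lemma lower_moment_cst (p x : R) : 0 < p -> 0 < x ->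
  lower_moment p (cst 1) x = x `^ p.
Proof.
move=> p0 x0; have pn0 : p != 0 by rewrite gt_eqF.
have D y z : 0 < y -> y <= z -> lower_moment p (cst 1) z - lower_moment p (cst 1) y = z `^ p - y `^ p.
  move=> y0 yz; rewrite lower_momentB//.
    under eq_Rintegral do rewrite mulr1.
    by rewrite integral_power_oo// mulrC divfK.
  by have [] := power_integrable_tails p0 (lt_le_trans y0 yz).
have nneg y : 0 <= lower_moment p (cst 1) y.
  by apply: mulr_ge0; [exact: ltW|apply: Rintegral_ge0 => s _; rewrite mulr1 powR_ge0].
apply/eqP; apply: contraT => ne.
have e0 : 0 < `|lower_moment p (cst 1) x - x `^ p| / (p + 1).
  by rewrite divr_gt0 ?normr_gt0 ?subr_eq0// addr_gt0.
set e := _ / _ in e0.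
have [_ ix] := power_integrable_tails p0 x0.
have [y [y0 yx Hy]] := lower_tail0 x0 e0 (fun _ _ _ => ler01) ix.
have Hy' : lower_moment p (cst 1) y < p * e.
  rewrite -ltr_pdivrMl// (le_lt_trans _ Hy)//.
  have := lower_momentB pn0 ix y0 (ltW yx); rewrite /lower_moment => E.
  by rewrite le_eqVlt; apply/orP; left; apply/eqP; apply: (mulfI pn0); rewrite mulVKf// mulrBr -E; ring.
pose z := Num.min y (e `^ p^-1).
have z0 : 0 < z by rewrite lt_min y0 powR_gt0.
have zp : z `^ p <= e.
  apply: (@le_trans _ _ ((e `^ p^-1) `^ p)).
    by apply: powR_le_pos => //; rewrite ge_min lexx orbT.
  by rewrite -powRrM mulVf// powRr1// ltW.
have zy : z <= y by rewrite ge_min lexx.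
have := D z y z0 zy.
have := D y x y0 (ltW yx).
have : z `^ p <= y `^ p by exact: powR_le_pos.
have := nneg z; have : 0 <= z `^ p by exact: powR_ge0.
have : `|lower_moment p (cst 1) x - x `^ p| = e * (p + 1).
  by rewrite /e divfK// gt_eqF// addr_gt0.
have [h1|h1] := leP 0 (lower_moment p (cst 1) x - x `^ p); [rewrite ger0_norm//|rewrite ltr0_norm//]; lra.
Qed.

Lemma upper_moment_cst (n x : R) : 0 < n -> 0 < x ->
  upper_moment n (cst 1) x = x `^ (- n).
Proof.
move=> n0 x0; have nn0 : n != 0 by rewrite gt_eqF.
have nn1 : - n != 0 by rewrite oppr_eq0.
have D y z : 0 < y -> y <= z -> upper_moment n (cst 1) y - upper_moment n (cst 1) z = y `^ (- n) - z `^ (- n).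
  move=> y0 yz; rewrite upper_momentB//.
    under eq_Rintegral do rewrite mulr1.
    by rewrite integral_power_oo//; field.
  by have [] := power_integrable_tails n0 y0.
have nneg y : 0 <= upper_moment n (cst 1) y.
  by apply: mulr_ge0; [exact: ltW|apply: Rintegral_ge0 => s _; rewrite mulr1 powR_ge0].
apply/eqP; apply: contraT => ne.
have e0 : 0 < `|upper_moment n (cst 1) x - x `^ (- n)| / (n + 1).
  by rewrite divr_gt0 ?normr_gt0 ?subr_eq0// addr_gt0.
set e := _ / _ in e0.
have [ix _] := power_integrable_tails n0 x0.
have [y [yx Hy]] := upper_tail0 x0 e0 (fun _ _ => ler01) ix.
have Hy' : upper_moment n (cst 1) y < n * e.
  rewrite -ltr_pdivrMl// (le_lt_trans _ Hy)//.
  have := upper_momentB nn0 ix x0 (ltW yx); rewrite /upper_moment => E.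
  by rewrite le_eqVlt; apply/orP; left; apply/eqP; apply: (mulfI nn0); rewrite mulVKf// mulrBr -E; ring.
pose z := Num.max y (e `^ (- n^-1)).
have y0 := lt_trans x0 yx.
have z0 : 0 < z by rewrite lt_max y0.
have zy : y <= z by rewrite le_max lexx.
have anti u v := @powR_le_neg R n u v n0.
have zp : z `^ (- n) <= e.
  apply: (@le_trans _ _ ((e `^ (- n^-1)) `^ (- n))).
    by apply: anti; [exact: powR_gt0|rewrite le_max lexx orbT].
  by rewrite -powRrM mulrNN mulVf// powRr1// ltW.
have := D y z y0 zy.
have := D x y x0 (ltW yx).
have := anti _ _ y0 zy.
have := nneg z; have : 0 <= z `^ (- n) by exact: powR_ge0.
have : `|upper_moment n (cst 1) x - x `^ (- n)| = e * (n + 1).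
  by rewrite /e divfK// gt_eqF// addr_gt0.
have [h1|h1] := leP 0 (upper_moment n (cst 1) x - x `^ (- n)); [rewrite ger0_norm//|rewrite ltr0_norm//]; lra.
Qed.

Variables (p n : R) (h : R -> R).
Hypotheses (p0 : 0 < p) (n0 : 0 < n) (hi : increasing_pos h).
Hypothesis int_h : forall x, 0 < x ->
  mu.-integrable `]x, +oo[ (EFin \o (fun s => s `^ (- n - 1) * h s)) /\
  mu.-integrable `]0, x[ (EFin \o (fun s => s `^ (p - 1) * h s)).

Let pn0 : p != 0. Proof. by rewrite gt_eqF. Qed.
Let nn0 : n != 0. Proof. by rewrite gt_eqF. Qed.

Lemma moments_of_integrable :
  (forall C, exists x, 0 < x /\ C < h x) ->
  (forall x C, 0 < x -> h x < C -> exists y, x < y /\ h y < C) ->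
  moments p n h (lower_moment p h) (upper_moment n h).
Proof.
move=> hoo hrc; split => //.
- move=> A B H x y x0 xy Hs; have y0 := lt_le_trans x0 xy.
  rewrite (lower_momentB pn0 (int_h y0).2 x0 xy) (upper_momentB nn0 (int_h x0).1 x0 xy).
  have c1 : increasing_pos (cst 1 : R -> R) by move=> *; exact: lexx.
  have i1 := power_mul_integrable_oo (p - 1) y hi x0.
  have i2 := power_mul_integrable_oo (- n - 1) y hi x0.
  have i3 := power_mul_integrable_oo (p - 1) y c1 x0.
  have i4 := power_mul_integrable_oo (- n - 1) y c1 x0.
  have E3 : y `^ p - x `^ p = p * \int[mu]_(s in `]x, y[) (s `^ (p - 1) * cst 1 s).
    under eq_Rintegral do rewrite mulr1.
    by rewrite integral_power_oo// mulrC divfK.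
  have E4 : x `^ (- n) - y `^ (- n) = n * \int[mu]_(s in `]x, y[) (s `^ (- n - 1) * cst 1 s).
    under eq_Rintegral do rewrite mulr1.
    by rewrite integral_power_oo// ?oppr_eq0//; field.
  rewrite E3 E4.
  have Z (f : R -> R) c : mu.-integrable `]x, y[ (EFin \o f) -> mu.-integrable `]x, y[ (EFin \o (fun s => c * f s)).
    by move=> i; exact: integrable_cmul.
  have S (f g : R -> R) : mu.-integrable `]x, y[ (EFin \o f) -> mu.-integrable `]x, y[ (EFin \o g) ->
      mu.-integrable `]x, y[ (EFin \o (fun s => f s + g s)).
    by move=> i j; exact: integrable_add.
  have : 0 <= \int[mu]_(s in `]x, y[) (A * (s `^ (p - 1) * h s) + B * (s `^ (- n - 1) * h s)
      + (- (A * H) * (s `^ (p - 1) * cst 1 s) + - (B * H) * (s `^ (- n - 1) * cst 1 s))).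
    apply: Rintegral_ge0 => s; rewrite /= in_itv/= => /andP[xs sy].
    by apply: (le_trans (Hs s xs sy)); rewrite le_eqVlt; apply/orP; left; apply/eqP; ring.
  rewrite RintegralD//; [|by apply: S; exact: Z|by apply: S; exact: Z].
  rewrite !RintegralD//; [|exact: Z..].
  rewrite !RintegralZl//.
  move/le_trans; apply; rewrite le_eqVlt; apply/orP; left; apply/eqP.
  by field; rewrite pn0 nn0.
- move=> x x0; have [_ i1] := int_h x0; have [_ i2] := power_integrable_tails p0 x0.
  rewrite -(lower_moment_cst p0 x0) /lower_moment mulrCA ler_pM2l//.
  rewrite -RintegralZl//; apply: le_Rintegral => //.
    exact: integrable_cmul.
  move=> s; rewrite /= in_itv/= => /andP[s0 sx].
  by rewrite mulr1 mulrC; apply: ler_wpM2r; [exact: powR_ge0|apply: hi => //; exact: ltW].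
- move=> x x0; have [i1 _] := int_h x0; have [i2 _] := power_integrable_tails n0 x0.
  rewrite -(upper_moment_cst n0 x0) /upper_moment mulrCA ler_pM2l//.
  rewrite -RintegralZl//; apply: le_Rintegral => //.
    exact: integrable_cmul.
  move=> s; rewrite /= in_itv/= andbT => xs.
  by rewrite mulr1 mulrC; apply: ler_wpM2l; [exact: powR_ge0|apply: hi => //; exact: ltW].
- move=> e t e0; have [u [u0 hu]] := hoo 0.
  pose x := Num.max u t.
  have ux : u <= x by rewrite le_max lexx.
  have x0 := lt_le_trans u0 ux.
  have [i1 _] := int_h x0.
  have hpos s : x < s -> 0 <= h s.
    by move=> xs; apply: (le_trans (ltW hu)); apply: hi => //; exact: le_trans (ltW xs).
  have e0' : 0 < e / n by rewrite divr_gt0.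
  have [y [xy Hy]] := upper_tail0 x0 e0' hpos i1.
  exists y; split; first by apply: le_lt_trans xy; rewrite le_max lexx orbT.
  move: Hy; rewrite ltr_pdivlMr//.
  have := upper_momentB nn0 i1 x0 (ltW xy); rewrite /upper_moment.
  lra.
Qed.

Lemma pint_lower (c x : R) : 0 < x ->
  pint h (- p) c `]0, x[ = (lower_moment p h x + c * x `^ p) / p.
Proof.
move=> x0; have [_ i1] := int_h x0; have [_ i2] := power_integrable_tails p0 x0.
rewrite -(lower_moment_cst p0 x0) /lower_moment /pint opprK mulrCA -mulrDr mulrC mulKf//.
rewrite -RintegralZl// -RintegralD//; last exact: integrable_cmul.
by apply: eq_Rintegral => s _; rewrite /=; ring.
Qed.

Lemma pint_upper (c x : R) : 0 < x ->
  pint h n c `]x, +oo[ = (upper_moment n h x + c * x `^ (- n)) / n.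
Proof.
move=> x0; have [i1 _] := int_h x0; have [i2 _] := power_integrable_tails n0 x0.
rewrite -(upper_moment_cst n0 x0) /upper_moment /pint mulrCA -mulrDr mulrC mulKf//.
rewrite -RintegralZl// -RintegralD//; last exact: integrable_cmul.
by apply: eq_Rintegral => s _; rewrite /=; ring.
Qed.

Let pint_oo (q c x y : R) : q != 0 -> 0 < x -> x <= y ->
  pint h (- q) c `]x, y[ = \int[mu]_(s in `]x, y[) (s `^ (q - 1) * h s) + c * ((y `^ q - x `^ q) / q).
Proof.
move=> q0 x0 xy; rewrite -integral_power_oo// /pint opprK.
have c1 : increasing_pos (cst 1 : R -> R) by move=> *; exact: lexx.
have i1 := power_mul_integrable_oo (q - 1) y hi x0.
have i3 := power_mul_integrable_oo (q - 1) y c1 x0.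
have i4 : mu.-integrable `]x, y[ (EFin \o (fun s : R => s `^ (q - 1))).
  by apply: eq_integrable i3 => // s _; rewrite /= mulr1.
rewrite -RintegralZl// -RintegralD//; last exact: integrable_cmul.
by apply: eq_Rintegral => s _; rewrite /=; ring.
Qed.

Lemma pint_lowerB (c x y : R) : 0 < x -> x <= y ->
  pint h (- p) c `]x, y[
  = (lower_moment p h y + c * y `^ p - (lower_moment p h x + c * x `^ p)) / p.
Proof.
move=> x0 xy; have [_ i1] := int_h (lt_le_trans x0 xy).
rewrite pint_oo//.
have -> : lower_moment p h y + c * y `^ p - (lower_moment p h x + c * x `^ p)
  = lower_moment p h y - lower_moment p h x + c * (y `^ p - x `^ p) by ring.
by rewrite lower_momentB//; field.
Qed.

Lemma pint_upperB (c x y : R) : 0 < x -> x <= y ->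
  pint h n c `]x, y[
  = (upper_moment n h x + c * x `^ (- n) - (upper_moment n h y + c * y `^ (- n))) / n.
Proof.
move=> x0 xy; have [i1 _] := int_h x0.
rewrite -{1}[n]opprK pint_oo ?oppr_eq0//.
have -> : upper_moment n h x + c * x `^ (- n) - (upper_moment n h y + c * y `^ (- n))
  = upper_moment n h x - upper_moment n h y + c * (x `^ (- n) - y `^ (- n)) by ring.
by rewrite upper_momentB//; field.
Qed.

End moments_of_integrals.

(** * Solutions of the inhomogeneous equation *)

Section real_functions.
Variable R : realType.
Implicit Types (f g E om : R -> R) (x y d c : R).

Lemma is_derive_of_cvg f x d :
  t^-1 * (f (t + x) - f x) @[t --> 0^'] --> d -> is_derive x 1 f d.
Proof.
move=> H.
have E : (fun t : R => t^-1 *: ((f \o shift x) (t *: 1) - f x)) = (fun t => t^-1 * (f (t + x) - f x)).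
  by apply/funext => t; rewrite /= /GRing.scale/= mulr1.
have H' : t^-1 *: ((f \o shift x) (t *: (1 : R^o)) - f x) @[t --> 0^'] --> d.
  by rewrite E.
split; first by apply/cvg_ex; exists d.
by rewrite /derive; apply: cvg_lim.
Qed.

Lemma is_derive_cvg f x d : is_derive x 1 f d ->
  t^-1 * (f (t + x) - f x) @[t --> 0^'] --> d.
Proof.
case=> /cvg_ex[l Hl] Hd.
have E : (fun t : R => t^-1 *: ((f \o shift x) (t *: 1) - f x)) = (fun t => t^-1 * (f (t + x) - f x)).
  by apply/funext => t; rewrite /= /GRing.scale/= mulr1.
have : l = d by rewrite -Hd /derive; apply/esym/cvg_lim.
by move=> <-; rewrite E in Hl.
Qed.

(** Serves at the jumps of h, where E is not a sum of differentiable terms but is squeezed by a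
    function that is flat at x. *)
Lemma is_derive_dominated E om x c : om x = 0 ->
  (\forall y \near x, `|E y| <= c * om y) -> is_derive x 1 om 0 -> is_derive x 1 E 0.
Proof.
move=> om0 dom dom0; apply: is_derive_of_cvg.
have Ex0 : E x = 0.
  by apply/eqP; rewrite -normr_le0; have := nbhs_singleton dom; rewrite om0 mulr0.
have c0 : 0 <= `|c| by [].
have H := is_derive_cvg dom0; rewrite om0 in H.
apply/cvgrPdist_lt => e e0.
have e0' : 0 < e / (`|c| + 1) by rewrite divr_gt0// ltr_wpDl.
move/cvgrPdist_lt : H => /(_ _ e0') H.
have dom' : \forall t \near (0 : R)^', `|E (t + x)| <= c * om (t + x).
  have : \forall t \near (0 : R), `|E (t + x)| <= c * om (t + x).
    have cs : t + x @[t --> (0 : R)] --> x.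
      rewrite -[X in _ --> X]add0r; apply: cvgD; [exact: cvg_id|exact: cvg_cst].
    exact: (cs _ dom).
  by apply: nbhs_dnbhs.
near=> t; rewrite Ex0 sub0r subr0 normrN normrM.
have h1 : `|E (t + x)| <= c * om (t + x) by near: t.
have h2 : `|0 - t^-1 * (om (t + x) - 0)| < e / (`|c| + 1) by near: t.
move: h2; rewrite sub0r subr0 normrN normrM => h2.
have h3 : `|E (t + x)| <= `|c| * `|om (t + x)|.
  by rewrite -normrM; apply: (le_trans h1); exact: ler_norm.
apply: (@le_lt_trans _ _ (`|c| * (`|t^-1| * `|om (t + x)|))).
  by rewrite mulrCA; apply: ler_wpM2l.
apply: (@le_lt_trans _ _ (`|c| * (e / (`|c| + 1)))).
  by apply: ler_wpM2l => //; exact: ltW.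
by rewrite mulrA ltr_pdivrMr ?ltr_wpDl// mulrC ltr_pM2l// ltrDl.
Unshelve. all: end_near. Qed.

Lemma deriv_MVT f (df : R -> R) x y : x < y ->
  (forall s, x <= s -> s <= y -> is_derive s 1 f (df s)) ->
  exists s, [/\ x < s, s < y & f y - f x = df s * (y - x)].
Proof.
move=> xy H.
have [||s] := @MVT _ f df x y xy.
- by move=> s; rewrite in_itv/= => /andP[xs sy]; apply: H; exact: ltW.
- apply: derivable_within_continuous => s; rewrite in_itv/= => /andP[xs sy].
  by apply: ex_derive; exact: H.
by rewrite in_itv/= => /andP[xs sy] E; exists s.
Qed.

Lemma deriv_ge0 f (df : R -> R) x y : x <= y ->
  (forall s, x <= s -> s <= y -> is_derive s 1 f (df s)) ->
  (forall s, x < s -> s < y -> 0 <= df s) -> f x <= f y.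
Proof.
rewrite le_eqVlt => /predU1P[->//|xy] H H0.
have [s [xs sy E]] := deriv_MVT xy H.
by rewrite -subr_ge0 E mulr_ge0 ?H0// subr_ge0 ltW.
Qed.

Lemma deriv_gt0 f (df : R -> R) x y : x < y ->
  (forall s, x <= s -> s <= y -> is_derive s 1 f (df s)) ->
  (forall s, x < s -> s < y -> 0 < df s) -> f x < f y.
Proof.
move=> xy H H0; have [s [xs sy E]] := deriv_MVT xy H.
by rewrite -subr_gt0 E mulr_gt0 ?H0// subr_gt0.
Qed.

Lemma deriv_gt0_left f x d : is_derive x 1 f d -> 0 < d ->
  \forall y \near x^'-, f y < f x.
Proof.
move=> /is_derive_cvg H d0.
move/cvgrPdist_lt : H => /(_ _ d0); move=> -[e /= e0 He].
near=> y.
have yx : y < x by near: y; exact: nbhs_left_lt.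
have yxe : x - e < y by near: y; apply: nbhs_left_gt; rewrite gtrBl.
have := He (y - x); rewrite /= sub0r opprB gtr0_norm ?subr_gt0// ltrBlDr -ltrBlDl yxe.
move=> /(_ isT); rewrite subr_eq0 lt_eqF// => /(_ isT); rewrite subrK => H.
have : 0 < (y - x)^-1 * (f y - f x) by move: H; rewrite ltr_norml => /andP[_]; lra.
by rewrite nmulr_rgt0 ?invr_lt0 ?subr_lt0.
Unshelve. all: end_near. Qed.

Lemma deriv_lt0_right f x d : is_derive x 1 f d -> d < 0 ->
  \forall y \near x^'+, f y < f x.
Proof.
move=> /is_derive_cvg H d0.
have d0' : 0 < - d by rewrite oppr_gt0.
move/cvgrPdist_lt : H => /(_ _ d0'); move=> -[e /= e0 He].
near=> y.
have yx : x < y by near: y; exact: nbhs_right_gt.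
have yxe : y < x + e by near: y; apply: nbhs_right_lt; rewrite ltrDl.
have := He (y - x); rewrite /= sub0r normrN gtr0_norm ?subr_gt0// ltrBlDl yxe.
move=> /(_ isT); rewrite subr_eq0 gt_eqF// => /(_ isT); rewrite subrK => H.
have : (y - x)^-1 * (f y - f x) < 0 by move: H; rewrite ltr_norml => /andP[]; lra.
by rewrite pmulr_rlt0 ?invr_gt0 ?subr_gt0// subr_lt0.
Unshelve. all: end_near. Qed.

Lemma continuous_dominated f g x c : {for x, continuous g} ->
  (\forall y \near x, `|f y - f x| <= c * `|g y - g x|) -> {for x, continuous f}.
Proof.
move=> cg dom; apply/cvgrPdist_lt => e e0.
have e0' : 0 < e / (`|c| + 1) by rewrite divr_gt0// ltr_wpDl.
move/cvgrPdist_lt : cg => /(_ _ e0') H.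
near=> y.
have h1 : `|f y - f x| <= c * `|g y - g x| by near: y.
have h2 : `|g x - g y| < e / (`|c| + 1) by near: y.
rewrite distrC in h2; rewrite distrC.
apply: (le_lt_trans h1); apply: (@le_lt_trans _ _ (`|c| * (e / (`|c| + 1)))).
  apply: (@le_trans _ _ (`|c| * `|g y - g x|)); first by apply: ler_wpM2r => //; exact: ler_norm.
  by apply: ler_wpM2l => //; exact: ltW.
by rewrite mulrA ltr_pdivrMr ?ltr_wpDl// mulrC ltr_pM2l// ltrDl.
Unshelve. all: end_near. Qed.

Lemma continuous_IVT f x y v : x <= y ->
  (forall s, x <= s -> s <= y -> {for s, continuous f}) ->
  Num.min (f x) (f y) <= v <= Num.max (f x) (f y) ->
  exists s, [/\ x <= s, s <= y & f s = v].
Proof.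
move=> xy cf hv; have [|s] := @IVT _ f x y v xy _ hv.
  apply: continuous_in_subspaceT => s; rewrite inE/= in_itv/= => /andP[xs sy].
  exact: cf.
by rewrite in_itv/= => /andP[xs sy] E; exists s.
Qed.

End real_functions.

(** With l = ln (y / x) the quantity is x^p ((exp(p l) - 1) / p + (exp(- n l) - 1) / n), and exp u >
    1 + u bounds the two fractions strictly below by l and - l. *)
Lemma powR_gap (R : realType) (p n x y : R) : 0 < p -> 0 < n -> 0 < x -> 0 < y -> x != y ->
  0 < (y `^ p - x `^ p) / p - x `^ (n + p) * (x `^ (- n) - y `^ (- n)) / n.
Proof.
move=> p0 n0 x0 y0 xy; pose l := ln y - ln x.
have l0 : l != 0.
  by rewrite subr_eq0; apply: contra_neq xy => /(congr1 expR); rewrite !lnK.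
have powE q z : 0 < z -> z `^ q = expR (q * ln z) by move=> z0; rewrite /powR gt_eqF.
rewrite !powE//.
have -> : expR (p * ln y) = expR (p * ln x) * expR (p * l) by rewrite -expRD; congr expR; rewrite /l; ring.
have -> : expR (- n * ln y) = expR (- n * ln x) * expR (- (n * l)) by rewrite -expRD; congr expR; rewrite /l; ring.
have -> : expR ((n + p) * ln x) = expR (p * ln x) * (expR (- n * ln x))^-1.
  by rewrite -expRN -expRD; congr expR; ring.
set A := expR (p * ln x); set B := expR (- n * ln x).
have A0 : 0 < A by exact: expR_gt0.
have B0 : B != 0 by rewrite expR_eq0.
have -> : (A * expR (p * l) - A) / p - A / B * (B - B * expR (- (n * l))) / n
  = A * ((expR (p * l) - 1) / p + (expR (- (n * l)) - 1) / n).
  by field; rewrite B0 !gt_eqF.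
rewrite pmulr_rgt0//.
have h1 : l < (expR (p * l) - 1) / p.
  by rewrite ltr_pdivlMr// ltrBrDl mulrC expR_gt1Dx// mulf_neq0// gt_eqF.
have h2 : - l < (expR (- (n * l)) - 1) / n.
  rewrite ltr_pdivlMr// ltrBrDl mulNr (mulrC l); apply: expR_gt1Dx.
  by rewrite oppr_eq0 mulf_neq0// gt_eqF.
lra.
Qed.

Lemma powRDp (R : realType) (x r s : R) : 0 < x -> x `^ (r + s) = x `^ r * x `^ s.
Proof. by move=> x0; rewrite powRD//; apply/implyP => _; rewrite gt_eqF. Qed.

(** * Signed comparison of moments *)

Section moment_comparison.
Variables (R : realType) (p n : R) (h M N : R -> R).
Hypothesis mom : moments p n h M N.
Implicit Types (x y z t q C e m n : R).

Notation a x := (x `^ p).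
Notation b x := (x `^ (- n)).
Notation Y x := (x `^ (n + p)).

Let p0 : 0 < p := mom_p mom.
Let n0 : 0 < n := mom_n mom.
Let np0 : 0 < n + p. Proof. exact: addr_gt0. Qed.
Let hi : increasing_pos h := mom_incr mom.

Lemma powR_pnE x : 0 < x -> a x = Y x * b x.
Proof. by move=> x0; rewrite -powRDp//; congr (_ `^ _); ring. Qed.

Lemma powR_lt_pos q x y : 0 < q -> 0 < x -> x < y -> x `^ q < y `^ q.
Proof.
move=> q0 x0 xy; apply: gt0_ltr_powR => //; rewrite nnegrE ltW//.
exact: lt_trans xy.
Qed.

Lemma powR_lt_neg q x y : 0 < q -> 0 < x -> x < y -> y `^ (- q) < x `^ (- q).
Proof.
move=> q0 x0 xy; rewrite !powRN ltf_pV2 ?posrE ?powR_gt0//; last exact: lt_trans xy.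
exact: powR_lt_pos.
Qed.

Lemma M_lo x y : 0 < x -> x <= y -> h x * (a y - a x) <= M y - M x.
Proof.
move=> x0 xy.
have := @mom_weight _ _ _ _ _ _ mom p 0 (h x) x y x0 xy.
have E (D D' : R) : p * D / p + 0 * D' / n = D by field; rewrite !gt_eqF.
rewrite E subr_ge0; apply => s xs sy.
rewrite mul0r addr0 mulr_ge0 ?mulr_ge0 ?powR_ge0 ?(ltW p0) ?(ltW n0)// subr_ge0.
by apply: hi => //; exact: ltW.
Qed.

Lemma M_hi x y : 0 < x -> x <= y -> M y - M x <= h y * (a y - a x).
Proof.
move=> x0 xy.
have := @mom_weight _ _ _ _ _ _ mom (- p) 0 (h y) x y x0 xy.
have E (D D' : R) : - p * D / p + 0 * D' / n = - D by field; rewrite !gt_eqF.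
rewrite E oppr_ge0 subr_le0; apply => s xs sy.
rewrite mul0r addr0 mulNr mulNr oppr_ge0 mulr_ge0_le0 ?mulr_ge0 ?powR_ge0 ?(ltW p0) ?(ltW n0)// subr_le0.
by apply: hi => //; [exact: lt_trans xs|exact: ltW].
Qed.

Lemma N_lo x y : 0 < x -> x <= y -> h x * (b x - b y) <= N x - N y.
Proof.
move=> x0 xy.
have := @mom_weight _ _ _ _ _ _ mom 0 n (h x) x y x0 xy.
have E (D D' : R) : 0 * D' / p + n * D / n = D by field; rewrite !gt_eqF.
rewrite E subr_ge0; apply => s xs sy.
rewrite mul0r add0r mulr_ge0 ?mulr_ge0 ?powR_ge0 ?(ltW p0) ?(ltW n0)// subr_ge0.
by apply: hi => //; exact: ltW.
Qed.

Lemma N_hi x y : 0 < x -> x <= y -> N x - N y <= h y * (b x - b y).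
Proof.
move=> x0 xy.
have := @mom_weight _ _ _ _ _ _ mom 0 (- n) (h y) x y x0 xy.
have E (D D' : R) : 0 * D' / p + - n * D / n = - D by field; rewrite !gt_eqF.
rewrite E oppr_ge0 subr_le0; apply => s xs sy.
rewrite mul0r add0r mulNr mulNr oppr_ge0 mulr_ge0_le0 ?mulr_ge0 ?powR_ge0 ?(ltW p0) ?(ltW n0)// subr_le0.
by apply: hi => //; [exact: lt_trans xs|exact: ltW].
Qed.

(* [moment_gap C z x y] is the integral over ]x, y[ of s^(-n-1) (s^(n+p) - z^(n+p)) (h(s) - C). *)
Definition moment_gap C z x y := (M y - M x - C * (a y - a x)) / p
  - Y z * (N x - N y - C * (b x - b y)) / n.
Notation gap := moment_gap.

(** [moment_gap] for the payoff 1 at level 0; it measures how the gap moves with the level, as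
    [gapE] states. *)
Definition power_gap z x y := (a y - a x) / p - Y z * (b x - b y) / n.
Notation gap1 := power_gap.

Lemma gapE C C' z x y : gap C z x y = gap C' z x y + (C' - C) * gap1 z x y.
Proof. by rewrite /gap /gap1; ring. Qed.

Lemma gapD C z x y t : gap C z x t = gap C z x y + gap C z y t.
Proof. by rewrite /gap; ring. Qed.

Lemma gap1_gt0 z x y : 0 < z -> z <= x -> x < y -> 0 < gap1 z x y.
Proof.
move=> z0 zx xy; have x0 := lt_le_trans z0 zx; have y0 := lt_trans x0 xy.
apply: lt_le_trans (powR_gap p0 n0 x0 y0 _) _; first by rewrite lt_eqF.
rewrite /gap1 lerD2l lerN2 ler_pM2r ?invr_gt0// ler_wpM2r//.
  by rewrite subr_ge0 ltW// powR_lt_neg.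
exact: powR_le_pos.
Qed.

Lemma gap1_lt0 z x y : 0 < x -> x < y -> y <= z -> gap1 z x y < 0.
Proof.
move=> x0 xy yz; have y0 := lt_trans x0 xy.
have := powR_gap p0 n0 y0 x0; rewrite gt_eqF// => /(_ isT) G.
have : Y y * (b x - b y) <= Y z * (b x - b y).
  by rewrite ler_wpM2r ?powR_le_pos// subr_ge0 ltW// powR_lt_neg.
rewrite -(@ler_pM2r _ n^-1) ?invr_gt0// /gap1 => G'.
have E1 : (a x - a y) / p = - ((a y - a x) / p) by ring.
have E2 : Y y * (b y - b x) / n = - (Y y * (b x - b y) / n) by ring.
by rewrite E1 E2 in G; lra.
Qed.

(** The choice A = e and B = - e z^(n+p) in [mom_weight] makes the weight e s^(-n-1) (s^(n+p) -
    z^(n+p)), which changes sign at z only. *)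
Let gap_weight C z x y e : 0 < x -> x <= y ->
  (forall s, x < s -> s < y -> 0 <= e * ((Y s - Y z) * (h s - C))) -> 0 <= e * gap C z x y.
Proof.
move=> x0 xy H.
have := @mom_weight _ _ _ _ _ _ mom e (- (e * Y z)) C x y x0 xy.
have -> : e * gap C z x y = e * (M y - M x - C * (a y - a x)) / p +
  - (e * Y z) * (N x - N y - C * (b x - b y)) / n by rewrite /gap; ring.
apply => s xs sy; have s0 := lt_trans x0 xs.
have -> : s `^ (p - 1) = Y s * s `^ (- n - 1).
  by rewrite -powRDp//; congr (_ `^ _); ring.
have -> : (e * (Y s * s `^ (- n - 1)) + - (e * Y z) * s `^ (- n - 1)) * (h s - C)
  = s `^ (- n - 1) * (e * ((Y s - Y z) * (h s - C))) by ring.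
by rewrite mulr_ge0 ?powR_ge0// H.
Qed.

Lemma gap_ge0_right C z x y : 0 < z -> z <= x -> x <= y -> C <= h x -> 0 <= gap C z x y.
Proof.
move=> z0 zx xy hC; have x0 := lt_le_trans z0 zx; rewrite -[gap _ _ _ _]mul1r.
apply: gap_weight => // s xs sy; rewrite mul1r mulr_ge0// subr_ge0.
  by apply: powR_le_pos => //; exact: le_trans (ltW xs).
by apply: (le_trans hC); apply: hi => //; exact: ltW.
Qed.

Lemma gap_le0_right C z x y : 0 < z -> z <= x -> x <= y -> h y <= C -> gap C z x y <= 0.
Proof.
move=> z0 zx xy hC; have x0 := lt_le_trans z0 zx; rewrite -oppr_ge0 -mulN1r.
apply: gap_weight => // s xs sy; rewrite mulN1r oppr_ge0 mulr_ge0_le0//.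
  by rewrite subr_ge0; apply: powR_le_pos => //; exact: le_trans (ltW xs).
by rewrite subr_le0; apply: le_trans hC; apply: hi; [exact: lt_trans xs|exact: ltW].
Qed.

Lemma gap_ge0_left C z x y : 0 < x -> x <= y -> y <= z -> h y <= C -> 0 <= gap C z x y.
Proof.
move=> x0 xy yz hC; rewrite -[gap _ _ _ _]mul1r.
apply: gap_weight => // s xs sy; have s0 := lt_trans x0 xs; rewrite mul1r mulr_le0// subr_le0.
  by apply: powR_le_pos => //; exact: le_trans (ltW sy) yz.
by apply: le_trans hC; apply: hi => //; exact: ltW.
Qed.

Lemma gap_le0_left C z x y : 0 < x -> x <= y -> y <= z -> C <= h x -> gap C z x y <= 0.
Proof.
move=> x0 xy yz hC; rewrite -oppr_ge0 -mulN1r.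
apply: gap_weight => // s xs sy; have s0 := lt_trans x0 xs; rewrite mulN1r oppr_ge0 mulr_le0_ge0//.
  by rewrite subr_le0; apply: powR_le_pos => //; exact: le_trans (ltW sy) yz.
by rewrite subr_ge0; apply: (le_trans hC); apply: hi => //; exact: ltW.
Qed.

(** [mom_weight] gives weak inequalities only; strictness is gained by moving the level to h x and
    using the sign of [power_gap]. *)
Lemma gap_gt0_right C z x y : 0 < z -> z <= x -> x < y -> C < h x -> 0 < gap C z x y.
Proof.
move=> z0 zx xy hC; rewrite (gapE C (h x)) ltr_wpDl ?gap_ge0_right// ?ltW//.
by rewrite mulr_gt0 ?gap1_gt0// subr_gt0.
Qed.

Lemma gap_lt0_right C z x y : 0 < z -> z <= x -> x < y -> h y < C -> gap C z x y < 0.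
Proof.
move=> z0 zx xy hC; rewrite (gapE C (h y)).
have := gap_le0_right z0 zx (ltW xy) (lexx (h y)).
have : (h y - C) * gap1 z x y < 0 by rewrite nmulr_rlt0 ?gap1_gt0// subr_lt0.
lra.
Qed.

Lemma gap_gt0_left C z x y : 0 < x -> x < y -> y <= z -> h y < C -> 0 < gap C z x y.
Proof.
move=> x0 xy yz hC; rewrite (gapE C (h y)).
have := gap_ge0_left x0 (ltW xy) yz (lexx (h y)).
have : 0 < (h y - C) * gap1 z x y by rewrite nmulr_rgt0 ?gap1_lt0// subr_lt0.
lra.
Qed.

(** Strict because h is unbounded: beyond some y it exceeds h x. *)
Lemma N_gt x : 0 < x -> h x * b x < N x.
Proof.
move=> x0; have [y [y0 hy]] := mom_infty mom (h x).
have xy : x < y.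
  by rewrite ltNge; apply/negP => yx; have := hi y0 yx; rewrite leNgt hy.
have := N_lo x0 (ltW xy); have := mom_tail mom y0.
have : h x * b y < h y * b y by rewrite ltr_pM2r ?powR_gt0.
by rewrite mulrBr; lra.
Qed.

(* With L the generator minus r, [ode_sol mu nu / (r (n + p))] solves L y = - h; its value at t is C / r
   and its slope at t is 0 iff mu = M t - C t^p and nu = N t - C t^(-n). *)
Definition ode_sol mu nu x := n * (M x - mu) / a x + p * (N x - nu) / b x.
Notation sol := ode_sol.
Definition ode_hom mu1 nu1 x := n * mu1 / a x + p * nu1 / b x.
Notation hom := ode_hom.
Definition ode_slope mu nu x := Y x * (N x - nu) - (M x - mu).
Notation slope := ode_slope.

Lemma sol_hom mu nu mu1 nu1 x : sol (mu - mu1) (nu - nu1) x = sol mu nu x + hom mu1 nu1 x.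
Proof. by rewrite /sol /hom; ring. Qed.

(** Variation of constants: on either side of the point where a solution leaves C smoothly, its
    deviation from C is an integral of C - h with a positive weight. *)
Lemma sol_right C z x : 0 < z -> z <= x ->
  sol (M z - C * a z) (N z - C * b z) x = (n + p) * C + n * p / a x * gap C x z x.
Proof.
move=> z0 zx; have x0 := lt_le_trans z0 zx.
rewrite /sol /gap (powR_pnE x0); field.
by rewrite !gt_eqF ?powR_gt0.
Qed.

Lemma sol_left C z x : 0 < x -> x <= z ->
  sol (M z - C * a z) (N z - C * b z) x = (n + p) * C - n * p / a x * gap C x x z.
Proof.
move=> x0 xz.
rewrite /sol /gap (powR_pnE x0); field.
by rewrite !gt_eqF ?powR_gt0.
Qed.

Let fac0 x : 0 < x -> 0 < n * p / a x.
Proof. by move=> x0; rewrite divr_gt0 ?powR_gt0// mulr_gt0. Qed.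

Lemma sol_ge_right C z x : 0 < z -> z <= x -> h x <= C ->
  (n + p) * C <= sol (M z - C * a z) (N z - C * b z) x.
Proof.
move=> z0 zx hC; have x0 := lt_le_trans z0 zx.
by rewrite sol_right// lerDl mulr_ge0 ?(ltW (fac0 _))// gap_ge0_left.
Qed.

Lemma sol_ge_left C z x : 0 < x -> x <= z -> h z <= C ->
  (n + p) * C <= sol (M z - C * a z) (N z - C * b z) x.
Proof.
move=> x0 xz hC.
by rewrite sol_left// lerDl oppr_ge0 mulr_ge0_le0 ?(ltW (fac0 _))// gap_le0_right.
Qed.

Lemma sol_le_left C z x : 0 < x -> x <= z -> C <= h x ->
  sol (M z - C * a z) (N z - C * b z) x <= (n + p) * C.
Proof.
move=> x0 xz hC.
by rewrite sol_left// gerDl oppr_le0 mulr_ge0 ?(ltW (fac0 _))// gap_ge0_right.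
Qed.

Lemma sol_lt_left C z x : 0 < x -> x < z -> C < h x ->
  sol (M z - C * a z) (N z - C * b z) x < (n + p) * C.
Proof.
move=> x0 xz hC.
by rewrite sol_left ?(ltW xz)// gtrDl oppr_lt0 mulr_gt0 ?fac0// gap_gt0_right.
Qed.

(* In the variable x^(n+p), [ode_slope mu nu] is concave with supergradient [ode_tilt nu]. *)
Definition ode_tilt nu x := N x - nu - b x * h x.
Notation tilt := ode_tilt.

Lemma slope_lo mu nu x y : 0 < x -> x <= y ->
  (Y y - Y x) * tilt nu y <= slope mu nu y - slope mu nu x.
Proof.
move=> x0 xy; have y0 := lt_le_trans x0 xy.
have := N_hi x0 xy; have := M_hi x0 xy; rewrite /slope /tilt !powR_pnE//.
rewrite -subr_ge0 => h1; rewrite -subr_ge0 => h2.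
have h3 : 0 <= Y x * (h y * (b x - b y) - (N x - N y)) by rewrite mulr_ge0 ?powR_ge0.
rewrite -subr_ge0; apply: (le_trans (addr_ge0 h1 h3)).
by rewrite le_eqVlt; apply/orP; left; apply/eqP; ring.
Qed.

Lemma slope_hi mu nu x y : 0 < x -> x <= y ->
  slope mu nu y - slope mu nu x <= (Y y - Y x) * tilt nu x.
Proof.
move=> x0 xy; have y0 := lt_le_trans x0 xy.
have := N_lo x0 xy; have := M_lo x0 xy; rewrite /slope /tilt !powR_pnE//.
rewrite -subr_ge0 => h1; rewrite -subr_ge0 => h2.
have h3 : 0 <= Y y * (N x - N y - h x * (b x - b y)) by rewrite mulr_ge0 ?powR_ge0.
rewrite -subr_ge0; apply: (le_trans (addr_ge0 h1 h3)).
by rewrite le_eqVlt; apply/orP; left; apply/eqP; ring.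
Qed.

Lemma slope_concave mu nu x y z : 0 < x -> x <= y -> y <= z ->
  slope mu nu x * (Y z - Y y) + slope mu nu z * (Y y - Y x) <= slope mu nu y * (Y z - Y x).
Proof.
move=> x0 xy yz; have y0 := lt_le_trans x0 xy.
have h1 := slope_lo mu nu x0 xy; have h2 := slope_hi mu nu y0 yz.
have g1 : 0 <= Y y - Y x by rewrite subr_ge0 powR_le_pos.
have g2 : 0 <= Y z - Y y by rewrite subr_ge0 powR_le_pos.
rewrite -subr_ge0 in h1; rewrite -subr_ge0 in h2.
have := mulr_ge0 g2 h1; have := mulr_ge0 g1 h2 => k1 k2.
rewrite -subr_ge0; apply: (le_trans (addr_ge0 k1 k2)).
by rewrite le_eqVlt; apply/orP; left; apply/eqP; ring.
Qed.

Lemma slope_between mu nu x y z : 0 < x -> x <= y -> y <= z ->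
  0 <= slope mu nu x -> 0 <= slope mu nu z -> 0 <= slope mu nu y.
Proof.
move=> x0 xy yz sx sz; have y0 := lt_le_trans x0 xy.
move: xy; rewrite le_eqVlt => /predU1P[<-//|xy].
have g1 : 0 <= Y y - Y x by rewrite subr_ge0 powR_le_pos// ltW.
have g2 : 0 <= Y z - Y y by rewrite subr_ge0 powR_le_pos.
have g3 : 0 < Y z - Y x by rewrite subr_gt0 powR_lt_pos// (lt_le_trans xy).
rewrite -(pmulr_lge0 _ g3); apply: le_trans (slope_concave mu nu x0 (ltW xy) yz).
by rewrite addr_ge0 ?mulr_ge0.
Qed.

Lemma slope_between_gt mu nu x y z : 0 < x -> x <= y -> y < z ->
  0 < slope mu nu x -> 0 <= slope mu nu z -> 0 < slope mu nu y.
Proof.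
move=> x0 xy yz sx sz; have y0 := lt_le_trans x0 xy.
have g1 : 0 <= Y y - Y x by rewrite subr_ge0 powR_le_pos.
have g2 : 0 < Y z - Y y by rewrite subr_gt0 powR_lt_pos.
have g3 : 0 < Y z - Y x by rewrite subr_gt0 powR_lt_pos// (le_lt_trans xy).
rewrite -(pmulr_lgt0 _ g3); apply: lt_le_trans (slope_concave mu nu x0 xy (ltW yz)).
by rewrite ltr_pwDl ?mulr_gt0// mulr_ge0.
Qed.

Lemma slope_between_lt mu nu x y z : 0 < x -> x < y -> y <= z ->
  0 <= slope mu nu x -> 0 < slope mu nu z -> 0 < slope mu nu y.
Proof.
move=> x0 xy yz sx sz; have y0 := lt_trans x0 xy.
have g1 : 0 < Y y - Y x by rewrite subr_gt0 powR_lt_pos.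
have g2 : 0 <= Y z - Y y by rewrite subr_ge0 powR_le_pos.
have g3 : 0 < Y z - Y x by rewrite subr_gt0 powR_lt_pos// (lt_le_trans xy).
rewrite -(pmulr_lgt0 _ g3); apply: lt_le_trans (slope_concave mu nu x0 (ltW xy) yz).
by rewrite ltr_wpDl ?mulr_gt0// mulr_ge0.
Qed.

Lemma slope_after mu nu x y z : 0 < x -> x < y -> y <= z ->
  0 <= slope mu nu x -> slope mu nu y <= 0 -> slope mu nu z <= 0.
Proof.
move=> x0 xy; rewrite le_eqVlt => /predU1P[<-//|yz] sx sy.
rewrite leNgt; apply/negP => sz.
by have := slope_between_lt x0 xy (ltW yz) sx sz; rewrite ltNge sy.
Qed.

(** With nu = 0, where no x^n is added to [R_h], the tilt is N - x^(-n) h, positive by [N_gt]. *)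
Lemma slope0_increasing mu x y : 0 < x -> x < y -> slope mu 0 x < slope mu 0 y.
Proof.
move=> x0 xy; have y0 := lt_trans x0 xy; rewrite -subr_gt0.
apply: lt_le_trans (slope_lo mu 0 x0 (ltW xy)).
apply: mulr_gt0; first by rewrite subr_gt0 powR_lt_pos.
by rewrite /tilt subr0 subr_gt0 mulrC N_gt.
Qed.

Let lipschitz_bound u v x y : 0 < u -> u <= x -> x <= v -> u <= y -> y <= v ->
  `|M y - M x| <= (`|h u| + `|h v|) * `|a y - a x| /\
  `|N y - N x| <= (`|h u| + `|h v|) * `|b y - b x|.
Proof.
move=> u0 ux xv uy yv.
wlog xy : x y ux xv uy yv / x <= y => [hw|].
  have [xy|/ltW yx] := leP x y; first exact: hw.
  have [h1 h2] := hw y x uy yv ux xv yx.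
  by rewrite (distrC (M y)) (distrC (N y)) (distrC (a y)) (distrC (b y)).
have x0 := lt_le_trans u0 ux; have y0 := lt_le_trans x0 xy.
have hb z : u <= z -> z <= v -> `|h z| <= `|h u| + `|h v|.
  move=> uz zv; have z0 := lt_le_trans u0 uz.
  have := hi u0 uz; have := hi z0 zv.
  have := ler_norm (h v); have := ler_norm (- h u); rewrite normrN.
  have := normr_ge0 (h u); have := normr_ge0 (h v).
  by move=> *; rewrite ler_norml; apply/andP; split; lra.
have ga : 0 <= a y - a x by rewrite subr_ge0 powR_le_pos.
have gb : 0 <= b x - b y by rewrite subr_ge0 powR_le_neg.
have key (D g : R) : 0 <= g -> h x * g <= D -> D <= h y * g -> `|D| <= (`|h u| + `|h v|) * g.
  move=> g0 D1 D2; have := hb x ux xv; have := hb y uy yv.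
  rewrite !ler_norml => /andP[_ h1] /andP[h2 _]; apply/andP; split.
    by apply: le_trans D1; rewrite -mulNr ler_wpM2r.
  by apply: (le_trans D2); rewrite ler_wpM2r.
split; first by rewrite (ger0_norm ga); apply: key => //; [exact: M_lo|exact: M_hi].
rewrite distrC (distrC (b y)) (ger0_norm gb); apply: key => //; [exact: N_lo|exact: N_hi].
Qed.

Lemma M_lipschitz u v x y : 0 < u -> u <= x -> x <= v -> u <= y -> y <= v ->
  `|M y - M x| <= (`|h u| + `|h v|) * `|a y - a x|.
Proof. by move=> u0 ux xv uy yv; have [] := lipschitz_bound u0 ux xv uy yv. Qed.

Lemma N_lipschitz u v x y : 0 < u -> u <= x -> x <= v -> u <= y -> y <= v ->
  `|N y - N x| <= (`|h u| + `|h v|) * `|b y - b x|.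
Proof. by move=> u0 ux xv uy yv; have [] := lipschitz_bound u0 ux xv uy yv. Qed.

Lemma powR_continuous q x : 0 < x -> {for x, continuous (fun s : R => s `^ q)}.
Proof.
move=> x0; apply/differentiable_continuous/derivable1_diffP/ex_derive.
exact: is_derive1_powR.
Qed.

Lemma near_half_double x : 0 < x -> \forall y \near x, x / 2 <= y /\ y <= x * 2.
Proof.
move=> x0; near=> y; split; apply: ltW; near: y.
  by apply: lt_nbhsr; lra.
by apply: lt_nbhsl; lra.
Unshelve. all: end_near. Qed.

Lemma M_continuous x : 0 < x -> {for x, continuous M}.
Proof.
move=> x0; apply: (@continuous_dominated R M _ x (`|h (x / 2)| + `|h (x * 2)|) (powR_continuous (q := p) x0)).
apply: filterS (near_half_double x0) => y [y1 y2].
by apply: M_lipschitz => //; lra.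
Qed.

Lemma N_continuous x : 0 < x -> {for x, continuous N}.
Proof.
move=> x0; apply: (@continuous_dominated R N _ x (`|h (x / 2)| + `|h (x * 2)|) (powR_continuous (q := - n) x0)).
apply: filterS (near_half_double x0) => y [y1 y2].
by apply: N_lipschitz => //; lra.
Qed.

End moment_comparison.

Lemma between_norms (R : realDomainType) (u v w : R) : u <= w -> w <= v ->
  - (`|u| + `|v|) <= w /\ w <= `|u| + `|v|.
Proof.
have := ler_norm v; have := ler_norm (- u); rewrite normrN.
have := normr_ge0 u; have := normr_ge0 v.
by move=> *; split; lra.
Qed.

(** * Differentiability of the solutions *)

Section ode_derivatives.
Variables (R : realType) (p n : R) (h M N : R -> R).
Hypothesis mom : moments p n h M N.
Implicit Types (x y z t q C e : R).

Notation a x := (x `^ p).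
Notation b x := (x `^ (- n)).
Notation Y x := (x `^ (n + p)).
Notation gap1 := (power_gap p n).
Notation sol := (ode_sol p n M N).
Notation hom := (ode_hom p n).
Notation slope := (ode_slope p n M N).

Let p0 : 0 < p := mom_p mom.
Let n0 : 0 < n := mom_n mom.
Let hi : increasing_pos h := mom_incr mom.

(** [hom (a z) (b z)] is the homogeneous solution with value n + p and slope 0 at z. It has its
    minimum there, and a multiple of it is w0 between zeta and alpha. *)
Lemma hom_right z x : 0 < z -> z <= x ->
  hom (a z) (b z) x = (n + p) - n * p / a x * gap1 x z x.
Proof.
move=> z0 zx; have x0 := lt_le_trans z0 zx.
rewrite /ode_hom /power_gap (powR_pnE p n x0); field.
by rewrite !gt_eqF ?powR_gt0.
Qed.

Lemma hom_left z x : 0 < x -> x <= z ->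
  hom (a z) (b z) x = (n + p) + n * p / a x * gap1 x x z.
Proof.
move=> x0 xz.
rewrite /ode_hom /power_gap (powR_pnE p n x0); field.
by rewrite !gt_eqF ?powR_gt0.
Qed.

Let fac0 x : 0 < x -> 0 < n * p / a x.
Proof. by move=> x0; rewrite divr_gt0 ?powR_gt0// mulr_gt0. Qed.

Lemma hom_gt z x : 0 < z -> 0 < x -> x != z -> n + p < hom (a z) (b z) x.
Proof.
move=> z0 x0; rewrite neq_lt => /orP[xz|zx].
  by rewrite hom_left ?ltW// ltrDl mulr_gt0 ?fac0// (gap1_gt0 mom).
by rewrite hom_right ?ltW// ltrDl oppr_gt0 pmulr_rlt0 ?fac0// (gap1_lt0 mom).
Qed.

Lemma hom_self z : 0 < z -> hom (a z) (b z) z = n + p.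
Proof. by move=> z0; rewrite hom_right// /power_gap; ring. Qed.

Lemma hom_ge z x : 0 < z -> 0 < x -> n + p <= hom (a z) (b z) x.
Proof.
move=> z0 x0; have [->|xz] := eqVneq x z; first by rewrite hom_self.
by apply: ltW; exact: hom_gt.
Qed.

Lemma hom_lt z t x : 0 < z -> z < t -> t <= x -> hom (a t) (b t) x < hom (a z) (b z) x.
Proof.
move=> z0 zt tx; have x0 : 0 < x by exact: lt_le_trans (lt_trans z0 zt) tx.
have -> : hom (a t) (b t) x = hom (a z) (b z) x + n * p / a x * gap1 x z t.
  by rewrite /ode_hom /power_gap (powR_pnE p n x0); field; rewrite !gt_eqF ?powR_gt0.
by rewrite gtrDl pmulr_rlt0 ?fac0// (gap1_lt0 mom).
Qed.

Lemma homZ k m1 n1 x : hom (k * m1) (k * n1) x = k * hom m1 n1 x.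
Proof. by rewrite /ode_hom; ring. Qed.

Lemma is_derive_hom m1 n1 x : 0 < x ->
  is_derive x 1 (hom m1 n1) (n * p / (x * a x) * (Y x * n1 - m1)).
Proof.
move=> x0.
have -> : hom m1 n1 = fun y => n * m1 * y `^ (- p) + p * n1 * y `^ n.
  by apply/funext => y; rewrite /ode_hom !powRN invrK.
have -> : n * p / (x * a x) * (Y x * n1 - m1)
  = n * m1 * (- p * x `^ (- p - 1)) + p * n1 * (n * x `^ (n - 1)).
  have xE q : x `^ (q - 1) = x `^ q / x by rewrite powRDp// powRN powRr1// ltW.
  rewrite !xE (powRDp _ _ x0) powRN; field.
  by rewrite !gt_eqF ?powR_gt0.
by apply: is_derive_add; apply: is_derive_cmul; exact: is_derive1_powR.
Qed.

(** With |h| <= K on [x/2, 2x], the solutions leaving the levels K and - K smoothly at x stay above,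
    respectively below, these levels; subtracting the homogeneous part encloses the remainder. *)
Let sol_remainder x y : 0 < x -> x / 2 <= y -> y <= x * 2 ->
  `|sol (M x) (N x) y| <= (`|h (x / 2)| + `|h (x * 2)|) * (hom (a x) (b x) y - (n + p)).
Proof.
move=> x0 y1 y2; have x20 : 0 < x / 2 by rewrite divr_gt0.
have y0 : 0 < y by exact: lt_le_trans y1.
have E C : sol (M x) (N x) y = sol (M x - C * a x) (N x - C * b x) y - C * hom (a x) (b x) y.
  by rewrite sol_hom homZ; ring.
set K : R := `|h (x / 2)| + `|h (x * 2)|.
have hb z : x / 2 <= z -> z <= x * 2 -> - K <= h z /\ h z <= K.
  move=> z1 z2; have z0 := lt_le_trans x20 z1.
  by apply: between_norms; apply: hi.
have [hx1 hx2] : - K <= h x /\ h x <= K by apply: hb; lra.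
have [hy1 hy2] := hb y y1 y2.
rewrite ler_norml; have [xy|/ltW yx] := leP x y; apply/andP; split.
- by rewrite (E K); have := sol_ge_right mom x0 xy hy2; lra.
- rewrite (E (- K)); have : sol (M x - - K * a x) (N x - - K * b x) y <= (n + p) * - K.
    rewrite (sol_right mom)// gerDl pmulr_rle0 ?fac0//.
    by apply: (gap_le0_left mom).
  lra.
- by rewrite (E K); have := sol_ge_left mom y0 yx hx2; lra.
- by rewrite (E (- K)); have := sol_le_left mom y0 yx hy1; lra.
Qed.

Lemma is_derive_sol mu nu x : 0 < x ->
  is_derive x 1 (sol mu nu) (n * p / (x * a x) * slope mu nu x).
Proof.
move=> x0.
(* A smooth homogeneous part plus a remainder of zero derivative at x, whether or not h jumps at
   x. *)
have -> : sol mu nu = fun y => hom (M x - mu) (N x - nu) y + sol (M x) (N x) y.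
  by apply/funext => y; rewrite /ode_sol /ode_hom; ring.
have -> : n * p / (x * a x) * slope mu nu x
   = n * p / (x * a x) * (Y x * (N x - nu) - (M x - mu)) + 0 by rewrite addr0.
apply: is_derive_add; first exact: is_derive_hom.
apply: (@is_derive_dominated R _ (fun y => hom (a x) (b x) y - (n + p)) x (`|h (x / 2)| + `|h (x * 2)|)).
- by rewrite hom_self// subrr.
- by apply: filterS (near_half_double x0) => y [y1 y2]; exact: sol_remainder.
- have -> : 0 = n * p / (x * a x) * (Y x * b x - a x) - 0 by rewrite (powR_pnE p n x0) subrr mulr0 subr0.
  by apply: is_derive_sub; exact: is_derive_hom.
Qed.

Lemma sol_nondecreasing mu nu x y : 0 < x -> x <= y ->
  (forall s, x < s -> s < y -> 0 <= slope mu nu s) -> sol mu nu x <= sol mu nu y.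
Proof.
move=> x0 xy H; apply: (deriv_ge0 xy (df := fun s => n * p / (s * a s) * slope mu nu s)).
  by move=> s xs _; apply: is_derive_sol; exact: lt_le_trans xs.
move=> s xs sy; have s0 := lt_trans x0 xs.
by apply: mulr_ge0; [rewrite divr_ge0 ?mulr_ge0 ?powR_ge0 ?ltW|exact: H].
Qed.

Lemma sol_increasing mu nu x y : 0 < x -> x < y ->
  (forall s, x < s -> s < y -> 0 < slope mu nu s) -> sol mu nu x < sol mu nu y.
Proof.
move=> x0 xy H; apply: (deriv_gt0 xy (df := fun s => n * p / (s * a s) * slope mu nu s)).
  by move=> s xs _; apply: is_derive_sol; exact: lt_le_trans xs.
move=> s xs sy; have s0 := lt_trans x0 xs.
by rewrite mulr_gt0 ?H// divr_gt0 ?mulr_gt0 ?powR_gt0.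
Qed.

Lemma sol_nonincreasing mu nu x y : 0 < x -> x <= y ->
  (forall s, x < s -> s < y -> slope mu nu s <= 0) -> sol mu nu y <= sol mu nu x.
Proof.
move=> x0 xy H; rewrite -lerN2.
apply: (deriv_ge0 xy (f := fun s => - sol mu nu s) (df := fun s => - (n * p / (s * a s) * slope mu nu s))).
  move=> s xs _; have s0 := lt_le_trans x0 xs.
  have -> : (fun s => - sol mu nu s) = (fun s => -1 * sol mu nu s) by apply/funext => u; rewrite mulN1r.
  by have := is_derive_cmul (- 1) (is_derive_sol mu nu s0); rewrite mulN1r.
move=> s xs sy; have s0 := lt_trans x0 xs.
rewrite oppr_ge0; apply: mulr_ge0_le0; last exact: H.
by rewrite divr_ge0 ?mulr_ge0 ?powR_ge0 ?ltW.
Qed.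

Lemma hom_increasing z x y : 0 < z -> z <= x -> x < y -> hom (a z) (b z) x < hom (a z) (b z) y.
Proof.
move=> z0 zx xy; have x0 := lt_le_trans z0 zx.
apply: (deriv_gt0 xy (df := fun s => n * p / (s * a s) * (Y s * b z - a z))).
  by move=> s xs _; apply: is_derive_hom; exact: lt_le_trans xs.
move=> s xs sy; have s0 := lt_trans x0 xs.
rewrite mulr_gt0 ?divr_gt0 ?mulr_gt0 ?powR_gt0//.
rewrite (powR_pnE p n z0) -mulrBl mulr_gt0 ?powR_gt0// subr_gt0.
by apply: powR_lt_pos; rewrite ?addr_gt0// (le_lt_trans zx).
Qed.

Lemma slope_continuous mu nu x : 0 < x -> {for x, continuous (slope mu nu)}.
Proof.
move=> x0; rewrite /ode_slope.
apply: (@continuousB _ R^o).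
  apply: (@continuousM _ R^o); first exact: powR_continuous.
  by apply: (@continuousB _ R^o); [exact: N_continuous mom _ x0|exact: cvg_cst].
by apply: (@continuousB _ R^o); [exact: M_continuous mom _ x0|exact: cvg_cst].
Qed.

End ode_derivatives.

(** * The dagger points *)

Section exit_and_entry.
Variables (R : realType) (p n : R) (h M N : R -> R).
Hypothesis mom : moments p n h M N.
Implicit Types (x y z t q C e k : R).

Notation a x := (x `^ p).
Notation b x := (x `^ (- n)).
Notation Y x := (x `^ (n + p)).
Notation gap := (moment_gap p n M N).
Notation sol := (ode_sol p n M N).
Notation hom := (ode_hom p n).
Notation slope := (ode_slope p n M N).

Let p0 : 0 < p := mom_p mom.
Let n0 : 0 < n := mom_n mom.
Let np0 : 0 < n + p. Proof. exact: addr_gt0. Qed.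
Let hi : increasing_pos h := mom_incr mom.

Lemma powR_lt_neg_inv q x y : 0 < q -> 0 < x -> 0 < y -> x `^ (- q) < y `^ (- q) -> y < x.
Proof.
move=> q0 x0 y0 xy; rewrite ltNge; apply/negP => yx.
by move: xy; rewrite ltNge powR_le_neg.
Qed.

Lemma powR_neg_surj q t : 0 < q -> 0 < t -> exists z, 0 < z /\ z `^ (- q) = t.
Proof.
move=> q0 t0; exists (t `^ (- q^-1)); split; first exact: powR_gt0.
by rewrite -powRrM mulrNN mulVf ?gt_eqF// powRr1// ltW.
Qed.

Lemma powR_neg_inj q x y : 0 < q -> 0 < x -> 0 < y -> x `^ (- q) = y `^ (- q) -> x = y.
Proof.
move=> q0 x0 y0 E; apply/eqP; rewrite eq_le !leNgt; apply/andP; split; apply/negP => l.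
  by have := powR_lt_neg q0 y0 l; rewrite E ltxx.
by have := powR_lt_neg q0 x0 l; rewrite E ltxx.
Qed.

Lemma level_h C d : 0 < d -> N d = C * b d -> h d < C.
Proof. by move=> d0 E; have := N_gt mom d0; rewrite E ltr_pM2r// powR_gt0. Qed.

(** N x <= C x^(-n) with x > d would force h < C on ]d, x[, and the contribution of this interval
    would keep N d below C d^(-n). *)
Lemma level_gt C d x : 0 < d -> d < x -> N d = C * b d -> C * b x < N x.
Proof.
move=> d0 dx E; have x0 := lt_trans d0 dx.
rewrite ltNge; apply/negP => Nx.
have hx : h x < C.
  by have := lt_le_trans (N_gt mom x0) Nx; rewrite ltr_pM2r// powR_gt0.
have := N_hi mom d0 (ltW dx).
have : h x * (b d - b x) < C * (b d - b x) by rewrite ltr_pM2r// subr_gt0 powR_lt_neg.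
by rewrite E; lra.
Qed.

Lemma level_mono C C' d d' : 0 < d -> 0 < d' -> N d = C * b d -> N d' = C' * b d' -> C < C' -> d < d'.
Proof.
move=> d0 d0' E E' CC; rewrite ltNge; apply/negP; rewrite le_eqVlt => /predU1P[dd|dd].
  by move: E' CC; rewrite dd E => /mulIf ->; rewrite ?ltxx ?gt_eqF ?powR_gt0.
have := level_gt d0' dd E'; rewrite E ltr_pM2r ?powR_gt0// => /lt_trans /(_ CC).
by rewrite ltxx.
Qed.

Lemma level_exists C x : 0 < x -> h x < C -> exists d, 0 < d /\ N d = C * b d.
Proof.
move=> x0 hx; have [y [y0 hy]] := mom_infty mom C.
have xy : x < y by rewrite ltNge; apply/negP => /(hi y0); rewrite leNgt (lt_trans hx hy).
have hC : 0 < C - h x by rewrite subr_gt0.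
(* For w <= x, N w <= N x + h x (w^(-n) - x^(-n)), and w^(-n) >= q makes this at most C w^(-n). *)
pose q := (N x - h x * b x) / (C - h x).
have q0 : 0 < q by rewrite divr_gt0// subr_gt0 (N_gt mom).
have [z [z0 bz]] := powR_neg_surj n0 q0.
pose w := Num.min z x.
have w0 : 0 < w by rewrite lt_min z0.
have wx : w <= x by rewrite ge_min lexx orbT.
have bw : q <= b w by rewrite -bz powR_le_neg// ge_min lexx.
have fw : N w - C * b w <= 0.
  have := N_hi mom w0 wx.
  have : (C - h x) * q <= (C - h x) * b w by rewrite ler_pM2l.
  by rewrite /q mulrC divfK ?gt_eqF//; lra.
have fy : 0 <= N y - C * b y.
  have := N_gt mom y0; have : C * b y < h y * b y by rewrite ltr_pM2r// powR_gt0.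
  lra.
have [||d [wd _ E]] := @continuous_IVT R (fun s => N s - C * b s) w y 0 (le_trans wx (ltW xy)).
- move=> s ws _; have s0 := lt_le_trans w0 ws.
  apply: (@continuousB _ R^o); first exact: N_continuous mom _ s0.
  by apply: (@continuousM _ R^o); [exact: cvg_cst|exact: powR_continuous].
- by rewrite ge_min fw/= le_max fy orbT.
exists d; split; first exact: lt_le_trans wd.
by apply/eqP; rewrite -subr_eq0 E.
Qed.

Section exit_value.
Variable k : R.
Hypothesis k0 : 0 < k.

(* Up to a positive factor, [k a(z) - (M al - k1 a(al))] is the coefficient of x^m in the payoff
   after entering at [al]. *)
Lemma entry_coef_decreasing k1 z1 z2 al1 al2 : 0 < z1 -> z1 < al1 -> 0 < z2 -> z2 < al2 ->
  al1 < al2 -> k1 < h al1 ->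
  N al1 - k1 * b al1 = k * b z1 -> N al2 - k1 * b al2 = k * b z2 ->
  k * a z2 - (M al2 - k1 * a al2) < k * a z1 - (M al1 - k1 * a al1).
Proof.
move=> z10 za1 z20 za2 al12 hal1 E1 E2.
have al10 := lt_trans z10 za1; have al20 := lt_trans z20 za2.
have z12 : z1 < z2.
  apply: (powR_lt_neg_inv n0 z20 z10).
  rewrite -(ltr_pM2l k0) -E1 -E2 -subr_gt0.
  have := N_lo mom al10 (ltW al12).
  have : k1 * (b al1 - b al2) < h al1 * (b al1 - b al2) by rewrite ltr_pM2r// subr_gt0 powR_lt_neg.
  lra.
pose mu1 := M al1 - k1 * a al1 - k * a z1.
pose mu2 := M al2 - k1 * a al2 - k * a z2.
have W1 s : sol mu1 0 s = sol (M al1 - k1 * a al1) (N al1 - k1 * b al1) s + k * hom (a z1) (b z1) s.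
  by rewrite -homZ -sol_hom E1 subrr.
have W2 s : sol mu2 0 s = sol (M al2 - k1 * a al2) (N al2 - k1 * b al2) s + k * hom (a z2) (b z2) s.
  by rewrite -homZ -sol_hom E2 subrr.
have self s : 0 < s -> sol (M s - k1 * a s) (N s - k1 * b s) s = (n + p) * k1.
  by move=> s0; rewrite (sol_right mom)// /moment_gap; ring.
(* The two solutions differ by a multiple of x^(-p), so their order at one point decides. *)
suff [s [s0 Hs]] : exists s, 0 < s /\ sol mu2 0 s < sol mu1 0 s.
  have : sol mu1 0 s - sol mu2 0 s = n / a s * (mu2 - mu1) by rewrite /ode_sol; ring.
  move=> E; move: Hs; rewrite -subr_gt0 E pmulr_rgt0 ?divr_gt0 ?powR_gt0//.
  by rewrite /mu1 /mu2; lra.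
(* The point is [al1] if z2 <= al1: there h > k1 has pushed the second solution down and the larger
   z gives the smaller [hom]. Otherwise it is z2, where the second [hom] is minimal while the first
   solution has not decreased since [al1]. *)
have [z2al1|al1z2] := leP z2 al1.
  exists al1; split=> //; rewrite W1 W2 self//.
  have := sol_lt_left mom al10 al12 hal1.
  have : k * hom (a z2) (b z2) al1 < k * hom (a z1) (b z1) al1 by rewrite ltr_pM2l// (hom_lt mom).
  lra.
exists z2; split=> //.
have h1 : sol mu1 0 al1 <= sol mu1 0 z2.
  apply: (sol_nondecreasing mom) => //; first exact: ltW.
  move=> s als _.
  have : slope mu1 0 al1 = k * (Y al1 * b z1 - a z1).
    have -> : slope mu1 0 al1 = Y al1 * (N al1 - k1 * b al1 + k1 * b al1) - (k1 * a al1 + k * a z1).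
      by rewrite /ode_slope /mu1; ring.
    by rewrite E1 (powR_pnE p n al10); ring.
  have : 0 < Y al1 * b z1 - a z1.
    by rewrite (powR_pnE p n z10) -mulrBl mulr_gt0 ?powR_gt0// subr_gt0 powR_lt_pos.
  move=> g E; apply: ltW; apply: lt_trans (slope0_increasing mom mu1 al10 als).
  by rewrite E mulr_gt0.
apply: lt_le_trans h1; rewrite W1 W2 self//.
have := sol_lt_left mom z20 za2 (lt_le_trans hal1 (hi al10 (ltW al1z2))).
rewrite (hom_self mom)//.
have : k * (n + p) <= k * hom (a z1) (b z1) al1 by rewrite ler_pM2l// (hom_ge mom).
lra.
Qed.

Variable de : R.
Hypotheses (de0 : 0 < de) (Nde : N de = k * b de).

(** As N de = k de^(-n), the solution leaving k smoothly at [de] is [sol mude 0]: the equation of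
    [delta_dag] says that it has no x^n term besides that of [R_h]. *)
Let mude := M de - k * a de.

Let exit_solE x : sol mude 0 x = sol (M de - k * a de) (N de - k * b de) x.
Proof. by rewrite Nde subrr. Qed.

Lemma exit_slope0 : slope mude 0 de = 0.
Proof. by rewrite /ode_slope /mude Nde (powR_pnE p n de0); ring. Qed.

Lemma exit_slope_gt0 x : de < x -> 0 < slope mude 0 x.
Proof. by move=> dx; have := slope0_increasing mom mude de0 dx; rewrite exit_slope0. Qed.

Lemma exit_sol_de : sol mude 0 de = (n + p) * k.
Proof. by rewrite exit_solE (sol_right mom)// /moment_gap; ring. Qed.

Lemma exit_sol_lt x y : de <= x -> x < y -> sol mude 0 x < sol mude 0 y.
Proof.
move=> dx xy; apply: (sol_increasing mom) => //; first exact: lt_le_trans dx.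
by move=> s xs _; apply: exit_slope_gt0; exact: le_lt_trans xs.
Qed.

Lemma exit_sol_le x y : de <= x -> x <= y -> sol mude 0 x <= sol mude 0 y.
Proof. by move=> dx; rewrite le_eqVlt => /predU1P[->//|xy]; apply: ltW; exact: exit_sol_lt. Qed.

(* The equations of [za_dag]; [k] stands for - r K and [k1] for r K1. *)
Definition is_entry k1 z al := [/\ 0 < z, z < al, de < al,
  M al - k1 * a al = mude + k * a z & N al - k1 * b al = k * b z].

Let entry_sol k1 z al x : is_entry k1 z al ->
  sol (M al - k1 * a al) (N al - k1 * b al) x = sol mude 0 x - k * hom (a z) (b z) x.
Proof.
case=> _ _ _ -> ->; rewrite -mulNr -homZ.
have -> : sol (mude + k * a z) (k * b z) x = sol (mude - (- k * a z)) (0 - (- k * b z)) x.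
  by congr (sol _ _ _); ring.
by rewrite sol_hom.
Qed.

Let self k1 s : 0 < s -> sol (M s - k1 * a s) (N s - k1 * b s) s = (n + p) * k1.
Proof. by move=> s0; rewrite (sol_right mom)// /moment_gap; ring. Qed.

(** At [de] the entry solution equals k (n + p - hom) <= 0, whereas h al <= k1 would keep it at or
    above (n + p) k1 to the left of al. *)
Lemma entry_h k1 z al : 0 < k1 -> is_entry k1 z al -> k1 < h al.
Proof.
move=> k10 E; rewrite ltNge; apply/negP => hal.
have [z0 zal dal _ _] := E.
have := sol_ge_left mom de0 (ltW dal) hal.
rewrite (entry_sol _ E) exit_sol_de.
have : k * (n + p) <= k * hom (a z) (b z) de by rewrite ler_pM2l// (hom_ge mom).
have : 0 < (n + p) * k1 by rewrite mulr_gt0.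
lra.
Qed.

(** The equation in M prescribes the coefficient that [entry_coef_decreasing] shows to be strictly
    monotone along the equation in N. *)
Lemma entry_unique k1 z al z' al' : 0 < k1 -> is_entry k1 z al -> is_entry k1 z' al' ->
  z = z' /\ al = al'.
Proof.
move=> k10.
wlog al12 : z al z' al' / al <= al' => [hw E E'|E E'].
  have [l|/ltW l] := leP al al'; first exact: hw.
  by have [-> ->] := hw _ _ _ _ l E' E.
have hal := entry_h k10 E.
case: (E) => z0 zal _ E1 E2; case: (E') => z0' zal' _ E1' E2'.
have -> : al = al'.
  apply/eqP; rewrite eq_le al12 leNgt; apply/negP => l.
  have := entry_coef_decreasing z0 zal z0' zal' l hal E2 E2'.
  by rewrite E1 E1'; lra.
split=> //; apply: (powR_neg_inj n0) => //; apply: (mulfI (lt0r_neq0 k0)).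
move: al12; rewrite le_eqVlt => /predU1P[alE|l]; first by rewrite -E2 -E2' alE.
have := entry_coef_decreasing z0 zal z0' zal' l hal E2 E2'.
by rewrite E1 E1'; lra.
Qed.

(** The equation in N gives z as a continuous function [ze] of the entry point; the one in M becomes
    B = - mude, solved by the intermediate value theorem. *)
Lemma entry_exists k1 x : 0 < k1 -> 0 < x -> h x < k -> exists z al, is_entry k1 z al.
Proof.
move=> k10 x0 hx.
(* At this point [ze w = w]; beyond it the constraint z < al holds. *)
have [w [w0 Nw]] : exists w, 0 < w /\ N w = (k + k1) * b w.
  by apply: (level_exists x0); lra.
have dw : de < w by apply: (level_mono de0 w0 Nde Nw); lra.
have [y [y0 hy]] := mom_infty mom (k + k1 + 1).
have Npos s : w <= s -> 0 < N s - k1 * b s.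
  move=> ws; have s0 := lt_le_trans w0 ws.
  have : (k + k1) * b s <= N s.
    move: ws; rewrite le_eqVlt => /predU1P[<-|ws]; first by rewrite Nw.
    by apply: ltW; exact: level_gt Nw.
  have : 0 < k * b s by rewrite mulr_gt0// powR_gt0.
  lra.
pose ze s := ((N s - k1 * b s) / k) `^ (- n^-1).
have ze0 s : w <= s -> 0 < ze s by move=> ws; rewrite powR_gt0// divr_gt0// Npos.
have bze s : w <= s -> k * b (ze s) = N s - k1 * b s.
  move=> ws; rewrite /ze -powRrM mulrNN mulVf ?gt_eqF// powRr1.
    by rewrite mulrC divfK// gt_eqF.
  by rewrite divr_ge0 ?(ltW k0)// ltW// Npos.
have zes s : w < s -> ze s < s.
  move=> ws; have s0 := lt_trans w0 ws; apply: (powR_lt_neg_inv n0) => //; first exact: ze0 (ltW ws).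
  rewrite -(ltr_pM2l k0) bze ?(ltW ws)//.
  have := level_gt w0 ws Nw; lra.
pose B s := k * a (ze s) - (M s - k1 * a s).
have cB s : w <= s -> {for s, continuous B}.
  move=> ws; have s0 := lt_le_trans w0 ws.
  have cb q : {for s, continuous (fun s : R => s `^ q)} by exact: powR_continuous.
  have cN := N_continuous mom s0; have cM := M_continuous mom s0.
  apply: (@continuousB _ R^o).
    apply: (@continuousM _ R^o); first exact: cvg_cst.
    have -> : (fun s => a (ze s)) = (fun u : R => a u) \o ((fun u => u `^ (- n^-1)) \o (fun s => (N s - k1 * b s) / k)) by [].
    apply: continuous_comp; last by apply: powR_continuous; exact: ze0.
    apply: continuous_comp; last by apply: powR_continuous; rewrite divr_gt0// Npos.
    apply: (@continuousM _ R^o); last exact: cvg_cst.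
    apply: (@continuousB _ R^o) => //.
    by apply: (@continuousM _ R^o); [exact: cvg_cst|exact: cb].
  apply: (@continuousB _ R^o) => //.
  by apply: (@continuousM _ R^o); [exact: cvg_cst|exact: cb].
pose v := - mude.
have Bw : v < B w.
  have zw : ze w = w.
    apply: (powR_neg_inj n0) => //; first exact: ze0.
    by apply: (mulfI (lt0r_neq0 k0)); rewrite bze// Nw; ring.
  rewrite /B zw /v /mude.
  (* As h < k + k1 before w, the gap of pivot [de] is nonpositive; its terms in N leave the surplus
     k1 de^p / n, which makes the bound on M w - M de strict. *)
  have gg := gap_le0_right mom de0 (lexx de) (ltW dw) (ltW (level_h w0 Nw)).
  have Yb := powR_pnE p n de0.
  have : gap (k + k1) de de w = (M w - M de - (k + k1) * (a w - a de)) / p + k1 * a de / n.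
    by rewrite /moment_gap Nw Nde Yb; ring.
  move=> E; rewrite E in gg.
  have h1 : 0 < k1 * a de / n by rewrite divr_gt0// mulr_gt0// powR_gt0.
  have h2 : 0 < k1 * a de by rewrite mulr_gt0// powR_gt0.
  have : (M w - M de - (k + k1) * (a w - a de)) / p < 0 by lra.
  by rewrite pmulr_llt0 ?invr_gt0//; lra.
pose big := Num.max w y.
(* Beyond y, h >= k + k1 + 1, hence B s <= - s^p + const; the point z below is where s^p outweighs
   the constant. *)
have t0 : 0 < (`|(k + k1 + 1) * a y - M y - v| + 1)^-1 by rewrite invr_gt0 ltr_wpDl.
have [z [z0 za]] := powR_neg_surj p0 t0.
have {}za : a z = `|(k + k1 + 1) * a y - M y - v| + 1.
  by rewrite -[LHS]invrK -powRN za invrK.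
pose s1 := Num.max big z.
have ws1 : w <= s1 by rewrite !le_max lexx.
have ys1 : y <= s1 by rewrite !le_max lexx orbT.
have zs1 : z <= s1 by rewrite !le_max lexx !orbT.
have s10 := lt_le_trans w0 ws1.
have Bs1 : B s1 <= v.
  have h1 : a (ze s1) <= a s1.
    apply: powR_le_pos => //; first exact: ze0.
    move: ws1; rewrite le_eqVlt => /predU1P[<-|l]; last exact: ltW (zes _ l).
    rewrite leNgt; apply/negP => l.
    have := powR_lt_neg n0 w0 l; rewrite -(ltr_pM2l k0) bze// Nw; lra.
  have h2 := M_lo mom y0 ys1.
  have h3 : (k + k1 + 1) * (a s1 - a y) <= h y * (a s1 - a y).
    by rewrite ler_wpM2r// ?subr_ge0 ?powR_le_pos// ltW.
  have h4 : a z <= a s1 by exact: powR_le_pos.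
  have h5 : k * a (ze s1) <= k * a s1 by rewrite ler_pM2l.
  have h6 := ler_norm ((k + k1 + 1) * a y - M y - v).
  rewrite /B; lra.
have [||al [wal _ E]] := @continuous_IVT R B w s1 v ws1.
- by move=> s ws _; exact: cB.
- by rewrite ge_min Bs1 orbT le_max (ltW Bw).
have {}wal : w < al.
  rewrite lt_neqAle wal andbT; apply: contraTneq Bw => ->.
  by rewrite E ltxx.
exists (ze al), al; split.
- exact: ze0 (ltW wal).
- exact: zes.
- exact: lt_trans dw wal.
- by move: E; rewrite /B /v; lra.
- by rewrite bze// ltW.
Qed.

End exit_value.
End exit_and_entry.

(** The pairs (boundary t, touching point x) with F <= 0 form a compact set, on which t attains its
    extremes. F will be a curve minus a level. *)
Lemma triangle_extremes (R : realType) (lo up : R) (F : R * R -> R) :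
  continuous F ->
  (exists t x, [/\ lo <= x, x <= t, t <= up & F (t, x) <= 0]) ->
  (exists t x, [/\ lo <= x, x <= t, t <= up, F (t, x) <= 0 &
     forall t' x', lo <= x' -> x' <= t' -> t' <= up -> F (t', x') <= 0 -> t <= t']) /\
  (exists t x, [/\ lo <= x, x <= t, t <= up, F (t, x) <= 0 &
     forall t' x', lo <= x' -> x' <= t' -> t' <= up -> F (t', x') <= 0 -> t' <= t]).
Proof.
move=> cF [t0 [x0 [lx0 xt0 tu0 F0]]].
pose S := ([set q : R * R | lo <= q.1 <= up /\ lo <= q.2 <= up]
  `&` ([set q | q.2 - q.1 <= 0] `&` [set q | F q <= 0])).
have cS : compact S.
  apply: compact_closedI.
    rewrite (_ : [set q | _] = `[lo, up]%classic `*` `[lo, up]%classic).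
      by apply: compact_setX; exact: segment_compact.
    by apply/seteqP; split => q /=; rewrite !in_itv.
  have clo (G : R * R -> R) : continuous G -> closed [set q | G q <= 0].
    by move=> cG; apply: (@preimage_closed _ _ G [set x | x <= 0]) => //; exact: closed_le.
  apply: closedI; last exact: clo.
  apply: clo => q; apply: (@continuousB _ R^o); [exact: cvg_snd|exact: cvg_fst].
have S0 : S !=set0.
  exists (t0, x0); split; split => //=; rewrite ?subr_le0//.
    by rewrite tu0 andbT (le_trans lx0).
  by rewrite lx0 (le_trans xt0).
have c1 : {within S, continuous (fst : R * R -> R)}.
  by apply: continuous_subspaceT => q; exact: cvg_fst.
have inS t' x' : lo <= x' -> x' <= t' -> t' <= up -> F (t', x') <= 0 -> (t', x') \in S.
  move=> lx xt tu Fx; rewrite inE; split; split => //=; rewrite ?subr_le0//.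
    by rewrite tu andbT (le_trans lx).
  by rewrite lx (le_trans xt).
split.
  have [[t x] + H] := compact_EVT_min S0 cS c1.
  rewrite inE => -[[/= /andP[_ h1] /andP[h2 _]] [/= h3 h4]]; rewrite subr_le0 in h3.
  by exists t, x; split => // t' x' *; apply: (H (t', x')); exact: inS.
have [[t x] + H] := compact_EVT_max S0 cS c1.
rewrite inE => -[[/= /andP[_ h1] /andP[h2 _]] [/= h3 h4]]; rewrite subr_le0 in h3.
by exists t, x; split => // t' x' *; apply: (H (t', x')); exact: inS.
Qed.

(** * The largest admissible entry cost *)

Section entry_cap.
Variables (R : realType) (p n : R) (h M N : R -> R).
Hypothesis mom : moments p n h M N.
Implicit Types (x y z t q C e k : R).

Notation a x := (x `^ p).
Notation b x := (x `^ (- n)).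
Notation Y x := (x `^ (n + p)).
Notation sol := (ode_sol p n M N).
Notation hom := (ode_hom p n).
Notation slope := (ode_slope p n M N).
Notation tilt := (ode_tilt n h N).

Let p0 : 0 < p := mom_p mom.
Let n0 : 0 < n := mom_n mom.
Let np0 : 0 < n + p. Proof. exact: addr_gt0. Qed.
Let hi : increasing_pos h := mom_incr mom.

Lemma sol_triangle_extremes (lo up c : R) (f g : R -> R) : 0 < lo ->
  (forall t, 0 < t -> {for t, continuous f}) -> (forall t, 0 < t -> {for t, continuous g}) ->
  (exists t x, [/\ lo <= x, x <= t, t <= up & sol (f t) (g t) x <= c]) ->
  (exists t x, [/\ lo <= x, x <= t, t <= up, sol (f t) (g t) x <= c &
     forall t' x', lo <= x' -> x' <= t' -> t' <= up -> sol (f t') (g t') x' <= c -> t <= t']) /\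
  (exists t x, [/\ lo <= x, x <= t, t <= up, sol (f t) (g t) x <= c &
     forall t' x', lo <= x' -> x' <= t' -> t' <= up -> sol (f t') (g t') x' <= c -> t' <= t]).
Proof.
move=> lo0 cf cg ex.
(* Clamping both arguments at lo > 0 makes F continuous on the whole plane. *)
pose F (q : R * R) := sol (f (Num.max lo q.1)) (g (Num.max lo q.1)) (Num.max lo q.2) - c.
have FE t x : lo <= x -> x <= t -> (F (t, x) <= 0) = (sol (f t) (g t) x <= c).
  move=> lx xt; rewrite /F /= (max_idPr lx) (max_idPr (le_trans lx xt)).
  by rewrite subr_le0.
have mlo t : 0 < Num.max lo t by rewrite lt_max lo0.
have cmax : continuous (fun t : R => Num.max lo t).
  by move=> t; apply: (@continuous_max _ _ (cst lo) id); [exact: cvg_cst|exact: cvg_id].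
have c1 (u : R -> R) : (forall t, 0 < t -> {for t, continuous u}) ->
    continuous (fun q : R * R => u (Num.max lo q.1)).
  move=> cu q; apply: (@continuous_comp _ _ _ (fst : R * R -> R) (fun t => u (Num.max lo t))).
    exact: cvg_fst.
  by apply: (@continuous_comp _ _ _ (fun t : R => Num.max lo t) u); [exact: cmax|exact: cu].
have c2 (u : R -> R) : (forall t, 0 < t -> {for t, continuous u}) ->
    continuous (fun q : R * R => u (Num.max lo q.2)).
  move=> cu q; apply: (@continuous_comp _ _ _ (snd : R * R -> R) (fun t => u (Num.max lo t))).
    exact: cvg_snd.
  by apply: (@continuous_comp _ _ _ (fun t : R => Num.max lo t) u); [exact: cmax|exact: cu].
have cF : continuous F.
  have -> : F = fun q : R * R => n * (M (Num.max lo q.2) - f (Num.max lo q.1)) * (fun s => s `^ (- p)) (Num.max lo q.2)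
     + p * (N (Num.max lo q.2) - g (Num.max lo q.1)) * (fun s => s `^ n) (Num.max lo q.2) - c.
    by apply/funext => q; rewrite /F /ode_sol !powRN invrK.
  have cM := c2 _ (@M_continuous _ _ _ _ _ _ mom); have cN := c2 _ (@N_continuous _ _ _ _ _ _ mom).
  have cp q' := c2 _ (@powR_continuous R q').
  have cf' := c1 _ cf; have cg' := c1 _ cg.
  move=> q; apply: (@cvgB _ R^o); last exact: cvg_cst.
  apply: (@cvgD _ R^o); (apply: cvgM; last exact: cp);
  (apply: cvgM; first exact: cvg_cst); apply: (@cvgB _ R^o).
  - exact: cM.
  - exact: cf'.
  - exact: cN.
  - exact: cg'.
have [|[t1 [x1 [h1 h2 h3 h4 H1]]] [t2 [x2 [g1 g2 g3 g4 H2]]]] := @triangle_extremes R lo up F cF.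
  by have [t [x [h1 h2 h3 h4]]] := ex; exists t, x; split => //; rewrite FE.
split.
- exists t1, x1; split=> //; first by rewrite -FE.
  by move=> t' x' lx xt tu; rewrite -FE//; exact: H1.
- exists t2, x2; split=> //; first by rewrite -FE.
  by move=> t' x' lx xt tu; rewrite -FE//; exact: H2.
Qed.

Lemma smooth_point mu nu C x : 0 < x -> slope mu nu x = 0 -> sol mu nu x = (n + p) * C ->
  mu = M x - C * a x /\ nu = N x - C * b x.
Proof.
move=> x0; rewrite /ode_slope /ode_sol => E1.
have b0 : b x != 0 by rewrite gt_eqF// powR_gt0.
have Y0 : Y x != 0 by rewrite gt_eqF// powR_gt0.
have E2 : M x - mu = Y x * (N x - nu) by lra.
rewrite E2 (powR_pnE p n x0) => E3.
have {}E3 : (n + p) * ((N x - nu) / b x) = (n + p) * C.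
  by rewrite -E3; field; rewrite Y0 b0.
have {}E3 := mulfI (lt0r_neq0 np0) E3.
have E4 : N x - nu = C * b x by rewrite -E3 divfK.
by split; [rewrite E4 in E2; lra|lra].
Qed.

Lemma slope_smooth C x : 0 < x -> slope (M x - C * a x) (N x - C * b x) x = 0.
Proof. by move=> x0; rewrite /ode_slope (powR_pnE p n x0); ring. Qed.

Lemma sol_smooth C x : 0 < x -> sol (M x - C * a x) (N x - C * b x) x = (n + p) * C.
Proof. by move=> x0; rewrite (sol_right mom)// /moment_gap; ring. Qed.

Lemma slope_pos_left mu nu x lo : 0 < lo -> lo < x -> 0 < slope mu nu x ->
  exists y, [/\ lo < y, y < x & sol mu nu y < sol mu nu x].
Proof.
move=> lo0 lx sx; have x0 := lt_trans lo0 lx.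
have D : 0 < n * p / (x * a x) * slope mu nu x.
  by rewrite mulr_gt0// divr_gt0 ?mulr_gt0 ?powR_gt0.
have H := deriv_gt0_left (is_derive_sol mom mu nu x0) D.
near x^'- => y; exists y; split; near: y => //.
- exact: nbhs_left_gt.
- exact: nbhs_left_lt.
Unshelve. all: end_near. Qed.

Lemma slope_neg_right mu nu x up : 0 < x -> x < up -> slope mu nu x < 0 ->
  exists y, [/\ x < y, y < up & sol mu nu y < sol mu nu x].
Proof.
move=> x0 xu sx.
have D : n * p / (x * a x) * slope mu nu x < 0.
  by rewrite pmulr_rlt0// divr_gt0 ?mulr_gt0 ?powR_gt0.
have H := deriv_lt0_right (is_derive_sol mom mu nu x0) D.
near x^'+ => y; exists y; split; near: y => //.
- exact: nbhs_right_gt.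
- exact: nbhs_right_lt.
Unshelve. all: end_near. Qed.

Lemma slope_interior_min mu nu lo x up : 0 < lo -> lo < x -> x < up ->
  (forall y, lo <= y -> y < up -> sol mu nu x <= sol mu nu y) -> slope mu nu x = 0.
Proof.
move=> lo0 lx xu H; apply/eqP; rewrite eq_le !leNgt; apply/andP; split; apply/negP => s.
  have [y [ly yx]] := slope_pos_left lo0 lx s.
  by rewrite ltNge H// ?ltW// (lt_trans yx).
have [y [xy yu]] := slope_neg_right (lt_trans lo0 lx) xu s.
by rewrite ltNge H// ltW// (lt_trans lx).
Qed.

Section cap.
Variables k de : R.
Hypotheses (k0 : 0 < k) (de0 : 0 < de) (Nde : N de = k * b de) (hde : h de < 0).

Let mude := M de - k * a de.
Notation is_entry := (is_entry p n M N k de).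

Let cap_slope0 : slope (M de) (N de) de = 0.
Proof. by have := slope_smooth 0 de0; rewrite !mul0r !subr0. Qed.

(** Right-continuity keeps h negative on a short interval after [de], where the solution leaving
    level 0 smoothly at [de] has to rise. *)
Let cap_slope_gt0 : exists y, de < y /\ forall s, de < s -> s <= y -> 0 < slope (M de) (N de) s.
Proof.
have [y [dy hy]] := mom_rcont mom de0 hde.
exists y; split => // s ds sy; have s0 := lt_trans de0 ds.
have hs : h s < 0 by apply: le_lt_trans hy; apply: hi.
have := slope_lo mom (M de) (N de) de0 (ltW ds); rewrite cap_slope0 subr0.
apply: lt_le_trans; rewrite mulr_gt0// ?subr_gt0 ?powR_lt_pos//.
have := N_hi mom de0 (ltW ds); rewrite /ode_tilt.
have : 0 < - h s * b de by rewrite mulr_gt0 ?powR_gt0// oppr_gt0.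
lra.
Qed.

(** For z = de the terms in k cancel: the solution leaving level 0 smoothly at [de] reaches k1
    smoothly at al. *)
Lemma cap_zero k1 al : is_entry k1 de al -> slope (M de) (N de) al = 0.
Proof.
case=> _ dal _; rewrite /mude => E1 E2; have al0 := lt_trans de0 dal.
have E3 : M al - M de = k1 * a al by lra.
have E4 : N al - N de = k1 * b al by rewrite Nde; lra.
by rewrite /ode_slope E3 E4 (powR_pnE p n al0); ring.
Qed.

Let cap_sol_increasing al : de < al -> slope (M de) (N de) al = 0 ->
  forall s, de < s -> s < al -> 0 < slope (M de) (N de) s.
Proof.
move=> dal Z s ds sal; have [y [dy Hy]] := cap_slope_gt0.
have [sy|ys] := leP s y; first exact: Hy.
apply: (slope_between_gt mom (lt_trans de0 dy) (ltW ys) sal); first exact: Hy.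
by rewrite Z.
Qed.

Lemma cap_exists : exists k1 al, 0 < k1 /\ is_entry k1 de al.
Proof.
have [y [dy Hy]] := cap_slope_gt0.
have [u [u0 hu]] := mom_infty mom 0.
have Nde0 : 0 < N de by rewrite Nde mulr_gt0// powR_gt0.
(* Where N x < N de and h x >= 0 the tilt is negative, so the concave slope has to come back to
   0. *)
have [x [xt Nx]] := mom_lim mom (Num.max y u) Nde0.
move: xt; rewrite gt_max => /andP[yx ux].
have x0 := lt_trans u0 ux.
have hx : 0 <= h x by apply: (le_trans (ltW hu)); apply: hi => //; exact: ltW.
have tx : tilt (N de) x < 0.
  rewrite /ode_tilt; have : 0 <= b x * h x by rewrite mulr_ge0 ?powR_ge0.
  lra.
pose phi := slope (M de) (N de).
(* Following the supergradient at x over the length q, in the variable x^(n+p), brings the slope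
   down to at most -1. *)
pose q := (`|phi x| + 1) / (- tilt (N de) x).
have q0 : 0 < q by apply: divr_gt0; rewrite ?oppr_gt0//; exact: ltr_wpDl.
have qt : q * tilt (N de) x = - (`|phi x| + 1).
  by rewrite /q; field; rewrite lt_eqF.
pose v := Y x + q.
have v0 : 0 < v by rewrite ltr_wpDl ?powR_ge0.
pose z := v `^ (n + p)^-1.
have z0 : 0 < z by exact: powR_gt0.
have Yz : Y z = v by rewrite /z -powRrM mulVf ?gt_eqF// powRr1// ltW.
have xz : x < z.
  rewrite ltNge; apply/negP => zx; have := powR_le_pos np0 z0 zx.
  by rewrite Yz /v; lra.
have phz : phi z <= 0.
  have := slope_hi mom (M de) (N de) x0 (ltW xz).
  rewrite -/phi Yz (_ : v - Y x = q); last by rewrite /v; ring.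
  by rewrite qt; have := ler_norm (phi x); lra.
have yz : y <= z by exact: ltW (lt_trans yx xz).
have y0 := lt_trans de0 dy.
have [||al [yal _ E]] := @continuous_IVT R phi y z 0 yz.
- by move=> s ys _; apply: (slope_continuous mom); exact: lt_le_trans ys.
- by rewrite ge_min phz orbT le_max (ltW (Hy y dy (lexx y))).
have dal := lt_le_trans dy yal; have al0 := lt_trans de0 dal.
(* The level is read off from the equation in N; the vanishing slope gives the one in M. *)
pose k1 := (N al - N de) / b al.
have E2 : N al - N de = k1 * b al by rewrite divfK// gt_eqF// powR_gt0.
have E1 : M al - M de = k1 * a al.
  by move: E; rewrite /phi /ode_slope E2 (powR_pnE p n al0); lra.
exists k1, al; split; last first.
  by split => //; [rewrite /mude; lra|rewrite -Nde; lra].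
have : sol (M de) (N de) de < sol (M de) (N de) al.
  by apply: (sol_increasing mom) => //; exact: cap_sol_increasing.
have -> : sol (M de) (N de) de = 0 by rewrite /ode_sol; ring.
have -> : sol (M de) (N de) al = (n + p) * k1.
  have -> : M de = M al - k1 * a al by lra.
  have -> : N de = N al - k1 * b al by lra.
  exact: sol_smooth.
by rewrite pmulr_rgt0.
Qed.

Let mude_cap x : sol (M de) (N de) x = sol mude 0 x - k * hom (a de) (b de) x.
Proof.
by rewrite /ode_sol /ode_hom /mude Nde; ring.
Qed.

Lemma entry_sol_exit k1 z al x : is_entry k1 z al ->
  sol (M al - k1 * a al) (N al - k1 * b al) x = sol mude 0 x - k * hom (a z) (b z) x.
Proof.
by case=> _ _ _ -> ->; rewrite /ode_sol /ode_hom /mude; ring.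
Qed.

(** Both curves are the exit solution minus k times a [hom], of parameter z for k1 and [de] for kc,
    and the larger parameter gives the higher curve to its right. At their entry points the curves
    take the values (n + p) k1 and (n + p) kc, and the higher curve is maximal at its own. *)
Lemma cap_compare k1 z al kc alc : 0 < k1 -> is_entry k1 z al -> is_entry kc de alc ->
  (k1 < kc) = (z < de).
Proof.
move=> k10 E Ec; have [z0 zal dal E1 E2] := E; have [_ dalc _ Ec1 Ec2] := Ec.
have al0 := lt_trans de0 dal; have alc0 := lt_trans de0 dalc.
have Uc : sol (M de) (N de) alc = (n + p) * kc.
  have -> : M de = M alc - kc * a alc by rewrite /mude in Ec1; lra.
  have -> : N de = N alc - kc * b alc by rewrite Nde; lra.
  exact: sol_smooth.
have Zc := cap_zero Ec.
have us := sol_smooth k1 al0; rewrite (entry_sol_exit _ E) in us.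
apply/idP/idP => [kk|zd]; last first.
- rewrite -(ltr_pM2l np0) -us -Uc.
  apply: (@lt_le_trans _ _ (sol (M de) (N de) al)).
    by rewrite mude_cap ltrD2l ltrN2 ltr_pM2l// (hom_lt mom)// ltW.
  have [aa|aa] := leP al alc.
    apply: (sol_nondecreasing mom) => // s als salc.
    by apply: ltW; apply: (cap_sol_increasing dalc Zc) => //; exact: lt_trans als.
  apply: (sol_nonincreasing mom) => //; first exact: ltW.
  move=> s alcs _; apply: (slope_after mom de0 dalc (ltW alcs)); by rewrite ?cap_slope0 ?Zc.
- rewrite ltNge; apply/negP => dz; move: kk; rewrite ltNge => /negP; apply.
  rewrite -(ler_pM2l np0).
  set mu := M al - k1 * a al; set nu := N al - k1 * b al.
  have usol x : sol mu nu x = sol mude 0 x - k * hom (a z) (b z) x by exact: entry_sol_exit.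
  have uslope : slope mu nu z = slope mude 0 z.
    by rewrite /ode_slope /mu /nu E1 E2 (powR_pnE p n z0) /mude; ring.
  have sz : 0 <= slope mu nu z.
    rewrite uslope; move: dz; rewrite le_eqVlt => /predU1P[<-|dz].
      by rewrite le_eqVlt; apply/orP; left; apply/eqP; rewrite /ode_slope /mude Nde (powR_pnE p n de0); ring.
    by apply: ltW; exact: (exit_slope_gt0 mom de0 Nde).
  have sal : slope mu nu al = 0 by exact: slope_smooth.
  have umax x : z <= x -> sol mu nu x <= (n + p) * k1.
    move=> zx; rewrite -(sol_smooth k1 al0) -/mu -/nu.
    have [xal|alx] := leP x al.
      apply: (sol_nondecreasing mom) => //; first exact: lt_le_trans zx.
      move=> s xs sal'; apply: (slope_between mom z0 _ (ltW sal')) => //; last by rewrite sal.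
      exact: le_trans (ltW xs).
    apply: (sol_nonincreasing mom) => //; first exact: ltW.
    by move=> s als _; apply: (slope_after mom z0 zal (ltW als)) => //; rewrite sal.
  have [zc|cz] := leP z alc.
    apply: le_trans (umax alc zc); rewrite -Uc mude_cap usol lerD2l lerN2 ler_pM2l//.
    move: dz; rewrite le_eqVlt => /predU1P[->//|dz].
    by apply: ltW; exact: (hom_lt mom).
  (* If alc < z the entry curve is taken at z instead, where its [hom] is minimal and the exit
     solution has grown. *)
  apply: le_trans (umax z (lexx z)); rewrite -Uc mude_cap usol (hom_self mom)//.
  apply: lerB.
    by apply: (exit_sol_le mom de0 Nde); exact: ltW.
  by rewrite ler_pM2l// (hom_ge mom).
Qed.

End cap.
End entry_cap.

(** * The free boundary system *)

Section switching.
Variables (R : realType) (p n : R) (h M N : R -> R).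
Hypothesis mom : moments p n h M N.
Implicit Types (x y z t C e k : R).

Notation a x := (x `^ p).
Notation b x := (x `^ (- n)).
Notation Y x := (x `^ (n + p)).
Notation gap := (moment_gap p n M N).
Notation gap1 := (power_gap p n).
Notation sol := (ode_sol p n M N).
Notation hom := (ode_hom p n).
Notation slope := (ode_slope p n M N).

Let p0 : 0 < p := mom_p mom.
Let n0 : 0 < n := mom_n mom.
Let np0 : 0 < n + p. Proof. exact: addr_gt0. Qed.
Let hi : increasing_pos h := mom_incr mom.

(* The blocks (C1 - h) 1_(x1,x2) and (C2 - h) 1_(y1,y2) have equal mass for s^(-n-1) ds and
   their difference changes sign once, from + to -, so the second has more mass for s^(p-1) ds. *)
Lemma block_comparison C1 C2 x1 x2 y1 y2 :
  0 < x1 -> x1 < x2 -> x1 < y1 -> y1 < y2 -> C2 < C1 -> h x2 < C1 -> h y2 < C2 ->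
  N x1 - C1 * b x1 - (N x2 - C1 * b x2) = N y1 - C2 * b y1 - (N y2 - C2 * b y2) ->
  x2 < y2 /\
  M y2 - C2 * a y2 - (M y1 - C2 * a y1) < M x2 - C1 * a x2 - (M x1 - C1 * a x1).
Proof.
move=> x10 x12 xy1 y12 CC hx2 hy2 EN.
have x20 := lt_trans x10 x12; have y10 := lt_trans x10 xy1; have y20 := lt_trans y10 y12.
have x2y2 : x2 < y2.
  rewrite ltNge; apply/negP => yx.
  have h1 := N_hi mom x10 (ltW xy1); have h2 := N_hi mom y20 yx.
  have hy1 : h y1 < C1.
    by apply: le_lt_trans hx2; apply: hi => //; exact: le_trans (ltW y12) yx.
  have g1 : h y1 * (b x1 - b y1) < C1 * (b x1 - b y1).
    by rewrite ltr_pM2r// subr_gt0 powR_lt_neg.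
  have g2 : h x2 * (b y2 - b x2) <= C1 * (b y2 - b x2).
    by rewrite ler_wpM2r ?(ltW hx2)// subr_ge0 powR_le_neg.
  have g3 : C2 * (b y1 - b y2) < C1 * (b y1 - b y2).
    by rewrite ltr_pM2r// subr_gt0 powR_lt_neg.
  lra.
split=> //.
(* Equal masses for s^(-n-1) cancel between gaps of a common pivot; x2, after which only the second
   block is left, is the pivot at which the signs separate. *)
have gE C u v : gap C x2 u v = (M v - C * a v - (M u - C * a u)) / p
    - Y x2 * (N u - C * b u - (N v - C * b v)) / n by rewrite /moment_gap; ring.
suff G : gap C2 x2 y1 y2 < gap C1 x2 x1 x2.
  by move: G; rewrite !gE EN ltrD2r ltr_pM2r// invr_gt0.
have G1 : 0 < gap C1 x2 x1 x2 by exact: (gap_gt0_left mom).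
have [xy|yx] := leP x2 y1.
  by apply: lt_trans G1; apply: (gap_lt0_right mom).
have hx2' : h x2 < C2 by apply: le_lt_trans hy2; apply: hi => //; exact: ltW.
rewrite (gapD p n M N C1 x2 x1 y1 x2) (gapD p n M N C2 x2 y1 x2 y2).
have k1 : gap C2 x2 x2 y2 < 0 by exact: (gap_lt0_right mom).
have k2 : 0 <= gap C1 x2 x1 y1.
  apply: (gap_ge0_left mom) => //; rewrite ?ltW//.
  by apply: le_lt_trans hx2; apply: hi => //; exact: ltW.
have k3 : gap C2 x2 y1 x2 <= gap C1 x2 y1 x2.
  rewrite (gapE _ _ _ _ C1 C2) lerDl.
  have : gap1 x2 y1 x2 < 0 by exact: (gap1_lt0 mom).
  by move=> g; apply: mulr_le0; lra.
lra.
Qed.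

Section thresholds.
Variables k k0 k1 : R.
Hypotheses (kp : 0 < k) (k0p : 0 < k0) (k1p : 0 < k1).

Let k0k : - k0 < k. Proof. by rewrite (lt_trans _ kp)// oppr_lt0. Qed.

(* The system of the theorem, with k = - r K, k0 = r K0 and k1 = r K1. *)
Definition smooth_fit z d g be al :=
  [/\ M be + k0 * a be = M al - k1 * a al, N be + k0 * b be = N al - k1 * b al,
      N be + k0 * b be = k * b z, M g + k0 * a g = M d - k * a d + k * a z
    & N g + k0 * b g = N d - k * b d + k * b z].

Notation is_system := smooth_fit.

(** Each sign comes from one equation: h be >= - k0 contradicts the equation in N between beta and
    alpha, and h al <= k1 the one in M, with the surplus k0 + k1 > 0; z < d follows from the last
    equation because h < - k0 up to beta. *)
Lemma system_facts z d g be al : is_system z d g be al -> ordered_points z d g be al ->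
  [/\ h be < - k0, k1 < h al & z < d].
Proof.
move=> [E1 E2 E3 E4 E5] [z0 zal [d0 dg gb ba]].
have g0 := lt_trans d0 dg; have be0 := lt_trans g0 gb; have al0 := lt_trans be0 ba.
have hb : h be < - k0.
  rewrite ltNge; apply/negP => hb.
  have := N_lo mom be0 (ltW ba).
  have : - k0 * (b be - b al) <= h be * (b be - b al).
    by rewrite ler_wpM2r// subr_ge0 powR_le_neg// ltW.
  have : 0 < (k0 + k1) * b al by rewrite mulr_gt0 ?addr_gt0 ?powR_gt0.
  lra.
have ha : k1 < h al.
  rewrite ltNge; apply/negP => ha.
  have := M_hi mom be0 (ltW ba).
  have : h al * (a al - a be) <= k1 * (a al - a be).
    by rewrite ler_wpM2r// subr_ge0 powR_le_pos// ltW.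
  have : 0 < (k0 + k1) * a be by rewrite mulr_gt0 ?addr_gt0 ?powR_gt0.
  lra.
split => //.
apply: (powR_lt_neg_inv n0) => //; rewrite -(ltr_pM2l kp).
have hg : h g < - k0 by apply: le_lt_trans hb; apply: hi => //; exact: ltW.
have := N_hi mom d0 (ltW dg).
have : h g * (b d - b g) < - k0 * (b d - b g) by rewrite ltr_pM2r// subr_gt0 powR_lt_neg.
have : 0 < k0 * b d by rewrite mulr_gt0 ?powR_gt0.
lra.
Qed.

Lemma sol_smooth_antitone C al al' x : 0 < x -> x <= al -> al < al' -> C < h al ->
  sol (M al' - C * a al') (N al' - C * b al') x < sol (M al - C * a al) (N al - C * b al) x.
Proof.
move=> x0 xal aa hC.
have -> : sol (M al' - C * a al') (N al' - C * b al') x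
  = sol (M al - C * a al) (N al - C * b al) x - n * p / a x * gap C x al al'.
  rewrite /ode_sol /moment_gap (powR_pnE p n x0); field.
  by rewrite !gt_eqF ?powR_gt0.
rewrite gtrDl oppr_lt0 mulr_gt0 ?divr_gt0 ?mulr_gt0 ?powR_gt0//.
exact: (gap_gt0_right mom).
Qed.

(* [(E1, E2)] is the smooth fit, at [be] and [al], of the two switching thresholds. *)
Lemma switch_sol_ge be al x : 0 < be -> be < al -> h be <= - k0 ->
  M be + k0 * a be = M al - k1 * a al -> N be + k0 * b be = N al - k1 * b al ->
  0 < x -> x <= al ->
  - ((n + p) * k0) <= sol (M al - k1 * a al) (N al - k1 * b al) x.
Proof.
move=> be0 ba hb E1 E2 x0 xal; have al0 := lt_trans be0 ba.
have E : forall y, sol (M al - k1 * a al) (N al - k1 * b al) y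
    = sol (M be - - k0 * a be) (N be - - k0 * b be) y.
  by move=> y; rewrite -E1 -E2; congr (sol _ _ _); ring.
have -> : - ((n + p) * k0) = (n + p) * - k0 by ring.
have [xb|bx] := leP x be; first by rewrite E; exact: (sol_ge_left mom).
rewrite -(sol_smooth mom (- k0) be0) -E.
apply: (sol_nondecreasing mom) => //; first exact: ltW.
move=> s bs sx; apply: (slope_between mom be0 (ltW bs) (le_trans (ltW sx) xal)).
  have -> : slope (M al - k1 * a al) (N al - k1 * b al) be
     = slope (M be - - k0 * a be) (N be - - k0 * b be) be.
    by rewrite -E1 -E2; congr (slope _ _ _); ring.
  by rewrite (slope_smooth p n M N).
by rewrite (slope_smooth p n M N).
Qed.

Lemma switch_sol_le be al x : 0 < be -> be < al ->
  M be + k0 * a be = M al - k1 * a al -> N be + k0 * b be = N al - k1 * b al ->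
  be <= x -> x <= al ->
  sol (M al - k1 * a al) (N al - k1 * b al) x <= (n + p) * k1.
Proof.
move=> be0 ba E1 E2 bx xal; have al0 := lt_trans be0 ba.
rewrite -(sol_smooth mom k1 al0).
apply: (sol_nondecreasing mom) => //; first exact: lt_le_trans bx.
move=> s xs sal; apply: (slope_between mom be0 (le_trans bx (ltW xs)) (ltW sal)).
  have -> : slope (M al - k1 * a al) (N al - k1 * b al) be
     = slope (M be - - k0 * a be) (N be - - k0 * b be) be.
    by rewrite -E1 -E2; congr (slope _ _ _); ring.
  by rewrite (slope_smooth p n M N).
by rewrite (slope_smooth p n M N).
Qed.

(** The unknowns are pinned down in the order alpha, beta, zeta, delta, gamma. For beta and gamma it
    suffices that N + k0 x^(-n) is strictly increasing where h < - k0. *)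
Lemma system_unique z d g be al z' d' g' be' al' :
  is_system z d g be al -> ordered_points z d g be al ->
  is_system z' d' g' be' al' -> ordered_points z' d' g' be' al' ->
  [/\ z' = z, d' = d, g' = g, be' = be & al' = al].
Proof.
move=> S O S' O'.
have [hb ha zd] := system_facts S O; have [hb' ha' zd'] := system_facts S' O'.
have [E1 E2 E3 E4 E5] := S; have [E1' E2' E3' E4' E5'] := S'.
have [z0 zal [d0 dg gb ba]] := O; have [z0' zal' [d0' dg' gb' ba']] := O'.
have g0 := lt_trans d0 dg; have be0 := lt_trans g0 gb; have al0 := lt_trans be0 ba.
have g0' := lt_trans d0' dg'; have be0' := lt_trans g0' gb'; have al0' := lt_trans be0' ba'.
(* The curve leaving k1 at the larger v' is strictly below the one leaving at v, hence below - k0 at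
   u; but it has its minimum - k0 at u'. *)
have noal u v u' v' : 0 < u -> u < v -> 0 < u' -> u' < v' -> h u' < - k0 -> k1 < h v ->
    M u + k0 * a u = M v - k1 * a v -> N u + k0 * b u = N v - k1 * b v ->
    M u' + k0 * a u' = M v' - k1 * a v' -> N u' + k0 * b u' = N v' - k1 * b v' ->
    ~ v < v'.
  move=> u0 uv u0' uv' hu' hv F1 F2 F1' F2' vv.
  have := switch_sol_ge u0' uv' (ltW hu') F1' F2' u0 (ltW (lt_trans uv vv)).
  have := sol_smooth_antitone u0 (ltW uv) vv hv.
  rewrite -F1 -F2.
  have -> : sol (M u + k0 * a u) (N u + k0 * b u) u = - ((n + p) * k0).
    rewrite -mulrN -(sol_smooth mom (- k0) u0); congr (sol _ _ _); ring.
  by move=> /lt_le_trans H /H; rewrite ltxx.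
have alE : al' = al.
  apply/eqP; rewrite eq_le !leNgt; apply/andP; split; apply/negP.
    exact: (noal be al be' al').
  exact: (noal be' al' be al).
have Ninj u v : 0 < u -> u < v -> h v < - k0 -> N u + k0 * b u < N v + k0 * b v.
  move=> u0 uv hv; have := N_hi mom u0 (ltW uv).
  have : h v * (b u - b v) < - k0 * (b u - b v) by rewrite ltr_pM2r// subr_gt0 powR_lt_neg.
  lra.
have beE : be' = be.
  rewrite alE in E2'.
  apply/eqP; rewrite eq_le !leNgt; apply/andP; split; apply/negP => l.
    by have := Ninj _ _ be0 l hb'; rewrite E2 E2' ltxx.
  by have := Ninj _ _ be0' l hb; rewrite E2 E2' ltxx.
have zE : z' = z.
  apply: (powR_neg_inj n0) => //; apply: (mulfI (lt0r_neq0 kp)).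
  by rewrite -E3 -E3' beE.
have hlt u : 0 < u -> u <= be -> h u < - k0.
  by move=> u0 ub; apply: le_lt_trans hb; exact: hi.
(* For a common z, the blocks k - h over ]u, u'[ and - k0 - h over ]v, v'[ have equal s^(-n-1) and
   equal s^(p-1) masses, which [block_comparison] rules out. *)
have nod u v u' v' : 0 < u -> u < v -> v < be -> 0 < u' -> u' < v' -> v' < be ->
    M v + k0 * a v = M u - k * a u + k * a z -> N v + k0 * b v = N u - k * b u + k * b z ->
    M v' + k0 * a v' = M u' - k * a u' + k * a z -> N v' + k0 * b v' = N u' - k * b u' + k * b z ->
    ~ u < u'.
  move=> u0 uv vb u0' uv' vb' F1 F2 F1' F2' uu.
  have v0 := lt_trans u0 uv; have v0' := lt_trans u0' uv'.
  have hu' : h u' < k by apply: lt_trans k0k; apply: hlt => //; exact: ltW (lt_trans uv' vb').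
  have vv : v < v'.
    have [//|vv] := ltP v v'.
    have : N v' + k0 * b v' <= N v + k0 * b v.
      move: vv; rewrite le_eqVlt => /predU1P[->//|vv].
      by apply: ltW; apply: Ninj => //; apply: hlt => //; exact: ltW.
    have := N_hi mom u0 (ltW uu).
    have : h u' * (b u - b u') < k * (b u - b u') by rewrite ltr_pM2r// subr_gt0 powR_lt_neg.
    lra.
  have hv' : h v' < - k0 by apply: hlt => //; exact: ltW.
  have EN : N u - k * b u - (N u' - k * b u') = N v - - k0 * b v - (N v' - - k0 * b v') by lra.
  have [_] := block_comparison u0 uu uv vv k0k hu' hv' EN.
  lra.
have dE : d' = d.
  rewrite zE in E4' E5'; rewrite beE in gb'.
  apply/eqP; rewrite eq_le !leNgt; apply/andP; split; apply/negP.
    exact: (nod d g d' g').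
  exact: (nod d' g' d g).
split => //; rewrite zE dE in E5'; rewrite beE in gb'.
apply/eqP; rewrite eq_le !leNgt; apply/andP; split; apply/negP => l.
  by have := Ninj _ _ g0 l (hlt _ g0' (ltW gb')); rewrite E5 E5' ltxx.
by have := Ninj _ _ g0' l (hlt _ g0 (ltW gb)); rewrite E5 E5' ltxx.
Qed.

Variable de : R.
Hypotheses (de0 : 0 < de) (Nde : N de = k * b de).
Let mude := M de - k * a de.
Notation is_entry := (is_entry p n M N k de).

Section entry_curve.
Variables z al : R.
Hypothesis E : is_entry k1 z al.
Let mu := M al - k1 * a al.
Let nu := N al - k1 * b al.

Let al0 : 0 < al. Proof. by case: E => _ _ dal _ _; exact: lt_trans dal. Qed.

Lemma entry_sol x : sol mu nu x = sol mude 0 x - k * hom (a z) (b z) x.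
Proof. exact: (@entry_sol_exit _ _ _ M N k de k1 z al x E). Qed.

Lemma entry_slope_de : z < de -> slope mu nu de < 0.
Proof.
case: E => z0 _ _ E1 E2 zd.
have -> : slope mu nu de = - (k * (Y de * b z - a z)).
  by rewrite /ode_slope /mu /nu E1 E2 Nde (powR_pnE p n de0); ring.
rewrite oppr_lt0 mulr_gt0// (powR_pnE p n z0) -mulrBl mulr_gt0 ?powR_gt0// subr_gt0.
exact: powR_lt_pos.
Qed.

Lemma entry_sol_de : z < de -> sol mu nu de < 0.
Proof.
case: (E) => z0 _ _ _ _ zd; rewrite entry_sol (exit_sol_de mom de0 Nde) mulrC -mulrBr.
rewrite pmulr_rlt0// subr_lt0; apply: (hom_gt mom) => //.
by rewrite gt_eqF.
Qed.

Let slope_pos : z < de -> exists y, [/\ de < y, y < al & 0 < slope mu nu y].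
Proof.
move=> zd; have [_ _ dal _ _] := E; apply: contrapT => H.
suff : sol mu nu al <= sol mu nu de.
  have := entry_sol_de zd; rewrite (sol_smooth mom)// => h1 h2.
  by have := le_lt_trans h2 h1; rewrite pmulr_rlt0// ltNge (ltW k1p).
apply: (sol_nonincreasing mom) => //; first exact: ltW.
move=> s ds sal; rewrite leNgt; apply/negP => ss; apply: H; by exists s.
Qed.

Let xhat_before x y : de < x -> x < al -> slope mu nu x = 0 -> y < al -> de < y -> 0 < slope mu nu y -> x < y.
Proof.
move=> dx xal sx yal dy sy; rewrite ltNge; apply/negP => yx.
have := slope_between_gt mom (lt_trans de0 dy) yx xal sy.
by rewrite sx ltxx (slope_smooth p n M N) ?lexx// => /(_ isT).
Qed.

(** The entry curve is negative with negative slope at [de] but positive at al, so its slope turns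
    positive in between. *)
Lemma xhat_exists : z < de -> exists x, [/\ de < x, x < al & slope mu nu x = 0].
Proof.
move=> zd; have [y [dy yal sy]] := slope_pos zd.
have sd := entry_slope_de zd.
have [||x [dx xy sx]] := @continuous_IVT R (slope mu nu) de y 0 (ltW dy).
- by move=> s ds _; apply: (slope_continuous mom); exact: lt_le_trans ds.
- by rewrite ge_min (ltW sd) le_max (ltW sy) orbT.
exists x; split=> //; last exact: le_lt_trans yal.
rewrite lt_neqAle dx andbT; apply: contraTneq sd => ->.
by rewrite sx ltxx.
Qed.

(** Concavity of the slope, which vanishes again at al: it is nonpositive before x and nonnegative
    from x to al. *)
Lemma xhat_min x y : z < de -> de < x -> x < al -> slope mu nu x = 0 ->
  de <= y -> y <= al -> sol mu nu x <= sol mu nu y.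
Proof.
move=> zd dx xal sx dy yal; have x0 := lt_trans de0 dx.
have [yx|xy] := leP y x.
  apply: (sol_nonincreasing mom) => //; first exact: lt_le_trans dy.
  move=> s ys sx'; rewrite leNgt; apply/negP => ss.
  have := xhat_before dx xal sx (lt_trans sx' xal) (le_lt_trans dy ys) ss.
  by rewrite ltNge (ltW sx').
apply: (sol_nondecreasing mom) => //; first exact: ltW.
move=> s xs sy; apply: (slope_between mom x0 (ltW xs) (le_trans (ltW sy) yal)).
  by rewrite sx.
by rewrite (slope_smooth p n M N).
Qed.

End entry_curve.
End thresholds.
End switching.

(** * Necessity of the dagger conditions *)

Section necessity.
Variables (R : realType) (p n : R) (h M N : R -> R).
Hypothesis mom : moments p n h M N.
Implicit Types (x y z t C e k : R).

Notation a x := (x `^ p).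
Notation b x := (x `^ (- n)).
Notation sol := (ode_sol p n M N).
Notation hom := (ode_hom p n).
Notation slope := (ode_slope p n M N).

Let p0 : 0 < p := mom_p mom.
Let n0 : 0 < n := mom_n mom.
Let np0 : 0 < n + p. Proof. exact: addr_gt0. Qed.
Let hi : increasing_pos h := mom_incr mom.

Variables k k0 k1 : R.
Hypotheses (kp : 0 < k) (k0p : 0 < k0) (k1p : 0 < k1).

Let k0k : - k0 < k. Proof. by rewrite (lt_trans _ kp)// oppr_lt0. Qed.

Variable de : R.
Hypotheses (de0 : 0 < de) (Nde : N de = k * b de).
Let mude := M de - k * a de.
Notation is_entry := (is_entry p n M N k de).
Notation is_system := (smooth_fit p n M N k k0 k1).

Variables z al : R.
Hypothesis E : is_entry k1 z al.
Let mu := M al - k1 * a al.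
Let nu := N al - k1 * b al.

Let al0 : 0 < al. Proof. by case: E => _ _ dal _ _; exact: lt_trans dal. Qed.

(** The key is al' < al: then the entry curve of [al] lies strictly below the switching curve of the
    system, which equals - (n + p) k0 at [be], and the minimum of the entry curve is lower still. *)
Lemma system_dagger z' d g be al' :
  is_system z' d g be al' -> ordered_points z' d g be al' ->
  [/\ h de < 0, z < de & forall x, de < x -> x < al -> slope mu nu x = 0 ->
      sol mu nu x < - ((n + p) * k0)].
Proof.
move=> S O; have [hb ha zd] := system_facts mom kp k0p k1p S O.
have [E1 E2 E3 E4 E5] := S; have [z0' zal' [d0 dg gb ba]] := O.
have g0 := lt_trans d0 dg; have be0 := lt_trans g0 gb; have al0' := lt_trans be0 ba.
have [z0 zal dal F1 F2] := E.
have hal := entry_h mom kp de0 Nde k1p E.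
have hg : h g < - k0 by apply: le_lt_trans hb; apply: hi => //; exact: ltW.
have dde : d < de.
  have [//|ded] := ltP d de.
  have : k * b d <= N d.
    move: ded; rewrite le_eqVlt => /predU1P[<-|ded]; first by rewrite Nde.
    by apply: ltW; exact: (level_gt mom de0 ded Nde).
  have := N_hi mom g0 (ltW gb).
  have : h be * (b g - b be) < - k0 * (b g - b be) by rewrite ltr_pM2r// subr_gt0 powR_lt_neg.
  lra.
(* The blocks k - h over ]d, de[ and - k0 - h over ]g, be[ have the same s^(-n-1) mass. *)
have EN : N d - k * b d - (N de - k * b de) = N g - - k0 * b g - (N be - - k0 * b be).
  by have := Nde; lra.
have [deb Mlt] := block_comparison mom d0 dde dg gb k0k (level_h mom de0 Nde) hb EN.
have hde : h de < 0.
  apply: (@le_lt_trans _ _ (h be)); first by apply: hi => //; exact: ltW.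
  by have := k0p; lra.
(* [mude] is the value of this expression for the pair (z, al), and by [entry_coef_decreasing] the
   expression increases with the entry point; hence al' < al below. *)
have coef : M al' - k1 * a al' - k * a z' < mude by rewrite /mude; lra.
have NA : N al' - k1 * b al' = k * b z' by lra.
have decr := entry_coef_decreasing mom kp.
have aa : al' < al.
  rewrite ltNge; apply/negP; rewrite le_eqVlt => /predU1P[aE|aa].
    have zE : z = z'.
      apply: (powR_neg_inj n0) => //; apply: (mulfI (lt0r_neq0 kp)).
      by rewrite -F2 -NA aE.
    by move: coef F1; rewrite -aE zE /mude; lra.
  by have := decr k1 z z' al al' z0 zal z0' zal' aa hal F2 NA; rewrite F1 -/mude; lra.
have u1 x : 0 < x -> x <= al' -> sol mu nu x < sol (M al' - k1 * a al') (N al' - k1 * b al') x.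
  by move=> x0 xal; exact: (sol_smooth_antitone mom).
have ualbe : sol (M al' - k1 * a al') (N al' - k1 * b al') be = - ((n + p) * k0).
  rewrite -E1 -E2 -mulrN -(sol_smooth mom (- k0) be0).
  by congr (sol _ _ _); ring.
have ube : sol mu nu be < - ((n + p) * k0) by rewrite -ualbe u1// ltW.
have k0np : 0 < (n + p) * k0 by rewrite mulr_gt0.
have exit_ge x : de <= x -> (n + p) * k <= sol mude 0 x.
  by move=> dx; rewrite -(exit_sol_de mom de0 Nde); exact: (exit_sol_le mom de0 Nde).
(* If be <= z, some entry point [al1] in ]al', al] is paired with [be] by the equation in N. Its
   curve at [be] is at least the exit solution minus k (n + p), so nonnegative, and yet below the
   switching curve, which is negative there. *)
have zbe : z < be.
  rewrite ltNge; apply/negP => bz.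
  have z'be : z' < be := lt_trans zd (lt_trans dg gb).
  have [||al1 [al1l al1u NE]] := @continuous_IVT R (fun s => N s - k1 * b s) al' al (k * b be) (ltW aa).
  - move=> s als _; have s0 := lt_le_trans al0' als.
    apply: (@continuousB _ R^o); first exact: N_continuous mom _ s0.
    by apply: (@continuousM _ R^o); [exact: cvg_cst|exact: powR_continuous].
  - rewrite NA F2 ge_min le_max !ler_pM2l//; apply/andP; split; apply/orP; [right|left].
      exact: powR_le_neg.
    by apply: powR_le_neg => //; exact: ltW.
  have l1 : al' < al1.
    rewrite lt_neqAle al1l andbT; apply/eqP => aE.
    have : k * b be < k * b z' by rewrite ltr_pM2l// powR_lt_neg.
    by rewrite -NA -NE aE ltxx.
  have al10 := lt_trans al0' l1.
  have hal1 : k1 < h al1 by apply: (lt_le_trans ha); apply: hi.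
  have c1 : M al1 - k1 * a al1 - k * a be <= mude.
    move: al1u; rewrite le_eqVlt => /predU1P[aE|al1u].
      have zE : be = z.
        apply: (powR_neg_inj n0) => //; apply: (mulfI (lt0r_neq0 kp)).
        by rewrite -F2 -NE aE.
      by rewrite aE zE F1 -/mude; lra.
    have bal1 : be < al1 := lt_trans ba l1.
    by have := decr k1 be z al1 al be0 bal1 z0 zal al1u hal1 NE F2; rewrite F1 -/mude; lra.
  have := sol_smooth_antitone mom be0 (ltW ba) l1 ha; rewrite ualbe.
  have -> : sol (M al1 - k1 * a al1) (N al1 - k1 * b al1) be
      = sol (M al1 - k1 * a al1 - k * a be) 0 be - k * hom (a be) (b be) be.
    by rewrite NE /ode_sol /ode_hom; ring.
  have : sol mude 0 be <= sol (M al1 - k1 * a al1 - k * a be) 0 be.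
    rewrite /ode_sol lerD2r ler_pM2r ?invr_gt0 ?powR_gt0// ler_pM2l//; lra.
  rewrite (hom_self mom)//; have := exit_ge be (ltW deb); lra.
(* If de <= z, the entry curve is nonnegative with nonnegative slope at z and does not decrease up
   to al, against its negative value at [be]. *)
have zde : z < de.
  rewrite ltNge; apply/negP => dez.
  have sz : 0 <= slope mu nu z.
    have -> : slope mu nu z = slope mude 0 z.
      by rewrite /ode_slope /mu /nu F1 F2 (powR_pnE p n z0) /mude; ring.
    move: dez; rewrite le_eqVlt => /predU1P[<-|dez].
      by rewrite le_eqVlt; apply/orP; left; apply/eqP; rewrite /ode_slope /mude Nde (powR_pnE p n de0); ring.
    by apply: ltW; exact: (exit_slope_gt0 mom de0 Nde).
  have : sol mu nu z <= sol mu nu be.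
    apply: (sol_nondecreasing mom) => //; first exact: ltW.
    move=> s zs sb; have sal : s <= al by exact: ltW (lt_trans sb (lt_trans ba aa)).
    apply: (slope_between mom z0 (ltW zs) sal sz).
    by rewrite (slope_smooth p n M N).
  rewrite (entry_sol E) (hom_self mom)//; have := exit_ge z dez; lra.
split=> // x dx xal sx.
apply: le_lt_trans ube; apply: (xhat_min mom de0 E) => //; first exact: ltW.
exact: ltW (lt_trans ba aa).
Qed.

End necessity.

(** * First touching and existence *)

Section first_touch.
Variables (R : realType) (p n : R) (h M N : R -> R).
Hypothesis mom : moments p n h M N.
Implicit Types (x y z t C e k : R).

Notation a x := (x `^ p).
Notation b x := (x `^ (- n)).
Notation sol := (ode_sol p n M N).

Lemma sol_param_continuous (f g : R -> R) (x t : R) :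
  {for t, continuous f} -> {for t, continuous g} ->
  {for t, continuous (fun t => sol (f t) (g t) x)}.
Proof.
move=> cu cv; apply: (@continuousD _ R^o); (apply: (@continuousM _ R^o); last exact: cvg_cst);
(apply: (@continuousM _ R^o); first exact: cvg_cst); apply: (@continuousB _ R^o) => //; exact: cvg_cst.
Qed.

Lemma shifted_moments_continuous C D D' t : 0 < t ->
  {for t, continuous (fun t => M t - C * a t - D)} /\ {for t, continuous (fun t => N t - C * b t - D')}.
Proof.
move=> t0; split; (apply: (@continuousB _ R^o); last exact: cvg_cst);
  apply: (@continuousB _ R^o); [exact: M_continuous mom _ t0| |exact: N_continuous mom _ t0|];
  by apply: (@continuousM _ R^o); [exact: cvg_cst|exact: powR_continuous].
Qed.

(** Were the curve below c at some y < t, so would be, by continuity, the curves of slightly smaller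
    parameter, against minimality. *)
Lemma sol_touch_min (lo up c : R) (f g : R -> R) : 0 < lo ->
  (forall t, 0 < t -> {for t, continuous f}) -> (forall t, 0 < t -> {for t, continuous g}) ->
  (exists t x, [/\ lo <= x, x <= t, t <= up & sol (f t) (g t) x <= c]) ->
  exists t x, [/\ lo <= x, x <= t, t <= up, sol (f t) (g t) x <= c &
     forall y, lo <= y -> y < t -> c <= sol (f t) (g t) y].
Proof.
move=> lo0 cf cg ex.
have [[t [x [lx xt tu ux Hmin]]] _] := sol_triangle_extremes mom lo0 cf cg ex.
exists t, x; split=> // y ly yt; rewrite leNgt; apply/negP => uy.
have t0 : 0 < t by rewrite (lt_le_trans lo0)// (le_trans lx).
have ct := sol_param_continuous (x := y) (cf t t0) (cg t t0).
have : \forall s \near t^'-, [/\ y < s, s < t & sol (f s) (g s) y < c].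
  have cl := cvgr_lt _ (cvg_at_left_filter ct) _ uy.
  near=> s; split; [near: s; exact: nbhs_left_gt|near: s; exact: nbhs_left_lt|by near: s; exact: cl].
move=> /filter_ex[s [ys st us]].
have := Hmin s y ly (ltW ys) (ltW (lt_le_trans st tu)) (ltW us).
by rewrite leNgt st.
Unshelve. all: by end_near. Qed.

(** As for [sol_touch_min], now moving t upwards, which needs t < up. *)
Lemma sol_touch_max (lo up c : R) (f g : R -> R) : 0 < lo ->
  (forall t, 0 < t -> {for t, continuous f}) -> (forall t, 0 < t -> {for t, continuous g}) ->
  (exists t x, [/\ lo <= x, x <= t, t <= up & sol (f t) (g t) x <= c]) ->
  exists t x, [/\ lo <= x, x <= t, t <= up, sol (f t) (g t) x <= c &
     t < up -> forall y, lo <= y -> y <= t -> c <= sol (f t) (g t) y].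
Proof.
move=> lo0 cf cg ex.
have [_ [t [x [lx xt tu ux Hmax]]]] := sol_triangle_extremes mom lo0 cf cg ex.
exists t, x; split=> // tup y ly yt; rewrite leNgt; apply/negP => uy.
have t0 : 0 < t by rewrite (lt_le_trans lo0)// (le_trans lx).
have ct := sol_param_continuous (x := y) (cf t t0) (cg t t0).
have : \forall s \near t^'+, [/\ t < s, s < up & sol (f s) (g s) y < c].
  have cl := cvgr_lt _ (cvg_at_right_filter ct) _ uy.
  near=> s; split; [near: s; exact: nbhs_right_gt|near: s; exact: nbhs_right_lt|by near: s; exact: cl].
move=> /filter_ex[s [ts st us]].
have := Hmax s y ly (le_trans yt (ltW ts)) (ltW st) (ltW us).
by rewrite leNgt ts.
Unshelve. all: by end_near. Qed.

End first_touch.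

Section sufficiency.
Variables (R : realType) (p n : R) (h M N : R -> R).
Hypothesis mom : moments p n h M N.
Implicit Types (x y z t C e : R).

Notation a x := (x `^ p).
Notation b x := (x `^ (- n)).
Notation Y x := (x `^ (n + p)).
Notation sol := (ode_sol p n M N).
Notation hom := (ode_hom p n).
Notation slope := (ode_slope p n M N).

Let p0 : 0 < p := mom_p mom.
Let n0 : 0 < n := mom_n mom.
Let np0 : 0 < n + p. Proof. exact: addr_gt0. Qed.
Let hi : increasing_pos h := mom_incr mom.

Variables k k0 k1 : R.
Hypotheses (kp : 0 < k) (k0p : 0 < k0) (k1p : 0 < k1).

Variable de : R.
Hypotheses (de0 : 0 < de) (Nde : N de = k * b de).
Let mude := M de - k * a de.
Notation is_entry := (is_entry p n M N k de).
Notation is_system := (smooth_fit p n M N k k0 k1).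

Lemma exit_sol_ge x : 0 < x -> (n + p) * k <= sol mude 0 x.
Proof.
move=> x0; have [dx|/ltW xd] := leP de x.
  by rewrite -(exit_sol_de mom de0 Nde); exact: (exit_sol_le mom de0 Nde).
have -> : sol mude 0 x = sol (M de - k * a de) (N de - k * b de) x by rewrite Nde subrr.
by apply: (sol_ge_left mom) => //; exact: ltW (level_h mom de0 Nde).
Qed.

Lemma switch_h be al : 0 < be -> be < al ->
  N be + k0 * b be = N al - k1 * b al -> h be < - k0.
Proof.
move=> be0 ba E2; rewrite ltNge; apply/negP => hb.
have := N_lo mom be0 (ltW ba).
have : - k0 * (b be - b al) <= h be * (b be - b al).
  by rewrite ler_wpM2r// subr_ge0 powR_le_neg// ltW.
have : 0 < (k0 + k1) * b al by rewrite mulr_gt0 ?addr_gt0 ?powR_gt0// (lt_trans be0).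
lra.
Qed.

Lemma entry_touch z al : is_entry k1 z al -> z < de ->
  (exists x, [/\ de < x, x < al &
     sol (M al - k1 * a al) (N al - k1 * b al) x < - ((n + p) * k0)]) ->
  exists be al', [/\ de < be, be < al', al' < al & k1 < h al'] /\
    (M be + k0 * a be = M al' - k1 * a al' /\ N be + k0 * b be = N al' - k1 * b al').
Proof.
move=> E zde [xh [dxh xhal uxh]]; have [z0 zal dal F1 F2] := E.
have k1np : 0 < (n + p) * k1 by rewrite mulr_gt0.
have k0np : 0 < (n + p) * k0 by rewrite mulr_gt0.
have [//| | | |al' [be []]] := @sol_touch_min _ _ _ _ _ _ mom de al (- ((n + p) * k0))
  (fun t => M t - k1 * a t - 0) (fun t => N t - k1 * b t - 0).
- by move=> t t0; exact: (shifted_moments_continuous mom k1 0 0 t0).1.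
- by move=> t t0; exact: (shifted_moments_continuous mom k1 0 0 t0).2.
- exists al, xh; rewrite !subr0; split; [exact: ltW|exact: ltW|by []|exact: ltW].
rewrite !subr0; set mu := M al' - _; set nu := N al' - _.
move=> dbe bal' al'al ule ge.
have be0 := lt_le_trans de0 dbe; have al'0 := lt_le_trans be0 bal'.
have {}bal' : be < al'.
  rewrite lt_neqAle bal' andbT; apply/eqP => ba; move: ule.
  by rewrite ba (sol_smooth mom)//; lra.
have uE : sol mu nu be = - ((n + p) * k0) by apply/eqP; rewrite eq_le ule ge.
have {}al'al : al' < al.
  rewrite lt_neqAle al'al andbT; apply/eqP => aa.
  by have := ge xh (ltW dxh); rewrite /mu /nu aa leNgt uxh => /(_ xhal).
have hal' : k1 < h al'.
  rewrite ltNge; apply/negP => hk.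
  have := sol_ge_left mom be0 (ltW bal') hk.
  rewrite -/mu -/nu uE; lra.
(* At [de] the slope is negative for the parameter [al], and lowering the parameter to al' lowers
   it; a touching at [de] would be followed by a dip below - k0. *)
have {}dbe : de < be.
  rewrite lt_neqAle dbe andbT; apply/eqP => db.
  have sl : slope mu nu de < 0.
    apply: le_lt_trans (entry_slope_de mom kp de0 Nde E zde).
    rewrite /ode_slope /mu /nu.
    have e1 := M_lo mom al'0 (ltW al'al); have e2 := N_lo mom al'0 (ltW al'al).
    have e3 : k1 * (a al - a al') <= h al' * (a al - a al').
      by apply: ler_wpM2r; [rewrite subr_ge0 powR_le_pos// ltW|exact: ltW].
    have e4 : k1 * (b al' - b al) <= h al' * (b al' - b al).
      by apply: ler_wpM2r; [rewrite subr_ge0 powR_le_neg// ltW|exact: ltW].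
    have e5 : Y de * (N al - k1 * b al) <= Y de * (N al' - k1 * b al').
      by rewrite ler_pM2l ?powR_gt0//; lra.
    lra.
  have deal' : de < al' by rewrite db.
  have [y [dy yal uy]] := slope_neg_right mom de0 deal' sl.
  by have := ge y (ltW dy) yal; rewrite -uE -db leNgt uy.
have s0 : slope mu nu be = 0.
  apply: (slope_interior_min mom de0 dbe bal') => y dy yal.
  by rewrite uE; exact: ge.
have [|e1 e2] := smooth_point (C := - k0) mom be0 s0; first by rewrite uE mulrN.
exists be, al'; split=> //; rewrite -/mu -/nu e1 e2; split; ring.
Qed.

Lemma exit_touch z be al : 0 < be -> be < al -> 0 < z -> z < be ->
  M be + k0 * a be = M al - k1 * a al -> N be + k0 * b be = N al - k1 * b al ->
  N be + k0 * b be = k * b z -> M be + k0 * a be - k * a z < mude ->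
  exists d g, [/\ z < d, d < g & g < be] /\
    (M g + k0 * a g = M d - k * a d + k * a z /\ N g + k0 * b g = N d - k * b d + k * b z).
Proof.
move=> be0 ba z0 zbe E1 E2 E3 lt.
have hb := switch_h be0 ba E2.
have k0np : 0 < (n + p) * k0 by rewrite mulr_gt0.
have knp : 0 < (n + p) * k by rewrite mulr_gt0.
have val t x : sol (M t - - k0 * a t - k * a z) (N t - - k0 * b t - k * b z) x
   = sol (M t - - k0 * a t) (N t - - k0 * b t) x + k * hom (a z) (b z) x.
  by rewrite sol_hom homZ.
have [//| | | |g [d []]] := @sol_touch_max _ _ _ _ _ _ mom z be ((n + p) * k)
  (fun t => M t - - k0 * a t - k * a z) (fun t => N t - - k0 * b t - k * b z).
- by move=> t t0; exact: (shifted_moments_continuous mom (- k0) (k * a z) 0 t0).1.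
- by move=> t t0; exact: (shifted_moments_continuous mom (- k0) 0 (k * b z) t0).2.
(* The curve that leaves at z itself has the value (n + p) (k - k0) there, below the level. *)
- exists z, z; split=> //; first exact: ltW.
  by rewrite val (sol_smooth mom)// (hom_self mom)//; lra.
move=> zd dg gb ule ge.
have d0 := lt_le_trans z0 zd; have g0 := lt_le_trans d0 dg.
(* For the parameter [be] the curve has nu = 0 and a smaller mu than the exit solution, so it lies
   strictly above the latter and never comes down to k. *)
have {}gb : g < be.
  rewrite lt_neqAle gb andbT; apply/eqP => gbe; move: ule; rewrite leNgt => /negP; apply.
  apply: (le_lt_trans (exit_sol_ge d0)).
  have -> : N g - - k0 * b g - k * b z = 0 by rewrite gbe -E3; ring.
  rewrite /ode_sol ltrD2r ltr_pM2r ?invr_gt0 ?powR_gt0// ltr_pM2l//.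
  by rewrite gbe; lra.
have {}ge := ge gb.
have zg := le_trans zd dg.
have uE : sol (M g - - k0 * a g - k * a z) (N g - - k0 * b g - k * b z) d = (n + p) * k.
  by apply/eqP; rewrite eq_le ule ge.
have {}zg : z < g.
  rewrite lt_neqAle zg andbT; apply/eqP => zgE.
  have := ge z (lexx z) zg; rewrite -zgE val (sol_smooth mom)// (hom_self mom)//; lra.
have hg : h g < - k0 by apply: le_lt_trans hb; apply: hi => //; exact: ltW.
(* At z [hom] is flat, and h < - k0 up to g makes the other part decrease there. *)
have {}zd : z < d.
  rewrite lt_neqAle zd andbT; apply/eqP => zdE.
  have sl : slope (M g - - k0 * a g - k * a z) (N g - - k0 * b g - k * b z) z < 0.
    rewrite /ode_slope.
    have e1 := M_hi mom z0 (ltW zg); have e2 := N_hi mom z0 (ltW zg).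
    have e3 : h g * (a g - a z) < - k0 * (a g - a z) by rewrite ltr_pM2r// subr_gt0 powR_lt_pos.
    have e4 : h g * (b z - b g) < - k0 * (b z - b g) by rewrite ltr_pM2r// subr_gt0 powR_lt_neg.
    have e5 : Y z * (N z - N g - k0 * b g) < Y z * (- k0 * b z).
      by rewrite ltr_pM2l ?powR_gt0//; lra.
    have e6 c : c * a z = c * (Y z * b z) by rewrite (powR_pnE p n z0).
    have := e6 k; have := e6 k0; lra.
  have [y [zy yg uy]] := slope_neg_right mom z0 zg sl.
  by have := ge y (ltW zy) (ltW yg); rewrite -uE -zdE leNgt uy.
(* At g only the homogeneous part has a slope, and it is positive since z < g. *)
have {}dg : d < g.
  rewrite lt_neqAle dg andbT; apply/eqP => dgE.
  have sl : 0 < slope (M g - - k0 * a g - k * a z) (N g - - k0 * b g - k * b z) g.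
    have -> : slope (M g - - k0 * a g - k * a z) (N g - - k0 * b g - k * b z) g
      = k * ((Y g - Y z) * b z).
      by rewrite /ode_slope (powR_pnE p n g0) (powR_pnE p n z0); ring.
    by rewrite !mulr_gt0 ?powR_gt0// subr_gt0 powR_lt_pos.
  have [y [zy yg uy]] := slope_pos_left mom z0 zg sl.
  by have := ge y (ltW zy) (ltW yg); rewrite -uE dgE leNgt uy.
have s0 : slope (M g - - k0 * a g - k * a z) (N g - - k0 * b g - k * b z) d = 0.
  apply: (slope_interior_min mom z0 zd dg) => y zy yg.
  by rewrite uE; apply: ge => //; exact: ltW.
have [e1 e2] := smooth_point mom d0 s0 uE.
exists d, g; split=> //; rewrite -e1 -e2; split; ring.
Qed.

(** Given beta and al', zeta is read off from the equation in N at al'. Then al' < al and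
    [entry_coef_decreasing] yield the strict inequality on the coefficient of x^m that [exit_touch]
    requires. *)
Lemma dagger_system z al : is_entry k1 z al -> z < de ->
  (exists x, [/\ de < x, x < al &
     sol (M al - k1 * a al) (N al - k1 * b al) x < - ((n + p) * k0)]) ->
  exists z' d g be al', is_system z' d g be al' /\ ordered_points z' d g be al'.
Proof.
move=> E zde ux; have [be [al' [[dbe bal al'al hal] [E1 E2]]]] := entry_touch E zde ux.
have [z0 zal dal F1 F2] := E.
have be0 := lt_trans de0 dbe; have al'0 := lt_trans be0 bal.
have NN : k * b z < N al' - k1 * b al'.
  have e2 := N_lo mom al'0 (ltW al'al).
  have e4 : k1 * (b al' - b al) < h al' * (b al' - b al).
    by rewrite ltr_pM2r// subr_gt0 powR_lt_neg.
  lra.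
have bz0 : 0 < k * b z by rewrite mulr_gt0 ?powR_gt0.
have [|z' [z'0 bz']] := @powR_neg_surj R n ((N al' - k1 * b al') / k) n0.
  by rewrite divr_gt0// (lt_trans bz0).
have {}bz' : N al' - k1 * b al' = k * b z' by rewrite bz' mulrCA divff ?mulr1// gt_eqF.
have z'z : z' < z.
  by apply: (powR_lt_neg_inv n0) => //; rewrite -(ltr_pM2l kp) -bz'.
have z'be : z' < be := lt_trans z'z (lt_trans zde dbe).
have := entry_coef_decreasing mom kp z'0 (lt_trans z'be bal) z0 zal al'al hal bz' F2.
rewrite F1 => lt.
have [|d [g [[zd dg gb] [E4 E5]]]] := exit_touch be0 bal z'0 z'be E1 E2 (etrans E2 bz').
  by rewrite E1 /mude; lra.
exists z', d, g, be, al'; split; first by split=> //; rewrite E2.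
by split=> //; [exact: lt_trans bal|split=> //; exact: lt_trans zd].
Qed.

End sufficiency.

(** * Verification of the HJB equation *)

Section monotone_ae.
Variable R : realType.
Implicit Types (h : R -> R) (x y : R).
Notation mu := (@lebesgue_measure R).

Lemma ae_neq (c : R) : {ae mu, forall x, x != c}.
Proof.
exists [set c]; split; [exact: measurable_set1| |].
  by apply: countable_lebesgue_measure0; exact: countable1.
by move=> x /= /negP; rewrite negbK => /eqP.
Qed.

Let continuous_or_discontinuous h x : increasing_pos h -> 0 < x ->
  h y @[y --> x^'+] --> h x -> ~ {for x, continuous h} -> discontinuity h x.
Proof.
move=> hi x0 hr nc.
have cl : cvg (h y @[y --> x^'-]).
  apply: nondecreasing_at_left_is_cvgr; near=> y.
    move=> s t; rewrite !inE/= => /andP[ys _] _ st; apply: hi => //.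
    by apply: lt_trans ys; near: y; exact: nbhs_left_gt.
  exists (h x) => v [s]; rewrite /= in_itv/= => /andP[ys sx] <-.
  apply: hi; last exact: ltW.
  by apply: lt_trans ys; near: y; exact: nbhs_left_gt.
split=> //; first by apply/cvg_ex; exists (h x).
apply/eqP => E; apply: nc; apply/left_right_continuousP; split=> //.
by rewrite -(cvg_lim _ hr)// -E.
Unshelve. all: by end_near. Qed.

Lemma monotone_ae_continuous h : increasing_pos h ->
  (forall x, 0 < x -> h y @[y --> x^'+] --> h x) ->
  {ae mu, forall x, 0 < x -> {for x, continuous h}}.
Proof.
move=> hi hr.
(* Monotonicity gives countably many discontinuities on each interval away from 0, and these
   intervals exhaust (0, oo). *)
pose D := \bigcup_(i : nat) [set x | x \in `](i.+1%:R)^-1, i.+1%:R[%R /\ discontinuity h x].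
have cD : countable D.
  apply: bigcup_countable => // i _; apply: discontinuity_countable.
  move=> x y; rewrite !inE/= => /andP[ix _] _ xy; apply: hi => //.
  by move: ix; rewrite bnd_simp; apply: lt_le_trans; rewrite invr_gt0.
exists D; split.
- by apply: countable_measurable => // t; exact: measurable_set1.
- exact: countable_lebesgue_measure0.
move=> x /= /not_implyP[x0 nc].
have dx := continuous_or_discontinuous hi x0 (hr x x0) nc.
exists (Num.truncn (x + x^-1)) => //=; split=> //.
have le : x + x^-1 < (Num.truncn (x + x^-1)).+1%:R by exact: truncnS_gt.
have xV : 0 < x^-1 by rewrite invr_gt0.
rewrite in_itv/=; apply/andP; split; last by apply: lt_trans le; rewrite ltrDl.
rewrite invf_plt ?posrE//; apply: lt_trans le; by rewrite ltrDr.
Qed.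

End monotone_ae.

(** * Gluing of C^1 functions *)

Section smooth_functions.
Variable R : realType.
Implicit Types (f g D E w : R -> R) (u v x y q c L : R).

(** Stands in for the local absolute continuity of a derivative, which it implies; it is stable
    under sums, products and gluing. *)
Definition loc_lipschitz D := forall u v, 0 < u -> exists L, 0 <= L /\
  forall x y, u <= x -> x <= v -> u <= y -> y <= v -> `|D y - D x| <= L * `|y - x|.

Lemma loc_lipschitz_cst c : loc_lipschitz (fun=> c).
Proof. by move=> u v u0; exists 0; split=> // *; rewrite subrr normr0 mul0r. Qed.

Lemma loc_lipschitzD D E : loc_lipschitz D -> loc_lipschitz E ->
  loc_lipschitz (fun x => D x + E x).
Proof.
move=> lD lE u v u0; have [L [L0 HL]] := lD u v u0; have [L' [L'0 HL']] := lE u v u0.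
exists (L + L'); split=> [|x y ux xv uy yv]; first exact: addr_ge0.
rewrite opprD addrACA mulrDl; apply: (le_trans (ler_normD _ _)).
by apply: lerD; [exact: HL|exact: HL'].
Qed.

Lemma loc_lipschitzM D E : loc_lipschitz D -> loc_lipschitz E ->
  loc_lipschitz (fun x => D x * E x).
Proof.
move=> lD lE u v u0; have [L [L0 HL]] := lD u v u0; have [L' [L'0 HL']] := lE u v u0.
have bnd (F : R -> R) K : 0 <= K -> (forall x y, u <= x -> x <= v -> u <= y -> y <= v ->
    `|F y - F x| <= K * `|y - x|) -> forall x, u <= x -> x <= v -> `|F x| <= `|F u| + K * (v - u).
  move=> K0 HF x ux xv; have := HF u x (lexx u) (le_trans ux xv) ux xv.
  have := ler_normD (F u) (F x - F u); rewrite addrC subrK.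
  have : K * `|x - u| <= K * (v - u).
    by apply: ler_wpM2l => //; rewrite ger0_norm ?subr_ge0// lerD2r.
  lra.
have bD := bnd D L L0 HL; have bE := bnd E L' L'0 HL'.
set B := `|D u| + _ in bD; set B' := `|E u| + _ in bE.
exists (`|B'| * L + `|B| * L'); split=> [|x y ux xv uy yv].
  by apply: addr_ge0; exact: mulr_ge0.
have -> : D y * E y - D x * E x = (D y - D x) * E y + D x * (E y - E x) by ring.
apply: (le_trans (ler_normD _ _)); rewrite !normrM mulrDl; apply: lerD.
  rewrite mulrAC [`|_| * `|_|]mulrC -mulrA; apply: ler_pM => //.
    by apply: (le_trans (bE y uy yv)); exact: ler_norm.
  by rewrite mulrC; exact: HL.
rewrite -mulrA; apply: ler_pM => //; last exact: HL'.
by apply: (le_trans (bD x ux xv)); exact: ler_norm.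
Qed.

Lemma loc_lipschitz_powR q : loc_lipschitz (fun x => x `^ q).
Proof.
move=> u v u0; exists (`|q| * (u `^ (q - 1) + v `^ (q - 1))); split.
  by rewrite mulr_ge0 ?addr_ge0 ?powR_ge0.
suff H x y : u <= x -> x < y -> y <= v ->
    `|y `^ q - x `^ q| <= `|q| * (u `^ (q - 1) + v `^ (q - 1)) * `|y - x|.
  move=> x y ux xv uy yv; have [xy|yx|->] := ltgtP x y.
  - exact: H.
  - by rewrite distrC [`|y - x|]distrC; exact: H.
  - by rewrite !subrr normr0 mulr0.
move=> ux xy yv; have x0 := lt_le_trans u0 ux.
have [s [xs sy ->]] := @deriv_MVT R (fun x => x `^ q) (fun s => q * s `^ (q - 1)) x y xy
  (fun s xs _ => is_derive1_powR q (lt_le_trans x0 xs)).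
have s0 := lt_trans x0 xs.
rewrite !normrM; apply: ler_wpM2r => //; apply: ler_wpM2l => //.
rewrite ger0_norm ?powR_ge0//.
have [q1|q1] := leP 0 (q - 1).
  apply: (@le_trans _ _ (v `^ (q - 1))); last by rewrite lerDr powR_ge0.
  have sv : s <= v := ltW (lt_le_trans sy yv).
  by apply: ge0_ler_powR => //; rewrite nnegrE ltW// (lt_le_trans s0).
apply: (@le_trans _ _ (u `^ (q - 1))); last by rewrite lerDl powR_ge0.
rewrite -[q - 1]opprK; apply: powR_le_neg => //; first by rewrite oppr_gt0.
exact: le_trans (ltW xs).
Qed.

Lemma loc_lipschitz_eq D E : (forall x, 0 < x -> D x = E x) ->
  loc_lipschitz E -> loc_lipschitz D.
Proof.
move=> DE lE u v u0; have [L [L0 HL]] := lE u v u0; exists L; split=> // x y ux xv uy yv.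
by rewrite !DE ?HL// (lt_le_trans u0).
Qed.

Lemma loc_lipschitz_dominated D E : loc_lipschitz E ->
  (forall u v, 0 < u -> exists c, 0 <= c /\ forall x y, u <= x -> x <= v -> u <= y -> y <= v ->
    `|D y - D x| <= c * `|E y - E x|) -> loc_lipschitz D.
Proof.
move=> lE DE u v u0; have [L [L0 HL]] := lE u v u0; have [c [c0 Hc]] := DE u v u0.
exists (c * L); split=> [|x y ux xv uy yv]; first exact: mulr_ge0.
apply: (le_trans (Hc _ _ _ _ _ _)) => //; rewrite -mulrA; apply: ler_wpM2l => //.
exact: HL.
Qed.

Lemma loc_lipschitz_glue D E q : D q = E q -> loc_lipschitz D -> loc_lipschitz E ->
  loc_lipschitz (fun x => if x <= q then D x else E x).
Proof.
move=> DE lD lE u v u0; have [L [L0 HL]] := lD u v u0; have [L' [L'0 HL']] := lE u v u0.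
exists (L + L'); split; first exact: addr_ge0.
suff H x y : u <= x -> x <= y -> y <= v ->
    `|(if y <= q then D y else E y) - (if x <= q then D x else E x)| <= (L + L') * `|y - x|.
  move=> x y ux xv uy yv; have [xy|/ltW yx] := leP x y; first exact: H.
  by rewrite distrC [`|y - x|]distrC; exact: H.
move=> ux xy yv; rewrite mulrDl; have uy := le_trans ux xy; have xv := le_trans xy yv.
case: (leP y q) => yq.
  rewrite (le_trans xy yq); apply: (le_trans (HL _ _ ux xv uy yv)).
  by rewrite lerDl mulr_ge0.
case: (leP x q) => xq; last first.
  by apply: (le_trans (HL' _ _ ux xv uy yv)); rewrite lerDr mulr_ge0.
have uq := le_trans ux xq; have qv := ltW (lt_le_trans yq yv).
have -> : E y - D x = (D q - D x) + (E y - E q) by rewrite DE; ring.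
apply: (le_trans (ler_normD _ _)); apply: lerD.
  apply: (le_trans (HL _ _ ux xv uq qv)); apply: ler_wpM2l => //.
  by rewrite !ger0_norm ?subr_ge0// lerD2r ltW.
apply: (le_trans (HL' _ _ uq qv uy yv)); apply: ler_wpM2l => //.
by rewrite !ger0_norm ?subr_ge0// ?lerB// ltW.
Qed.

Definition smooth w D := (forall x, 0 < x -> is_derive x 1 w (D x)) /\ loc_lipschitz D.

Lemma smooth_eq w w' D D' : (forall x, 0 < x -> w x = w' x) -> (forall x, 0 < x -> D x = D' x) ->
  smooth w' D' -> smooth w D.
Proof.
move=> ww DD [dw lD]; split; last exact: loc_lipschitz_eq DD lD.
move=> x x0; rewrite DD//; apply: near_eq_is_derive (dw x x0).
by apply: filterS (lt_nbhsr x0) => y y0; rewrite ww.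
Qed.

(** In Caratheodory's form the slope functions of f and g share the value d at q, so their gluing is
    continuous there. *)
Lemma is_derive_glue f g q d : f q = g q -> is_derive q 1 f d -> is_derive q 1 g d ->
  is_derive q 1 (fun x => if x <= q then f x else g x) d.
Proof.
move=> fg /is_derive1_caratheodory[F [FE cF Fq]] /is_derive1_caratheodory[G [GE cG Gq]].
apply/is_derive1_caratheodory; exists (fun x => if x <= q then F x else G x); split.
- by move=> z; rewrite lexx; case: leP => zq; [rewrite FE|rewrite fg GE].
- rewrite /prop_for /continuous_at lexx; apply/cvgrPdist_lt => e e0.
  have /cvgrPdist_lt/(_ e e0) Fn : F z @[z --> q] --> F q := cF.
  have /cvgrPdist_lt/(_ e e0) Gn : G z @[z --> q] --> G q := cG.
  by apply: filterS2 Fn Gn => z; rewrite Fq Gq; case: ifP.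
- by rewrite lexx.
Qed.

Lemma smooth_glue w w' D D' q : 0 < q -> w q = w' q -> D q = D' q ->
  smooth w D -> smooth w' D' ->
  smooth (fun x => if x <= q then w x else w' x) (fun x => if x <= q then D x else D' x).
Proof.
move=> q0 ww DD [dw lD] [dw' lD']; split; last exact: loc_lipschitz_glue.
move=> x x0; have [xq|qx|->] := ltgtP x q.
- apply: near_eq_is_derive (dw x x0); apply: filterS (lt_nbhsl xq) => y yq.
  by rewrite ltW.
- apply: near_eq_is_derive (dw' x x0); apply: filterS (lt_nbhsr qx) => y qy.
  by rewrite leNgt qy.
- by apply: is_derive_glue; rewrite ?DD//; [rewrite -DD; exact: dw|exact: dw'].
Qed.

Lemma smooth_C1_AC w D : smooth w D -> C1_AC w.
Proof.
move=> [dw lD].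
have dE x : 0 < x -> derive1 w x = D x.
  by move=> x0; rewrite derive1E; apply: derive_val; exact: dw.
have {}lD : loc_lipschitz (derive1 w) by exact: loc_lipschitz_eq dE lD.
split=> [x x0|x x0|u v u0 uv].
- by have := dw x x0.
- have [L [L0 HL]] := lD (x / 2) (x * 2) (divr_gt0 x0 (ltr0Sn _ 1)).
  apply: (@continuous_dominated R _ id x L); first exact: cvg_id.
  have := near_half_double x0; apply: filterS => y [xy yx].
  by apply: HL => //; lra.
move=> e e0; have [L [L0 HL]] := lD u v u0.
exists (e / (L + 1)); first by rewrite divr_gt0// ltr_wpDl.
move=> k s t st _ lt.
apply: (@le_lt_trans _ _ (L * \sum_(i < k) (t i - s i))).
  rewrite mulr_sumr; apply: ler_sum => i _; have [us stt tv] := st i (ltn_ord i).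
  apply: (le_trans (HL _ _ us (le_trans stt tv) (le_trans us stt) tv)).
  by rewrite ger0_norm// subr_ge0.
apply: (@le_lt_trans _ _ ((L + 1) * \sum_(i < k) (t i - s i))).
  rewrite mulrDl lerDl mul1r; apply: sumr_ge0 => i _.
  by have [_ stt _] := st i (ltn_ord i); rewrite subr_ge0.
by move: lt; rewrite ltr_pdivlMr ?ltr_wpDl// mulrC.
Qed.

Lemma smooth_increasing w D : smooth w D -> (forall x, 0 < x -> 0 <= D x) -> increasing_pos w.
Proof.
move=> [dw _] D0 x y x0 xy; apply: (deriv_ge0 xy (df := D)).
  by move=> s xs _; apply: dw; exact: lt_le_trans xs.
by move=> s xs _; apply: D0; exact: lt_trans xs.
Qed.

End smooth_functions.

(** * Second derivatives and the differential equation *)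

Section jets.
Variable R : realType.
Implicit Types (f g F A D w h : R -> R) (u v x y c L : R).

Lemma local_jet w f D u v x d : 0 <= u -> u < x -> x < v ->
  (forall y, u < y -> y < v -> w y = f y) ->
  (forall y, 0 < y -> is_derive y 1 f (D y)) -> is_derive x 1 D d ->
  derive1 w x = D x /\ derive1n 2 w x = d.
Proof.
move=> u0 ux xv wf df dD.
have inn y : u < y -> y < v -> \forall z \near y, u < z /\ z < v.
  by move=> uy yv; apply: filterS2 (lt_nbhsr uy) (lt_nbhsl yv) => z.
have dw y : u < y -> y < v -> derive1 w y = D y.
  move=> uy yv; rewrite derive1E; apply: derive_val.
  apply: near_eq_is_derive (df y (le_lt_trans u0 uy)).
  by apply: filterS (inn y uy yv) => z [uz zv]; rewrite wf.
split; first exact: dw.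
rewrite [LHS]derive1E; apply: derive_val.
apply: near_eq_is_derive dD.
by apply: filterS (inn x ux xv) => z [uz zv]; rewrite /= dw.
Qed.

(** F behaves as an integral of h against dA: where h is continuous, its increment is h x times that
    of A up to a vanishing factor. *)
Lemma is_derive_stieltjes F A h x d : is_derive x 1 A d -> {for x, continuous h} ->
  (\forall z \near x, `|F z - F x - h x * (A z - A x)| <= `|h z - h x| * `|A z - A x|) ->
  is_derive x 1 F (h x * d).
Proof.
move=> dA ch near_le.
have := is_derive_cvg dA => cA.
apply: is_derive_of_cvg.
suff : t^-1 * (F (t + x) - F x) - h x * (t^-1 * (A (t + x) - A x)) @[t --> 0^'] --> (0 : R).
  have c1 : h x * (t^-1 * (A (t + x) - A x)) @[t --> 0^'] --> h x * d.
    by apply: cvgM; [exact: cvg_cst|exact: cA].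
  move=> c0; rewrite -[h x * d]add0r.
  have E : (fun t => t^-1 * (F (t + x) - F x)) = (fun t => t^-1 * (F (t + x) - F x)
      - h x * (t^-1 * (A (t + x) - A x)) + h x * (t^-1 * (A (t + x) - A x))).
    by apply: funext => t; rewrite subrK.
  by rewrite E; exact: cvgD c0 c1.
have sh : t + x @[t --> (0 : R)^'] --> x.
  have : t + x @[t --> (0 : R)] --> x.
    by rewrite -[X in _ --> X]add0r; apply: cvgD; [exact: cvg_id|exact: cvg_cst].
  by move=> H S /H; exact: nbhs_dnbhs.
apply/norm_cvg0P.
apply: (@squeeze_cvgr _ _ _ _ (fun=> 0) (fun t => `|h (t + x) - h x| * `|t^-1 * (A (t + x) - A x)|)).
- have : \forall t \near (0 : R)^', `|F (t + x) - F x - h x * (A (t + x) - A x)| <=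
    `|h (t + x) - h x| * `|A (t + x) - A x| by exact: sh near_le.
  apply: filterS => t le; rewrite normr_ge0/=.
  have -> : t^-1 * (F (t + x) - F x) - h x * (t^-1 * (A (t + x) - A x)) =
    t^-1 * (F (t + x) - F x - h x * (A (t + x) - A x)) by ring.
  by rewrite !normrM mulrCA ler_wpM2l.
- exact: cvg_cst.
- rewrite -[X in _ --> X](mul0r `|d|); apply: cvgM.
    rewrite -[X in _ --> X](@normr0 _ R); apply: cvg_norm.
    rewrite -[X in _ --> X](subrr (h x)); apply: cvgB; last exact: cvg_cst.
    by move=> S /ch; exact: sh.
  by apply: cvg_norm.
Qed.

End jets.

Section moment_derivatives.
Variables (R : realType) (p n : R) (h M N : R -> R).
Hypothesis mom : moments p n h M N.

Lemma moment_derivatives (x : R) : 0 < x -> {for x, continuous h} ->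
  is_derive x 1 M (h x * (p * x `^ (p - 1))) /\ is_derive x 1 N (h x * (- n * x `^ (- n - 1))).
Proof.
move=> x0 ch; split; (apply: is_derive_stieltjes ch _; first exact: is_derive1_powR);
  apply: filterS (lt_nbhsr x0) => z z0; have [xz|/ltW zx] := leP x z.
- have := M_lo mom x0 xz; have := M_hi mom x0 xz; have := mom_incr mom x0 xz => hh.
  rewrite [in `|h z - _|]ger0_norm ?subr_ge0// [in `|z `^ p - _|]ger0_norm ?subr_ge0 ?powR_le_pos ?(mom_p mom)//.
  by move=> h1 h2; rewrite ger0_norm; lra.
- have := M_lo mom z0 zx; have := M_hi mom z0 zx; have := mom_incr mom z0 zx => hh.
  rewrite [in `|h z - _|]ler0_norm ?subr_le0// [in `|z `^ p - _|]ler0_norm ?subr_le0 ?powR_le_pos ?(mom_p mom)//.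
  by move=> h1 h2; rewrite ger0_norm; lra.
- have := N_lo mom x0 xz; have := N_hi mom x0 xz; have := mom_incr mom x0 xz => hh.
  rewrite [in `|h z - _|]ger0_norm ?subr_ge0// [in `|z `^ (- n) - _|]ler0_norm ?subr_le0 ?powR_le_neg ?(mom_n mom)//.
  by move=> h1 h2; rewrite ler0_norm; lra.
- have := N_lo mom z0 zx; have := N_hi mom z0 zx; have := mom_incr mom z0 zx => hh.
  rewrite [in `|h z - _|]ler0_norm ?subr_le0// [in `|z `^ (- n) - _|]ger0_norm ?subr_ge0 ?powR_le_neg ?(mom_n mom)//.
  by move=> h1 h2; rewrite ler0_norm; lra.
Qed.

Lemma loc_lipschitz_moments : loc_lipschitz M /\ loc_lipschitz N.
Proof.
split; [apply: loc_lipschitz_dominated (@loc_lipschitz_powR R p) _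
       |apply: loc_lipschitz_dominated (@loc_lipschitz_powR R (- n)) _];
  move=> u v u0; exists (`|h u| + `|h v|); (split; first exact: addr_ge0);
  move=> x y ux xv uy yv.
- exact: (M_lipschitz mom).
- exact: (N_lipschitz mom).
Qed.

End moment_derivatives.

Section ode.
Variables (R : realType) (p n : R) (M N : R -> R).
Hypotheses (p0 : 0 < p) (n0 : 0 < n).
Implicit Types (x mu nu C : R).

Notation sol := (ode_sol p n M N).
Notation slope := (ode_slope p n M N).

(** For b = s2 (1 + p - n) and r = s2 p n the powers x^(-p) and x^n solve the homogeneous equation,
    and the factor 1 / (s2 p n (n + p)) scales the source to - h. Taking M = N = 0 and hx = 0 gives
    the homogeneous case. *)
Lemma sol_ode s2 mu nu x hx : 0 < s2 -> 0 < x ->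
  is_derive x 1 M (hx * (p * x `^ (p - 1))) -> is_derive x 1 N (hx * (- n * x `^ (- n - 1))) ->
  exists d, is_derive x 1 (fun y => (s2 * p * n * (n + p))^-1 * (n * p / (y * y `^ p) * slope mu nu y)) d /\
    s2 * x ^+ 2 * d
      + s2 * (1 + p - n) * x * ((s2 * p * n * (n + p))^-1 * (n * p / (x * x `^ p) * slope mu nu x))
      - s2 * p * n * ((s2 * p * n * (n + p))^-1 * sol mu nu x) = - hx.
Proof.
move=> s20 x0 dM dN.
have dY := is_derive1_powR (n + p) x0.
have dslope := is_derive_sub (is_derive_mul dY (is_derive_sub dN (is_derive_cst nu x 1)))
  (is_derive_sub dM (is_derive_cst mu x 1)).
have dprod := is_derive_cmul (s2 * p * n * (n + p))^-1 (is_derive_cmul (n * p)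
  (is_derive_mul (is_derive1_powR (- p - 1) x0) dslope)).
have E y : 0 < y -> y `^ (- p - 1) = (y * y `^ p)^-1.
  by move=> y0; rewrite -opprD powRN (powRDp _ _ y0) powRr1 ?ltW// mulrC.
eexists; split.
  apply: near_eq_is_derive dprod; apply: filterS (lt_nbhsr x0) => y y0.
  by rewrite E// /ode_slope !mulrA.
rewrite /ode_sol /ode_slope E//.
have X0 := powR_gt0 p x0; have B0 := powR_gt0 n x0.
have -> : x `^ (- p - 1 - 1) = (x * (x * x `^ p))^-1.
  by rewrite (powRDp _ _ x0) E// powRN powRr1 ?ltW// -invfM mulrC.
have -> : x `^ (n + p - 1) = x `^ n * x `^ p / x.
  by rewrite (powRDp _ _ x0) (powRDp _ _ x0) powRN powRr1 ?ltW.
have -> : x `^ (- n - 1) = (x `^ n * x)^-1.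
  by rewrite -opprD powRN (powRDp _ _ x0) powRr1 ?ltW.
have -> : x `^ (p - 1) = x `^ p / x by rewrite (powRDp _ _ x0) powRN powRr1 ?ltW.
have -> : x `^ (n + p) = x `^ n * x `^ p by rewrite (powRDp _ _ x0).
rewrite powRN /cst; field.
by rewrite !gt_eqF ?addr_gt0.
Qed.

End ode.

Section smooth_solutions.
Variables (R : realType) (p n : R).
Implicit Types (h M N w D : R -> R) (x c mu nu : R).

Lemma smooth_addc w D c : smooth w D -> smooth (fun x => w x + c) D.
Proof.
move=> [dw lD]; split=> // x x0; rewrite -[D x]addr0.
exact: is_derive_add (dw x x0) (is_derive_cst c x 1).
Qed.

Lemma smooth_cst c : @smooth R (fun=> c) (fun=> 0).
Proof. by split=> [x _|]; [exact: is_derive_cst|exact: loc_lipschitz_cst]. Qed.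

Lemma smooth_sol M N c mu nu : loc_lipschitz M -> loc_lipschitz N ->
  (forall x, 0 < x -> is_derive x 1 (ode_sol p n M N mu nu) (n * p / (x * x `^ p) * ode_slope p n M N mu nu x)) ->
  smooth (fun x => c * ode_sol p n M N mu nu x)
    (fun x => c * (n * p / (x * x `^ p) * ode_slope p n M N mu nu x)).
Proof.
move=> lM lN ds; split=> [x x0|]; first exact: is_derive_cmul (ds x x0).
apply: (@loc_lipschitz_eq _ _ (fun x => c * (n * p) * (x `^ (- p - 1) *
  (x `^ (n + p) * (N x + - nu) + -1 * (M x + - mu))))).
  move=> x x0; have -> : x `^ (- p - 1) = (x * x `^ p)^-1.
    by rewrite -opprD powRN (powRDp _ _ x0) powRr1 ?ltW// mulrC.
  by rewrite /ode_slope mulN1r !mulrA.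
do ! [exact: loc_lipschitz_cst|exact: loc_lipschitz_powR|by []
     |apply: loc_lipschitzM|apply: loc_lipschitzD].
Qed.

End smooth_solutions.

Lemma max3_eq0 (R : realDomainType) (A B C : R) : A <= 0 -> B <= 0 -> C <= 0 ->
  [\/ A = 0, B = 0 | C = 0] -> Num.max A (Num.max B C) = 0.
Proof.
move=> A0 B0 C0 Z; apply/eqP; rewrite eq_le !ge_max A0 B0 C0 !le_max /=.
by case: Z => ->; rewrite lexx ?orbT.
Qed.

(** * The candidate functions and the variational inequalities *)

Section verification.
Variables (R : realType) (p n : R) (h M N : R -> R).
Hypothesis mom : moments p n h M N.
Implicit Types (x y t C e : R).

Notation a x := (x `^ p).
Notation b x := (x `^ (- n)).
Notation Y x := (x `^ (n + p)).
Notation sol := (ode_sol p n M N).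
Notation hom := (ode_hom p n).
Notation slope := (ode_slope p n M N).

Let p0 : 0 < p := mom_p mom.
Let n0 : 0 < n := mom_n mom.
Let np0 : 0 < n + p. Proof. exact: addr_gt0. Qed.
Let hi : increasing_pos h := mom_incr mom.

Variables k k0 k1 : R.
Hypotheses (kp : 0 < k) (k0p : 0 < k0) (k1p : 0 < k1).
Variables s2 z d g be al : R.
Hypothesis s20 : 0 < s2.
Hypothesis S : smooth_fit p n M N k k0 k1 z d g be al.
Hypothesis O : ordered_points z d g be al.

Let r := s2 * p * n.
Let c := (s2 * p * n * (n + p))^-1.
Let c0 : 0 < c. Proof. by rewrite invr_gt0 !mulr_gt0. Qed.
Let r0 : 0 < r. Proof. by rewrite !mulr_gt0. Qed.
Let cE C : c * ((n + p) * C) = C / r.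
Proof. by rewrite /c /r; field; rewrite !gt_eqF. Qed.

Let mu := M al - k1 * a al - k * a z.
Let mud := M d - k * a d.
Let nud := N d - k * b d.

(** The function w0 between zeta and alpha, written as a solution for zero moments so that [sol_ode]
    applies to it. *)
Let v x := c * ode_sol p n (fun=> 0) (fun=> 0) (- (k * a z)) (- (k * b z)) x.
Let dv x := c * (n * p / (x * a x) * ode_slope p n (fun=> 0) (fun=> 0) (- (k * a z)) (- (k * b z)) x).
Let dsol m q x := c * (n * p / (x * a x) * slope m q x).

Let vE x : v x = c * (k * hom (a z) (b z) x).
Proof. by rewrite /v /ode_sol /ode_hom; congr (_ * _); ring. Qed.

Let vsE x : ode_slope p n (fun=> 0) (fun=> 0) (- (k * a z)) (- (k * b z)) x = k * (Y x * b z - a z).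
Proof. by rewrite /ode_slope; ring. Qed.

Let z0 : 0 < z. Proof. by case: O. Qed.
Let d0 : 0 < d. Proof. by case: O => _ _ []. Qed.
Let dg : d < g. Proof. by case: O => _ _ []. Qed.
Let gb : g < be. Proof. by case: O => _ _ []. Qed.
Let ba : be < al. Proof. by case: O => _ _ []. Qed.
Let g0 : 0 < g. Proof. exact: lt_trans d0 dg. Qed.
Let be0 : 0 < be. Proof. exact: lt_trans g0 gb. Qed.
Let al0 : 0 < al. Proof. exact: lt_trans be0 ba. Qed.
Let hb : h be < - k0. Proof. by case: (system_facts mom kp k0p k1p S O). Qed.
Let ha : k1 < h al. Proof. by case: (system_facts mom kp k0p k1p S O). Qed.
Let zd : z < d. Proof. by case: (system_facts mom kp k0p k1p S O). Qed.
Let hg : h g < - k0.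
Proof. by apply: le_lt_trans hb; apply: hi => //; exact: ltW. Qed.

Let fE x : sol mud nud x = sol (M g - - k0 * a g) (N g - - k0 * b g) x + k * hom (a z) (b z) x.
Proof.
have [_ _ _ E4 E5] := S; rewrite -homZ -sol_hom.
have -> : mud = M g - - k0 * a g - k * a z by rewrite -[LHS](addrK (k * a z)) -E4; ring.
by have -> : nud = N g - - k0 * b g - k * b z by rewrite -[LHS](addrK (k * b z)) -E5; ring.
Qed.

Let uE x : sol mu 0 x = sol (M al - k1 * a al) (N al - k1 * b al) x + k * hom (a z) (b z) x.
Proof.
have [_ E2 E3 _ _] := S; rewrite -homZ -sol_hom.
by have -> : N al - k1 * b al - k * b z = 0 by rewrite -E2 -E3; ring.
Qed.

Let ubE x : sol mu 0 x = sol (M be - - k0 * a be) (N be - - k0 * b be) x + k * hom (a z) (b z) x.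
Proof.
have [E1 _ E3 _ _] := S; rewrite -homZ -sol_hom.
have -> : N be - - k0 * b be - k * b z = 0 by rewrite -E3; ring.
by have -> : mu = M be - - k0 * a be - k * a z by rewrite /mu -E1; ring.
Qed.

Let slope_shift C t : 0 < t -> slope (M t - C * a t - k * a z) (N t - C * b t - k * b z) t
  = k * (Y t * b z - a z).
Proof. by move=> t0; rewrite /ode_slope (powR_pnE p n t0); ring. Qed.

Let slope_g : slope mud nud g = k * (Y g * b z - a z).
Proof.
rewrite -(slope_shift (- k0) g0); have [_ _ _ E4 E5] := S.
have -> : mud = M g - - k0 * a g - k * a z by rewrite -[LHS](addrK (k * a z)) -E4; ring.
by have -> : nud = N g - - k0 * b g - k * b z by rewrite -[LHS](addrK (k * b z)) -E5; ring.
Qed.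

Let slope_be : slope mu 0 be = k * (Y be * b z - a z).
Proof.
rewrite -(slope_shift (- k0) be0); have [E1 _ E3 _ _] := S.
have -> : N be - - k0 * b be - k * b z = 0 by rewrite -E3; ring.
by have -> : mu = M be - - k0 * a be - k * a z by rewrite /mu -E1; ring.
Qed.

Let slope_al : slope mu 0 al = k * (Y al * b z - a z).
Proof.
rewrite -(slope_shift k1 al0); have [_ E2 E3 _ _] := S.
by have -> : N al - k1 * b al - k * b z = 0 by rewrite -E2 -E3; ring.
Qed.

Let vs_ge0 x : z <= x -> 0 <= k * (Y x * b z - a z).
Proof.
move=> zx; rewrite (powR_pnE p n z0) -mulrBl !mulr_ge0 ?powR_ge0 ?(ltW kp)// subr_ge0.
exact: powR_le_pos.
Qed.

Let w1 x := if x <= d then k / r else if x < g then c * sol mud nud x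
  else if x <= be then v x - k0 / r else c * sol mu 0 x.
Let w0 x := if x <= z then k / r else if x < al then v x else c * sol mu 0 x - k1 / r.

(** The derivatives of w1 and w0. Their branches are closed on the right, the form of [smooth_glue];
    by smooth fit the choice of branch at g and al is immaterial. *)
Let D1 x := if x <= d then 0 else if x <= g then dsol mud nud x
  else if x <= be then dv x else dsol mu 0 x.
Let D0 x := if x <= z then 0 else if x <= al then dv x else dsol mu 0 x.

Let sol_d : c * sol mud nud d = k / r. Proof. by rewrite (sol_smooth mom)// cE. Qed.
Let v_g : c * sol mud nud g = v g - k0 / r.
Proof. by rewrite fE (sol_smooth mom)// vE mulrDr cE mulNr addrC. Qed.
Let v_be : c * sol mu 0 be = v be - k0 / r.
Proof. by rewrite ubE (sol_smooth mom)// vE mulrDr cE mulNr addrC. Qed.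
Let v_al : c * sol mu 0 al - k1 / r = v al.
Proof. by rewrite uE (sol_smooth mom)// vE mulrDr cE addrAC subrr add0r. Qed.
Let v_z : v z = k / r.
Proof. by rewrite vE (hom_self mom)// [k * _]mulrC cE. Qed.

Let smooth_v : smooth v dv.
Proof.
apply: smooth_sol; [exact: loc_lipschitz_cst|exact: loc_lipschitz_cst|].
move=> x x0; rewrite vsE.
have -> : ode_sol p n (fun=> 0) (fun=> 0) (- (k * a z)) (- (k * b z)) = hom (k * a z) (k * b z).
  by apply: funext => y; rewrite /ode_sol /ode_hom !sub0r !opprK.
have -> : k * (Y x * b z - a z) = Y x * (k * b z) - k * a z by ring.
exact: is_derive_hom.
Qed.

Let smooth_s m q : smooth (fun x => c * sol m q x) (dsol m q).
Proof.
have [lM lN] := loc_lipschitz_moments mom.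
by apply: smooth_sol => // x x0; exact: (is_derive_sol mom).
Qed.

Let smooth_w1 : smooth w1 D1.
Proof.
apply: (smooth_eq (w' := fun x => if x <= d then k / r else if x <= g then c * sol mud nud x
  else if x <= be then v x - k0 / r else c * sol mu 0 x) _ (fun x _ => erefl (D1 x))).
  move=> x x0; rewrite /w1; case: (ltgtP x g) => [//|//|->].
  by rewrite (ltW gb) v_g.
apply: (smooth_glue d0 _ _ (smooth_cst _)); [by rewrite (ltW dg) sol_d| |].
  by rewrite (ltW dg) /dsol (slope_smooth p n M N)// !mulr0.
apply: (smooth_glue g0 _ _ (smooth_s mud nud)); [by rewrite (ltW gb) v_g| |].
  by rewrite (ltW gb) /dsol slope_g /dv vsE.
apply: (smooth_glue be0 _ _ (smooth_addc _ smooth_v) (smooth_s mu 0)); first by rewrite v_be.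
by rewrite /dsol slope_be /dv vsE.
Qed.

Let smooth_w0 : smooth w0 D0.
Proof.
apply: (smooth_eq (w' := fun x => if x <= z then k / r else if x <= al then v x
  else c * sol mu 0 x - k1 / r) _ (fun x _ => erefl (D0 x))).
  move=> x x0; rewrite /w0; case: (ltgtP x al) => [//|//|->].
  by rewrite v_al.
have zal : z < al by case: O.
apply: (smooth_glue z0 _ _ (smooth_cst _)); [by rewrite (ltW zal) v_z| |].
  by rewrite (ltW zal) /dv vsE (powR_pnE p n z0) subrr !mulr0.
apply: (smooth_glue al0 _ _ smooth_v (smooth_addc _ (smooth_s mu 0))); first by rewrite v_al.
by rewrite /dsol slope_al /dv vsE.
Qed.

Let fac x t : 0 < x -> 0 <= t -> 0 <= c * (n * p / (x * a x) * t).
Proof.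
move=> x0 t0; rewrite mulr_ge0 ?(ltW c0)// mulr_ge0// ltW//.
by rewrite divr_gt0 ?mulr_gt0 ?powR_gt0.
Qed.

Let slope_tail x : be <= x -> 0 <= slope mu 0 x.
Proof.
have H : 0 <= slope mu 0 be by rewrite slope_be vs_ge0// ltW// (lt_trans zd)// (lt_trans dg).
rewrite le_eqVlt => /predU1P[<-//|bx]; apply: (le_trans H).
exact: ltW (slope0_increasing mom _ be0 bx).
Qed.

Lemma verification_increasing : increasing_pos w1 /\ increasing_pos w0.
Proof.
split; [apply: smooth_increasing smooth_w1 _|apply: smooth_increasing smooth_w0 _] => x x0.
- rewrite /D1; case: (leP x d) => // dx; case: (leP x g) => xg; last case: (leP x be) => xb.
  + apply: fac => //; apply: (slope_between mom d0 (ltW dx) xg).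
      by rewrite (slope_smooth p n M N).
    by rewrite slope_g vs_ge0// ltW// (lt_trans zd).
  + by rewrite /dv vsE fac// vs_ge0// ltW// (lt_trans _ xg)// (lt_trans zd).
  + by apply: fac => //; exact: slope_tail (ltW xb).
- rewrite /D0; case: (leP x z) => // zx; case: (leP x al) => xa.
  + by rewrite /dv vsE fac// vs_ge0// ltW.
  + by apply: fac => //; exact: slope_tail (ltW (lt_trans ba xa)).
Qed.

Let w1_ge x : 0 < x -> k / r <= w1 x.
Proof.
move=> x0; have [xd|dx] := leP x d; first by rewrite /w1 xd.
have := verification_increasing.1 d x d0 (ltW dx); by rewrite {1}/w1 lexx.
Qed.

Let w0_ge x : 0 < x -> k / r <= w0 x.
Proof.
move=> x0; have [xz|zx] := leP x z; first by rewrite /w0 xz.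
have := verification_increasing.2 z x z0 (ltW zx); by rewrite {1}/w0 lexx.
Qed.

Let w0_mid x : z < x -> x <= al -> w0 x = v x.
Proof.
move=> zx xa; rewrite /w0 (lt_geF zx); move: xa; rewrite le_eqVlt => /predU1P[->|->//].
by rewrite ltxx v_al.
Qed.

Let switch_cost x : 0 < x -> w0 x - w1 x - k0 / r <= 0 /\ w1 x - w0 x - k1 / r <= 0.
Proof.
move=> x0; have K0 : 0 < k0 / r by rewrite divr_gt0.
have K1 : 0 < k1 / r by rewrite divr_gt0.
have zal : z < al by case: O.
(* The curve leaving - k0 smoothly at g is still at least - k0 at d, so w0 - w1 is at most k0 / r at
   d; before d, w0 is only smaller. *)
have hom_d : k * hom (a z) (b z) d <= (n + p) * k + (n + p) * k0.
  have := sol_ge_left mom d0 (ltW dg) (ltW hg).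
  have := fE d; rewrite (sol_smooth mom k d0); lra.
have hom_ge_k x' : 0 < x' -> (n + p) * k <= k * hom (a z) (b z) x'.
  by move=> x'0; rewrite mulrC ler_pM2l// (hom_ge mom).
have [xz|zx] := leP x z.
  by rewrite /w0 /w1 xz (le_trans xz (ltW zd)); split; lra.
have [xd|dx] := leP x d.
  have := w0_ge x0; have xa : x <= al by rewrite (le_trans xd)// ltW// (lt_trans dg)// (lt_trans gb).
  rewrite w0_mid// /w1 xd vE => w0g.
  have hx : k * hom (a z) (b z) x <= k * hom (a z) (b z) d.
    rewrite ler_pM2l//; move: xd; rewrite le_eqVlt => /predU1P[->//|xd].
    exact: ltW (hom_increasing mom z0 (ltW zx) xd).
  have : c * (k * hom (a z) (b z) x) <= c * ((n + p) * k + (n + p) * k0).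
    by rewrite ler_pM2l// (le_trans hx).
  by rewrite [c * (_ * k + _)]mulrDr !cE; split; lra.
have [xg|gx] := ltP x g.
  have xa : x <= al by rewrite ltW// (lt_trans xg)// (lt_trans gb).
  rewrite w0_mid// /w1 (lt_geF dx) xg vE -(cE k0) -(cE k1).
  have fx : (n + p) * - k0 <= sol (M g - - k0 * a g) (N g - - k0 * b g) x.
    exact: (sol_ge_left mom x0 (ltW xg) (ltW hg)).
  (* Left of g this curve does not increase, so it is bounded by its value at d, which is (n + p) k
     - k hom <= 0. *)
  have fd : sol (M g - - k0 * a g) (N g - - k0 * b g) x <= (n + p) * k1.
    apply: (@le_trans _ _ (sol (M g - - k0 * a g) (N g - - k0 * b g) d)).
      apply: (sol_nonincreasing mom d0 (ltW dx)) => s ds sx.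
      have s0 := lt_trans d0 ds; have sg := lt_trans sx xg.
      have := slope_lo mom (M g - - k0 * a g) (N g - - k0 * b g) s0 (ltW sg).
      rewrite (slope_smooth p n M N)//.
      have : 0 <= (Y g - Y s) * ode_tilt n h N (N g - - k0 * b g) g.
        have -> : ode_tilt n h N (N g - - k0 * b g) g = b g * (- k0 - h g) by rewrite /ode_tilt; ring.
        rewrite !mulr_ge0 ?powR_ge0 ?subr_ge0 ?(ltW hg)//.
        by apply: powR_le_pos => //; exact: ltW.
      lra.
    have := fE d; rewrite (sol_smooth mom k d0); have := hom_ge_k d d0.
    have : 0 < (n + p) * k1 by rewrite mulr_gt0.
    lra.
  have := fE x => fEx.
  have l1 : k * hom (a z) (b z) x - sol mud nud x <= (n + p) * k0 by lra.
  have l2 : sol mud nud x - k * hom (a z) (b z) x <= (n + p) * k1 by lra.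
  by split; rewrite subr_le0 -?mulrBr ler_pM2l.
have [xb|bx] := leP x be.
  have xa : x <= al by rewrite ltW// (le_lt_trans xb).
  by rewrite w0_mid// /w1 (lt_geF dx) (le_gtF gx) xb; split; lra.
have [xa|ax] := leP x al.
  rewrite w0_mid// /w1 (lt_geF dx) (le_gtF gx) (lt_geF bx) vE uE.
  case: S => E1 E2 _ _ _.
  have := switch_sol_ge mom be0 ba (ltW hb) E1 E2 x0 xa.
  have := switch_sol_le mom be0 ba E1 E2 (ltW bx) xa.
  set u := sol _ _ x; move=> u1 u2.
  rewrite -(cE k0) -(cE k1).
  have l1 : c * - ((n + p) * k0) <= c * u by rewrite ler_pM2l.
  have l2 : c * u <= c * ((n + p) * k1) by rewrite ler_pM2l.
  by move: l1 l2; split; lra.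
have zx' : z < x by [].
rewrite /w0 /w1 (lt_geF zx) (le_gtF (ltW ax)) (lt_geF dx) (le_gtF gx) (lt_geF bx).
by split; lra.
Qed.

Let h_le x : 0 < x -> x <= be -> h x < - k0.
Proof. by move=> x0 xb; apply: le_lt_trans hb; exact: hi. Qed.

(** On each open branch one of the three terms vanishes identically; the signs of the others reduce
    to h < - k0 up to beta, h > k1 from alpha on, [switch_cost], and the lower bound k / r of w1 and
    w0. The five boundaries and the jumps of h form a null set. *)
Lemma verification_HJB (sg bb rr K1 K0 K : R) :
  (forall x, 0 < x -> h y @[y --> x^'+] --> h x) ->
  sg ^+ 2 = s2 -> bb = s2 * (1 + p - n) -> rr = r ->
  - K = k / r -> K0 = k0 / r -> K1 = k1 / r ->
  HJB bb sg rr h K1 K0 K w1 w0.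
Proof.
move=> hr sgE bE rE KE K0E K1E.
have FF := ae_filter_ringOfSetsType (@lebesgue_measure R).
have good : {ae @lebesgue_measure R, forall x, [/\ x != d, x != g, x != be, x != z & x != al] /\
    (0 < x -> {for x, continuous h})}.
  apply: (@filterS _ _ FF _ _ _ (filterI (ae_neq d) (filterI (ae_neq g) (filterI (ae_neq be)
    (filterI (ae_neq z) (filterI (ae_neq al) (monotone_ae_continuous hi hr))))))).
  by move=> x [? [? [? [? []]]]].
have rk C : r * (C / r) = C by rewrite mulrC divfK// gt_eqF.
have vode x : 0 < x -> exists e, is_derive x 1 dv e /\
    s2 * x ^+ 2 * e + s2 * (1 + p - n) * x * dv x - r * v x = 0.
  move=> x0; have d0' : is_derive x 1 (fun=> 0 : R) (0 * (p * x `^ (p - 1))).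
    by rewrite mul0r; exact: is_derive_cst.
  have d0'' : is_derive x 1 (fun=> 0 : R) (0 * (- n * x `^ (- n - 1))).
    by rewrite mul0r; exact: is_derive_cst.
  have [e [de oe]] := sol_ode p0 n0 (- (k * a z)) (- (k * b z)) s20 x0 d0' d0''.
  by exists e; split => //; rewrite oe oppr0.
have sode m q x : 0 < x -> {for x, continuous h} -> exists e, is_derive x 1 (dsol m q) e /\
    s2 * x ^+ 2 * e + s2 * (1 + p - n) * x * dsol m q x - r * (c * sol m q x) = - h x.
  move=> x0 ch; have [dM dN] := moment_derivatives mom x0 ch.
  by have [e [de oe]] := sol_ode p0 n0 m q s20 x0 dM dN; exists e.
have zal : z < al by case: O.
split; [exact: smooth_C1_AC smooth_w1|exact: smooth_C1_AC smooth_w0| |];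
  apply: (@filterS _ _ FF _ _ _ good) => x [[xd xg xb xz xa] ch] x0;
  have {}ch := ch x0; have [sc0 sc1] := switch_cost x0;
  have g1 := w1_ge x0; have g0' := w0_ge x0;
  rewrite sgE bE rE ?K0E ?K1E KE.
- have B3 : - w1 x + k / r <= 0 by rewrite addrC subr_le0.
  have [xd'|dx] := ltP x d.
    have w1E y : 0 < y -> y < d -> w1 y = k / r by move=> _ yd; rewrite /w1 (ltW yd).
    have [-> ->] := local_jet (lexx 0) x0 xd' w1E (smooth_cst (k / r)).1 (is_derive_cst (0 : R) x 1).
    apply: max3_eq0 => //; rewrite w1E// !mulr0 !add0r ?rk; last by apply: Or33; rewrite addNr.
    by have := h_le x0 (ltW (lt_trans xd' (lt_trans dg gb))); have := k0p; have := kp; lra.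
  have {dx xd} dx : d < x by rewrite lt_neqAle eq_sym xd.
  have [xg'|gx] := ltP x g.
    have w1E y : d < y -> y < g -> w1 y = c * sol mud nud y.
      by move=> dy yg; rewrite /w1 (lt_geF dy) yg.
    have [e [de oe]] := sode mud nud x x0 ch.
    have [-> ->] := local_jet (ltW d0) dx xg' w1E (smooth_s mud nud).1 de.
    have A0 : s2 * x ^+ 2 * e + s2 * (1 + p - n) * x * dsol mud nud x - r * w1 x + h x = 0.
      by rewrite w1E// oe addNr.
    by apply: max3_eq0 => //; [rewrite A0|apply: Or31].
  have {gx xg} gx : g < x by rewrite lt_neqAle eq_sym xg.
  have zx : z < x := lt_trans zd dx.
  have [xb'|bx] := ltP x be.
    have w1E y : g < y -> y < be -> w1 y = v y - k0 / r.
      by move=> gy yb; rewrite /w1 (lt_geF (lt_trans dg gy)) (le_gtF (ltW gy)) (ltW yb).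
    have [e [de oe]] := vode x x0.
    have [-> ->] := local_jet (ltW g0) gx xb' w1E (smooth_addc (- (k0 / r)) smooth_v).1 de.
    apply: max3_eq0 => //.
      have := h_le x0 (ltW xb'); rewrite w1E//; have := rk k0; move: oe; lra.
    apply: Or32; rewrite w1E// w0_mid// ?(ltW (lt_trans xb' ba))//; lra.
  have {bx xb} bx : be < x by rewrite lt_neqAle eq_sym xb.
  (* [x + 1] is an artificial right end, as [local_jet] asks for a bounded branch. *)
  have w1E y : be < y -> y < x + 1 -> w1 y = c * sol mu 0 y.
    move=> b_y _; have gy := lt_trans gb b_y.
    by rewrite /w1 (lt_geF (lt_trans dg gy)) (le_gtF (ltW gy)) (lt_geF b_y).
  have x1 : x < x + 1 by rewrite ltrDl.
  have [e [de oe]] := sode mu 0 x x0 ch.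
  have [-> ->] := local_jet (ltW be0) bx x1 w1E (smooth_s mu 0).1 de.
  have A0 : s2 * x ^+ 2 * e + s2 * (1 + p - n) * x * dsol mu 0 x - r * w1 x + h x = 0.
    by rewrite w1E// oe addNr.
  by apply: max3_eq0 => //; [rewrite A0|apply: Or31].
- have B3 : - w0 x + k / r <= 0 by rewrite addrC subr_le0.
  have [xz'|zx] := ltP x z.
    have w0E y : 0 < y -> y < z -> w0 y = k / r by move=> _ yz; rewrite /w0 (ltW yz).
    have [-> ->] := local_jet (lexx 0) x0 xz' w0E (smooth_cst (k / r)).1 (is_derive_cst (0 : R) x 1).
    apply: max3_eq0 => //; rewrite w0E// ?mulr0 ?add0r ?rk; last by apply: Or33; rewrite addNr.
    by rewrite oppr_le0 ltW.
  have {zx xz} zx : z < x by rewrite lt_neqAle eq_sym xz.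
  have [xa'|ax] := ltP x al.
    have w0E y : z < y -> y < al -> w0 y = v y.
      by move=> zy ya; rewrite /w0 (lt_geF zy) ya.
    have [e [de oe]] := vode x x0.
    have [-> ->] := local_jet (ltW z0) zx xa' w0E smooth_v.1 de.
    have A0 : s2 * x ^+ 2 * e + s2 * (1 + p - n) * x * dv x - r * w0 x = 0 by rewrite w0E.
    by apply: max3_eq0 => //; [rewrite A0|apply: Or31].
  have {ax xa} ax : al < x by rewrite lt_neqAle eq_sym xa.
  have w0E y : al < y -> y < x + 1 -> w0 y = c * sol mu 0 y - k1 / r.
    by move=> a_y _; rewrite /w0 (lt_geF (lt_trans zal a_y)) (le_gtF (ltW a_y)).
  have x1 : x < x + 1 by rewrite ltrDl.
  have [e [de oe]] := sode mu 0 x x0 ch.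
  have [-> ->] := local_jet (ltW al0) ax x1 w0E (smooth_addc (- (k1 / r)) (smooth_s mu 0)).1 de.
  have hx : k1 < h x by apply: lt_le_trans ha _; apply: hi => //; exact: ltW.
  apply: max3_eq0 => //.
    by rewrite w0E//; have := rk k1; move: oe hx; lra.
  have bx := lt_trans ba ax; have gx := lt_trans gb bx.
  by apply: Or32; rewrite w0E// /w1 (lt_geF (lt_trans dg gx)) (le_gtF (ltW gx)) (lt_geF bx); lra.
Qed.

End verification.

(** By monotonicity the limit at 0 is the infimum of h over (0, oo), and an infimum is below c iff
    some value is. *)
Lemma right_lim0_lt (R : realType) (h : R -> R) (c : R) : increasing_pos h ->
  (right_lim0 h < c%:E)%E <-> exists x, 0 < x /\ h x < c.
Proof.
move=> hi.
have H : (h x)%:E @[x --> 0^'+] --> ereal_inf [set (h x)%:E | x in [set` `]0, +oo[ ] ].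
  apply: nondecreasing_at_right_cvge => // x y; rewrite !inE/= => /andP[x0 _] _ xy.
  by rewrite lee_fin; apply: hi => //; move: x0; rewrite bnd_simp.
rewrite /right_lim0 (cvg_lim _ H)//; split.
  move=> /ereal_inf_lt[y [x xi <-]]; rewrite lte_fin => hx; exists x; split=> //.
  by move: xi; rewrite /= in_itv/= andbT.
move=> [x [x0 hx]]; apply: le_lt_trans (_ : (h x)%:E < _)%E; last by rewrite lte_fin.
by apply: ereal_inf_lbound; exists x => //=; rewrite in_itv/= x0.
Qed.

(** * Translation to the data of the problem *)

Section translation.
Variables (R : realType) (b sigma r : R) (h : R -> R) (p n : R).
Hypotheses (Em : exp_m b sigma r = - p) (En : exp_n b sigma r = n).
Hypotheses (p0 : 0 < p) (n0 : 0 < n) (s0 : 0 < sigma ^+ 2).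
Hypotheses (rE : r = sigma ^+ 2 * p * n) (bE : b = sigma ^+ 2 * (1 + p - n)).
Hypothesis hi : increasing_pos h.
Hypothesis int_h : forall x, 0 < x ->
  lebesgue_measure.-integrable `]x, +oo[ (EFin \o (fun s => s `^ (- n - 1) * h s)) /\
  lebesgue_measure.-integrable `]0, x[ (EFin \o (fun s => s `^ (p - 1) * h s)).
Let M := lower_moment p h.
Let N := upper_moment n h.
Hypothesis mom : moments p n h M N.

Variables K1 K0 K : R.
Hypotheses (K1p : 0 < K1) (K0p : 0 < K0).
Let k := - (r * K).
Let k0 := r * K0.
Let k1 := r * K1.
Let mN0 : n != 0. Proof. by rewrite gt_eqF. Qed.
Let pN0 : p != 0. Proof. by rewrite gt_eqF. Qed.
Let r0 : 0 < r. Proof. by rewrite rE; apply: mulr_gt0 => //; exact: mulr_gt0. Qed.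
Let k0p : 0 < k0. Proof. exact: mulr_gt0. Qed.
Let k1p : 0 < k1. Proof. exact: mulr_gt0. Qed.
Let np0 : 0 < n + p. Proof. exact: addr_gt0. Qed.

Notation a x := (x `^ p).
Notation bb x := (x `^ (- n)).
Notation is_entry := (is_entry p n M N k).
Notation is_system := (smooth_fit p n M N k k0 k1).
Notation sol := (ode_sol p n M N).
Notation slope := (ode_slope p n M N).

Let lowB c x y : 0 < x -> x <= y ->
  - p * pint h (- p) c `]x, y[ = M x + c * a x - (M y + c * a y).
Proof. by move=> x0 xy; rewrite (pint_lowerB p0 hi int_h c x0 xy) -/M; field. Qed.
Let upB c x y : 0 < x -> x <= y ->
  n * pint h n c `]x, y[ = N x + c * bb x - (N y + c * bb y).
Proof. by move=> x0 xy; rewrite (pint_upperB n0 hi int_h c x0 xy) -/N; field. Qed.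
Let low c x : 0 < x -> p * pint h (- p) c `]0, x[ = M x + c * a x.
Proof. by move=> x0; rewrite (pint_lower p0 int_h c x0) -/M; field. Qed.
Let up c x : 0 < x -> n * pint h n c `]x, +oo[ = N x + c * bb x.
Proof. by move=> x0; rewrite (pint_upper n0 int_h c x0) -/N; field. Qed.

Lemma systemE z d g be al : ordered_points z d g be al ->
  free_boundary_system b sigma r h K1 K0 K z d g be al <-> is_system z d g be al.
Proof.
move=> [z0 zal [d0 dg gb ba]].
have g0 := lt_trans d0 dg; have be0 := lt_trans g0 gb; have al0 := lt_trans be0 ba.
rewrite /free_boundary_system Em En !opprK.
rewrite lowB ?(ltW ba)// upB ?(ltW ba)// up// upB ?(ltW gb)// up// mulNr low// mulNr opprK low//.
rewrite /smooth_fit -/k -/k0 -/k1 /k /k0 /k1.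
move: (M al) (M be) (M g) (M d) (N al) (N be) (N g) (N d) (a al) (a be) (a g) (a d) (a z)
  (bb al) (bb be) (bb g) (bb d) (bb z) => *.
by split=> -[e1 e2 e3 e4 e5]; split; lra.
Qed.

Section negative.
Hypothesis Kn : K < 0.
Let kp : 0 < k. Proof. by rewrite oppr_gt0 pmulr_rlt0. Qed.
Variable x0 : R.
Hypotheses (x00 : 0 < x0) (hx0 : h x0 < k).
Notation de := (delta_dag b sigma r h K).

Lemma delta_dagP : 0 < de /\ N de = k * bb de.
Proof.
rewrite /delta_dag En.
have [d [d0 Nd]] := level_exists mom x00 hx0.
have : exists d, [set d | 0 < d /\ pint h n (r * K) `]d, +oo[ = 0] d.
  exists d; split=> //; apply: (mulfI mN0); rewrite mulr0 up// Nd /k; ring.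
move=> /getPex[e0 /(congr1 ( *%R n))]; rewrite mulr0; set e := get _ in e0 *.
by rewrite up// => E; split=> //; rewrite /k; lra.
Qed.

Let de0 : 0 < de. Proof. by case: delta_dagP. Qed.
Let Nde : N de = k * bb de. Proof. by case: delta_dagP. Qed.

Let dagger_pairE K1' z al : 0 < K1' -> 0 < z -> de < al ->
  [/\ G1 b sigma r h K K1' de z al = 0 & G2 b sigma r h K K1' de z al = 0] <->
  M al - r * K1' * a al = M de - k * a de + k * a z /\ N al - r * K1' * bb al = k * bb z.
Proof.
move=> K1'0 z0 dal; have := Nde; rewrite /G1 /G2 Em En opprK => Nde'.
by rewrite lowB ?(ltW dal)// [- n * _]mulNr upB ?(ltW dal)// /k; move: Nde'; rewrite /k; split=> -[e1 e2]; split; lra.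
Qed.

Lemma za_dagP K1' : 0 < K1' ->
  is_entry de (r * K1') (za_dag b sigma r h K K1').1 (za_dag b sigma r h K K1').2.
Proof.
move=> K1'0; rewrite /za_dag.
have k10 : 0 < r * K1' by exact: mulr_gt0.
have [z [al [z0 zal dal E1 E2]]] := entry_exists mom kp de0 Nde k10 x00 hx0.
set S := [set za : R * R | _].
have : exists za, S za.
  exists (z, al); rewrite /S/=.
  have [e1 e2] := (dagger_pairE K1'0 z0 dal).2 (conj E1 E2).
  by split=> //; rewrite gt_max dal.
move=> /getPex; case: (get S) => z' al' [/= z'0]; rewrite gt_max => /andP[dal' zal'] e1 e2.
by have [] := (dagger_pairE K1'0 z'0 dal').1 (conj e1 e2).
Qed.

(** With [alpha_dag] as its last argument, [G2] vanishes at (de, de) iff zeta_dag = de. [cap_exists]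
    provides a cost with this property, and [entry_unique] identifies the pair picked by [get] with
    the one constructed. *)
Lemma K1_dagP : h de < 0 ->
  0 < K1_dag b sigma r h K /\
  is_entry de (r * K1_dag b sigma r h K) de (alpha_dag b sigma r h K (K1_dag b sigma r h K)).
Proof.
move=> hde; have [kc [alc [kc0 E]]] := cap_exists mom kp de0 Nde hde.
have entE K1' : 0 < K1' -> G2 b sigma r h K K1' de de (alpha_dag b sigma r h K K1') = 0 <->
    (za_dag b sigma r h K K1').1 = de.
  move=> K1'0; have [z0 zal dal e1 e2] := za_dagP K1'0.
  rewrite /G2 /alpha_dag En [- n * _]mulNr upB ?(ltW dal)//.
  split=> [e3|zE].
    apply: (powR_neg_inj n0) => //; apply: (mulfI (lt0r_neq0 kp)).
    by have := Nde; move: e2 e3; rewrite /k; lra.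
  by have := Nde; move: e2; rewrite zE /k; lra.
rewrite /K1_dag; set S := [set K1 : R | _].
have [] : S (get S).
  apply: getPex; exists (kc / r).
  have kr : 0 < kc / r by rewrite divr_gt0.
  split=> //; apply/entE => //.
  have := za_dagP kr; rewrite mulrCA divff ?gt_eqF// mulr1 => E'.
  by have [<- _] := entry_unique mom kp de0 Nde kc0 E E'.
move=> g0 /(entE _ g0) zE; split=> //.
by have := za_dagP g0; rewrite zE.
Qed.

Notation z := (za_dag b sigma r h K K1).1.
Notation al := (alpha_dag b sigma r h K K1).
Let mu := M al - k1 * a al.
Let nu := N al - k1 * bb al.
Let entry : is_entry de k1 z al. Proof. exact: za_dagP. Qed.

Lemma K1_dag_lt : h de < 0 -> (K1 < K1_dag b sigma r h K) = (z < de).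
Proof.
move=> hde; have [K0' E] := K1_dagP hde.
by rewrite -(cap_compare mom kp de0 Nde hde k1p entry E) ltr_pM2l.
Qed.

Lemma x_hatP : z < de -> let x := x_hat b sigma r h K K1 in
  [/\ de < x, x < al & slope mu nu x = 0].
Proof.
move=> zde; rewrite /x_hat; set S := [set x : R | _].
have SE x : de < x -> x < al -> S x <-> slope mu nu x = 0.
  move=> dx xal; have x00' := lt_trans de0 dx.
  (* The expression defining [x_hat] is minus the slope of the entry curve divided by x^p. *)
  have E : exp_m b sigma r * x `^ exp_m b sigma r * pint h (exp_m b sigma r) (- (r * K1)) `]x, al[
      - exp_n b sigma r * x `^ exp_n b sigma r * pint h (exp_n b sigma r) (- (r * K1)) `]x, al[
      = - (slope mu nu x / a x).
    have -> : exp_m b sigma r * x `^ exp_m b sigma r * pint h (exp_m b sigma r) (- (r * K1)) `]x, al[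
      = x `^ (- p) * (- p * pint h (- p) (- (r * K1)) `]x, al[) by rewrite Em; ring.
    have -> : exp_n b sigma r * x `^ exp_n b sigma r * pint h (exp_n b sigma r) (- (r * K1)) `]x, al[
      = x `^ n * (n * pint h n (- (r * K1)) `]x, al[) by rewrite En; ring.
    rewrite lowB ?(ltW xal)// upB ?(ltW xal)// /ode_slope /mu /nu /k1 (powRDp _ _ x00') !powRN.
    have al0' := lt_trans x00' xal.
    by field; rewrite !gt_eqF ?powR_gt0.
  rewrite /S /=; split=> [[_ _]|s0'].
    rewrite E => /eqP; rewrite oppr_eq0 mulf_eq0 invr_eq0 [a x == 0]gt_eqF ?powR_gt0// orbF.
    by move/eqP.
  by split=> //; rewrite E s0' mul0r oppr0.
have : S (get S).
  apply: getPex; have [x [dx xal sx]] := xhat_exists mom kp k1p de0 Nde entry zde.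
  by exists x; apply/SE.
move=> Sg; case: (Sg) => dx xal _; split=> //.
by move: Sg; move/SE; apply.
Qed.

(** At a zero of the slope the two terms of [sol] are in the ratio n : p, so one of them gives the
    value. By [xhat_min] this value is the minimum of the entry curve over [de, al], which
    identifies [K0_dag] as the depth of that curve. *)
Lemma K0_dagE : z < de ->
  sol mu nu (x_hat b sigma r h K K1) = - ((n + p) * (r * K0_dag b sigma r h K K1)).
Proof.
move=> zde; have [dx xal sx] := x_hatP zde; rewrite /K0_dag En.
set x := x_hat _ _ _ _ _ _ in dx xal sx *; have x00' := lt_trans de0 dx.
have -> : n * x `^ n / r * pint h n (- (r * K1)) `]x, al[
    = x `^ n / r * (n * pint h n (- (r * K1)) `]x, al[) by ring.
rewrite upB ?(ltW xal)//.
have /eqP : slope mu nu x = 0 by [].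
rewrite /ode_slope subr_eq0 => /eqP e; rewrite /ode_sol -e (powRDp _ _ x00') /nu /k1 !powRN.
have al0' := lt_trans x00' xal.
by field; rewrite !gt_eqF ?powR_gt0.
Qed.

Lemma K0_dag_lt : z < de ->
  (K0 < K0_dag b sigma r h K K1) = (sol mu nu (x_hat b sigma r h K K1) < - ((n + p) * k0)).
Proof. by move=> zde; rewrite K0_dagE// ltrN2 ltr_pM2l// ltr_pM2l. Qed.

End negative.
End translation.

(** * The explicit functions of the statement *)

Section explicit_solution.
Variables (R : realType) (b sigma r : R) (h : R -> R) (p n : R).
Hypotheses (Em : exp_m b sigma r = - p) (En : exp_n b sigma r = n).
Hypotheses (p0 : 0 < p) (n0 : 0 < n) (s0 : 0 < sigma ^+ 2).
Hypotheses (rE : r = sigma ^+ 2 * p * n) (bE : b = sigma ^+ 2 * (1 + p - n)).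
Hypothesis hi : increasing_pos h.
Hypothesis hr : forall x, 0 < x -> h y @[y --> x^'+] --> h x.
Hypothesis int_h : forall x, 0 < x ->
  lebesgue_measure.-integrable `]x, +oo[ (EFin \o (fun s => s `^ (- n - 1) * h s)) /\
  lebesgue_measure.-integrable `]0, x[ (EFin \o (fun s => s `^ (p - 1) * h s)).
Let M := lower_moment p h.
Let N := upper_moment n h.
Hypothesis mom : moments p n h M N.

Variables K1 K0 K : R.
Hypotheses (K1p : 0 < K1) (K0p : 0 < K0) (Kn : K < 0).
Let k := - (r * K).
Let k0 := r * K0.
Let k1 := r * K1.
Let r0 : 0 < r. Proof. by rewrite rE; apply: mulr_gt0 => //; exact: mulr_gt0. Qed.
Let kp : 0 < k. Proof. by rewrite oppr_gt0 pmulr_rlt0. Qed.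
Let k0p : 0 < k0. Proof. exact: mulr_gt0. Qed.
Let k1p : 0 < k1. Proof. exact: mulr_gt0. Qed.
Let np0 : 0 < n + p. Proof. exact: addr_gt0. Qed.
Let sN0 : sigma != 0. Proof. by apply: contraTneq s0 => ->; rewrite expr0n ltxx. Qed.

Notation a x := (x `^ p).
Notation bb x := (x `^ (- n)).
Notation sol := (ode_sol p n M N).

Let c := (sigma ^+ 2 * p * n * (n + p))^-1.
Let c0 : 0 < c.
Proof. by rewrite invr_gt0 -rE; exact: mulr_gt0. Qed.

Variables z d g be al : R.
Hypothesis S : smooth_fit p n M N k k0 k1 z d g be al.
Hypothesis O : ordered_points z d g be al.
Let z0 : 0 < z. Proof. by case: O. Qed.
Let d0 : 0 < d. Proof. by case: O => _ _ []. Qed.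
Let dg : d < g. Proof. by case: O => _ _ []. Qed.
Let gb : g < be. Proof. by case: O => _ _ []. Qed.
Let ba : be < al. Proof. by case: O => _ _ []. Qed.
Let g0 : 0 < g. Proof. exact: lt_trans d0 dg. Qed.
Let be0 : 0 < be. Proof. exact: lt_trans g0 gb. Qed.
Let al0 : 0 < al. Proof. exact: lt_trans be0 ba. Qed.
Let hb : h be < - k0. Proof. by case: (system_facts mom kp k0p k1p S O). Qed.
Let hg : h g < - k0.
Proof. by apply: le_lt_trans hb; apply: hi => //; exact: ltW. Qed.
Let hd : h d < k.
Proof.
apply: (@lt_trans _ _ (- k0)); last by rewrite (lt_trans _ kp)// oppr_lt0.
by apply: le_lt_trans hg; apply: hi => //; exact: ltW.
Qed.

Let mud := M d - k * a d.
Let nud := N d - k * bb d.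
Let mu := M al - k1 * a al - k * a z.

Let mud_lt0 : mud < 0.
Proof.
rewrite subr_lt0; apply: (le_lt_trans (mom_tail0 mom d0)).
by rewrite ltr_pM2r// powR_gt0.
Qed.

Let nud_lt0 : nud < 0.
Proof.
have [_ _ E3 _ E5] := S.
have e1 := N_hi mom g0 (ltW gb).
have : h be * (bb g - bb be) < - k0 * (bb g - bb be) by rewrite ltr_pM2r// subr_gt0 powR_lt_neg.
rewrite /nud; move: E3 E5 e1.
move: (N g) (N be) (N d) (bb g) (bb be) (bb d) (bb z) (h be) => *; lra.
Qed.

Let mu_lt0 : mu < 0.
Proof.
have [E1 _ _ E4 _] := S.
have e1 := M_hi mom g0 (ltW gb).
have : h be * (a be - a g) < - k0 * (a be - a g) by rewrite ltr_pM2r// subr_gt0 powR_lt_pos.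
have := mud_lt0; rewrite /mu /mud; move: E1 E4 e1.
move: (M g) (M be) (M d) (M al) (a g) (a be) (a d) (a z) (a al) (h be) => *; lra.
Qed.

Let Gamma1E : Gamma1 b sigma r h K d = - (c * n * mud).
Proof.
rewrite /Gamma1 Em En (pint_lower p0 int_h _ d0) -/M /mud /c /k; field.
by rewrite sN0 !gt_eqF.
Qed.

Let Gamma2E : Gamma2 b sigma r h K d = - (c * p * nud).
Proof.
rewrite /Gamma2 Em En (pint_upper n0 int_h _ d0) -/N /nud /c /k; field.
by rewrite sN0 !gt_eqF.
Qed.

Let Delta1E : Delta1 b sigma r K z = c * n * (k * a z).
Proof.
rewrite /Delta1 Em En opprK /c /k; field.
by rewrite sN0 !gt_eqF.
Qed.

Let Delta2E : Delta2 b sigma r K z = c * p * (k * bb z).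
Proof. by rewrite /Delta2 Em En /c /k opprK; field; rewrite sN0 !gt_eqF. Qed.

Let coef_AE : coef_A b sigma r h K1 K z al = - (c * n * mu).
Proof.
rewrite /coef_A Delta1E Em En opprK (pint_lower p0 int_h _ al0) -/M /mu /c /k1; field.
by rewrite sN0 !gt_eqF.
Qed.

(** mud < 0 since h < k up to d. By the equations of the system, nud and mu - mud are the integrals
    of h + k0 over ]g, be[ against n s^(-n-1) and p s^(p-1), hence negative. *)
Lemma coefs_gt0 : [/\ 0 < Gamma1 b sigma r h K d, 0 < Gamma2 b sigma r h K d,
  0 < coef_A b sigma r h K1 K z al, 0 < Delta1 b sigma r K z & 0 < Delta2 b sigma r K z].
Proof.
rewrite Gamma1E Gamma2E coef_AE Delta1E Delta2E.
by split; rewrite ?oppr_gt0 ?pmulr_rlt0 ?mulr_gt0 ?powR_gt0.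
Qed.

Let R_hE x : 0 < x -> R_h b sigma r h x = c * sol 0 0 x.
Proof.
move=> x0; rewrite /R_h Em En (pint_lower p0 int_h _ x0) (pint_upper n0 int_h _ x0) -/M -/N.
rewrite /ode_sol /c !powRN; field.
by rewrite sN0 !gt_eqF ?powR_gt0.
Qed.

Let solE m q x : 0 < x -> - (c * n * m) * x `^ (- p) + - (c * p * q) * x `^ n + R_h b sigma r h x = c * sol m q x.
Proof.
by move=> x0; rewrite R_hE// /ode_sol !powRN; field; rewrite !gt_eqF ?powR_gt0.
Qed.

Let vE x : 0 < x -> Delta1 b sigma r K z * x `^ (- p) + Delta2 b sigma r K z * x `^ n
  = c * ode_sol p n (fun=> 0) (fun=> 0) (- (k * a z)) (- (k * bb z)) x.
Proof.
by move=> x0; rewrite Delta1E Delta2E /ode_sol !powRN; field; rewrite !gt_eqF ?powR_gt0.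
Qed.

Let WE x : 0 < x -> coef_A b sigma r h K1 K z al * x `^ (- p) + R_h b sigma r h x = c * sol mu 0 x.
Proof. by move=> x0; rewrite coef_AE -(solE _ _ x0); ring. Qed.

Let scaleK C : C = r * C / (sigma ^+ 2 * p * n).
Proof. by rewrite -rE mulrAC divff ?mul1r// gt_eqF. Qed.

Let KE : - K = k / (sigma ^+ 2 * p * n).
Proof. by rewrite [LHS]scaleK mulrN. Qed.

Lemma verification :
  (increasing_pos (fun_w1 b sigma r h K1 K0 K z d g be al) /\
   increasing_pos (fun_w0 b sigma r h K1 K z al)) /\
  HJB b sigma r h K1 K0 K (fun_w1 b sigma r h K1 K0 K z d g be al)
    (fun_w0 b sigma r h K1 K z al).
Proof.
have := verification_HJB mom kp k0p k1p s0 S O hr erefl bE rE KE (scaleK K0) (scaleK K1).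
have := verification_increasing mom kp k0p k1p s0 S O.
set w1 := (X in increasing_pos X /\ _); set w0 := (X in _ /\ increasing_pos X).
have -> : fun_w1 b sigma r h K1 K0 K z d g be al = w1.
  apply: funext => x; rewrite /fun_w1 /w1 Em En KE; case: (leP x d) => // dx.
  have x0 := lt_trans d0 dx; case: (ltP x g) => xg; first by rewrite Gamma1E Gamma2E solE.
  by case: (leP x be) => xb; [rewrite vE// [K0 in LHS]scaleK|rewrite WE].
have -> : fun_w0 b sigma r h K1 K z al = w0.
  apply: funext => x; rewrite /fun_w0 /w0 Em En KE; case: (leP x z) => // zx.
  have x0 := lt_trans z0 zx; case: (ltP x al) => xa; first by rewrite vE.
  by rewrite WE// [K1 in X in _ - X]scaleK.
by [].
Qed.

End explicit_solution.

(** * The equivalence *)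

Section equivalence.
Variables (R : realType) (b sigma r : R) (h : R -> R) (p n : R).
Hypotheses (Em : exp_m b sigma r = - p) (En : exp_n b sigma r = n).
Hypotheses (p0 : 0 < p) (n0 : 0 < n) (s0 : 0 < sigma ^+ 2).
Hypotheses (rE : r = sigma ^+ 2 * p * n) (bE : b = sigma ^+ 2 * (1 + p - n)).
Hypothesis hi : increasing_pos h.
Hypothesis hr : forall x, 0 < x -> h y @[y --> x^'+] --> h x.
Hypothesis int_h : forall x, 0 < x ->
  lebesgue_measure.-integrable `]x, +oo[ (EFin \o (fun s => s `^ (- n - 1) * h s)) /\
  lebesgue_measure.-integrable `]0, x[ (EFin \o (fun s => s `^ (p - 1) * h s)).
Hypothesis mom : moments p n h (lower_moment p h) (upper_moment n h).
Variables K1 K0 K : R.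
Hypotheses (HK1 : 0 < K1) (HK0 : 0 < K0).

Let r0 : 0 < r. Proof. by rewrite rE; apply: mulr_gt0 => //; exact: mulr_gt0. Qed.
Let k0p : 0 < r * K0. Proof. exact: mulr_gt0. Qed.
Let k1p : 0 < r * K1. Proof. exact: mulr_gt0. Qed.

(** The theorem with the Brownian motion reduced to the integrability of the power moments of h. *)
Lemma free_boundary_equivalence :
  (exists zeta delta gamma beta alpha : R,
     [/\ (free_boundary_system b sigma r h K1 K0 K zeta delta gamma beta alpha
          /\ ordered_points zeta delta gamma beta alpha),
         (forall zeta' delta' gamma' beta' alpha' : R,
            free_boundary_system b sigma r h K1 K0 K
              zeta' delta' gamma' beta' alpha' ->
            ordered_points zeta' delta' gamma' beta' alpha' ->
            [/\ zeta' = zeta, delta' = delta, gamma' = gamma, beta' = beta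
              & alpha' = alpha]),
         [/\ 0 < Gamma1 b sigma r h K delta, 0 < Gamma2 b sigma r h K delta,
             0 < coef_A b sigma r h K1 K zeta alpha,
             0 < Delta1 b sigma r K zeta & 0 < Delta2 b sigma r K zeta],
         (increasing_pos
            (fun_w1 b sigma r h K1 K0 K zeta delta gamma beta alpha)
          /\ increasing_pos (fun_w0 b sigma r h K1 K zeta alpha))
       & HJB b sigma r h K1 K0 K
           (fun_w1 b sigma r h K1 K0 K zeta delta gamma beta alpha)
           (fun_w0 b sigma r h K1 K zeta alpha)])
  <->
  [/\ K < 0, (right_lim0 h < (- r * K0)%:E)%E,
      h (delta_dag b sigma r h K) < 0,
      K1 < K1_dag b sigma r h K
    & K0 < K0_dag b sigma r h K K1].
Proof.
have sysE := systemE Em En p0 n0 hi int_h K1 K0 K.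
split=> [[z [d [g [be [al [[S O] _ [_ _ _ _ D2] _ _]]]]]]|[Kn h0 hde K1lt K0lt]].
  have z0 : 0 < z by case: O.
  (* [Delta2] has the sign of - K. *)
  have Kn : K < 0.
    have den : 0 < sigma ^+ 2 * n * (n - - p).
      by rewrite opprK; apply: mulr_gt0; [exact: mulr_gt0|exact: addr_gt0].
    move: D2; rewrite /Delta2 En Em oppr_gt0 pmulr_llt0 ?invr_gt0//.
    by rewrite pmulr_llt0 ?powR_gt0// pmulr_rlt0.
  have kp : 0 < - (r * K) by rewrite oppr_gt0 pmulr_rlt0.
  have {}S := (sysE _ _ _ _ _ O).1 S.
  have [hb _ _] := system_facts mom kp k0p k1p S O.
  have be0 : 0 < be by case: O => _ _ [d0 dg gb _]; exact: lt_trans d0 (lt_trans dg gb).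
  have hbk : h be < - (r * K) by apply: (lt_trans hb); apply: (@lt_trans _ _ 0) => //; rewrite oppr_lt0.
  have [de0 Nde] := delta_dagP En n0 int_h mom be0 hbk.
  have entry := za_dagP Em En p0 n0 s0 rE hi int_h mom Kn be0 hbk HK1.
  have [hde zde xmin] := system_dagger mom kp k0p k1p de0 Nde entry S O.
  split=> //.
  - by apply/(right_lim0_lt _ hi); exists be; rewrite mulNr.
  - by rewrite (K1_dag_lt Em En p0 n0 s0 rE hi int_h mom HK1 Kn be0 hbk hde).
  - rewrite (K0_dag_lt Em En p0 n0 s0 rE hi int_h mom K0 HK1 Kn be0 hbk zde).
    have [dx xal sx] := x_hatP Em En p0 n0 s0 rE hi int_h mom HK1 Kn be0 hbk zde.
    exact: xmin.
have kp : 0 < - (r * K) by rewrite oppr_gt0 pmulr_rlt0.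
move/(right_lim0_lt _ hi): h0 => [x0 [x00 hx0]].
(* Since - r K0 < 0 < - r K, the same x0 serves as the low point of h that the existence of
   [delta_dag] and of the entry pair requires. *)
have hxk : h x0 < - (r * K).
  by apply: (lt_trans hx0); apply: (@lt_trans _ _ 0) => //; rewrite mulNr oppr_lt0.
have [de0 Nde] := delta_dagP En n0 int_h mom x00 hxk.
have entry := za_dagP Em En p0 n0 s0 rE hi int_h mom Kn x00 hxk HK1.
have zde : (za_dag b sigma r h K K1).1 < delta_dag b sigma r h K.
  by rewrite -(K1_dag_lt Em En p0 n0 s0 rE hi int_h mom HK1 Kn x00 hxk hde).
have [dx xal sx] := x_hatP Em En p0 n0 s0 rE hi int_h mom HK1 Kn x00 hxk zde.
move: K0lt; rewrite (K0_dag_lt Em En p0 n0 s0 rE hi int_h mom K0 HK1 Kn x00 hxk zde) => ux.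
have [|z [d [g [be [al [S O]]]]]] := dagger_system mom kp k0p k1p de0 Nde entry zde.
  by exists (x_hat b sigma r h K K1).
have [incr hjb] := verification Em En p0 n0 s0 rE bE hr int_h mom HK1 HK0 Kn S O.
exists z, d, g, be, al; split=> //.
- by split=> //; exact/sysE.
- move=> z' d' g' be' al' S' O'.
  exact: (system_unique mom kp k0p k1p S O ((sysE _ _ _ _ _ O').1 S') O').
- exact: (coefs_gt0 Em En p0 n0 s0 rE hi int_h mom HK1 HK0 Kn S O).
Qed.

End equivalence.

Theorem lemma8 (R : realType) (d : measure_display) (T : measurableType d)
    (P : probability T R) (W : R -> {RV P >-> R}) (b sigma r : R) (h : R -> R)
    (K1 K0 K : R)
    (HW : brownian_motion W) (Hsigma : sigma != 0) (Hr : 0 < r)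
    (Hh : payoff_assumption W b sigma r h) (HK1 : 0 < K1) (HK0 : 0 < K0) :
  (exists zeta delta gamma beta alpha : R,
     [/\ (free_boundary_system b sigma r h K1 K0 K zeta delta gamma beta alpha
          /\ ordered_points zeta delta gamma beta alpha),
         (forall zeta' delta' gamma' beta' alpha' : R,
            free_boundary_system b sigma r h K1 K0 K
              zeta' delta' gamma' beta' alpha' ->
            ordered_points zeta' delta' gamma' beta' alpha' ->
            [/\ zeta' = zeta, delta' = delta, gamma' = gamma, beta' = beta
              & alpha' = alpha]),
         [/\ 0 < Gamma1 b sigma r h K delta, 0 < Gamma2 b sigma r h K delta,
             0 < coef_A b sigma r h K1 K zeta alpha,
             0 < Delta1 b sigma r K zeta & 0 < Delta2 b sigma r K zeta],
         (increasing_pos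
            (fun_w1 b sigma r h K1 K0 K zeta delta gamma beta alpha)
          /\ increasing_pos (fun_w0 b sigma r h K1 K zeta alpha))
       & HJB b sigma r h K1 K0 K
           (fun_w1 b sigma r h K1 K0 K zeta delta gamma beta alpha)
           (fun_w0 b sigma r h K1 K zeta alpha)])
  <->
  [/\ K < 0, (right_lim0 h < (- r * K0)%:E)%E,
      h (delta_dag b sigma r h K) < 0,
      K1 < K1_dag b sigma r h K
    & K0 < K0_dag b sigma r h K K1].
Proof.
have [m0 n0 rE bE] := exp_bounds b Hsigma Hr; have [hr hi hoo _] := Hh.
have p0 : 0 < - exp_m b sigma r by rewrite oppr_gt0.
have int_h x (x0 : 0 < x) := payoff_integrable HW Hsigma Hr Hh x0.
apply: (free_boundary_equivalence (esym (opprK _)) erefl p0 n0) => //.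
- by rewrite exprn_even_gt0.
- by rewrite [LHS]rE; ring.
apply: moments_of_integrable => // [C|x C x0 hx].
  move/cvgryPgt/(_ C): hoo => hC.
  have [x [x0 Cx]] := filter_ex (filterI (nbhs_pinfty_gt (num_real 0)) hC).
  by exists x.
have hC : \forall y \near (x : R)^'+, h y < C by exact: (cvgr_lt _ (hr x x0) _ hx).
have [y [xy Cy]] := filter_ex (filterI (nbhs_right_gt (x : R)) hC).
by exists y.
Qed.
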